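(* Let $k$ be an algebraically closed field of characteristic zero and let $B=\mathcal{O}(SL_2(k))=k[x,y,z,w]$ with $xw-yz=1$. For a finite subgroup $H\subset SL_2(k)$ let $B^H$ be the ring of invariants for the action of $H$ on $SL_2(k)$ by right multiplication. The following equalities hold. (a) $B^{\mathbb{Z}_n}=k[\widehat{x^n+y^n},\widehat{xy}]$ for all $n\ge 2$. (b) $B^{\mathbb{Z}_n}=k[\widehat{x^n+y^n}]$ for all odd $n\ge 3$. (c) $B^{\mathbb{Z}_{2n}}=k[\widehat{f_n}]$ for all odd $n\ge 3$, where $f_n=x^{2n}+(xy)^n+y^{2n}$. (d) $B^{\mathrm{BD}_{4n}}=k[\widehat{r_{2n}}]$ for all $n\ge 2$, where $r_{2n}=x^{2n}+y^{2n}$. (e) $B^{\mathrm{BT}_{24}}=k[\widehat{v_3}]$ for $v_3=xy(x^4-y^4)$. (f) $B^{\mathrm{BO}_{48}}=k[\widehat{v_1}]$ for $v_1=x^8+14x^4y^4+y^8$. (g) $B^{\mathrm{BI}_{120}}=k[\widehat{w_1}]$ for $w_1=xy(x^{10}+11x^5y^5-y^{10})$. Moreover, $B^{\mathrm{BI}_{120}}$ is a UFD.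
   Context: Let $\upsilon$ be the $k$-derivation of $B$ with $\upsilon x=z$, $\upsilon y=w$, $\upsilon z=\upsilon w=0$. For $f\in k[x,y]$ homogeneous of degree $d$, $\widehat{f}$ denotes the $k$-vector space spanned by $\upsilon^jf$, $0\le j\le d$. $k[\widehat{f}]$ (resp. $k[\widehat{f},\widehat{g}]$) denotes the $k$-subalgebra of $B$ generated by $\widehat{f}$ (resp. by $\widehat{f}$ and $\widehat{g}$). Finite subgroups of $SL_2(k)$: let $\zeta_n\in k^*$ have order $n$, $i^2=-1$, $\psi_n=\begin{pmatrix}\zeta_n&0\\ 0&\zeta_n^{-1}\end{pmatrix}$, $\vec{i}=\begin{pmatrix}i&0\\ 0&-i\end{pmatrix}$, $\vec{j}=\begin{pmatrix}0&1\\ -1&0\end{pmatrix}$, $\vec{k}=\begin{pmatrix}0&i\\ i&0\end{pmatrix}$, $\sigma=\frac12(I+\vec{i}+\vec{j}+\vec{k})$, $\kappa=\frac{1}{\sqrt5}\begin{pmatrix}\zeta_5^4-\zeta_5&\zeta_5^2-\zeta_5^3\\ \zeta_5^2-\zeta_5^3&\zeta_5-\zeta_5^4\end{pmatrix}$. Then $\mathbb{Z}_n=\langle\psi_n\rangle$ $(n\ge2)$, $\mathrm{BD}_{4n}=\langle\psi_{2n},\vec{j}\rangle$ $(n\ge 2)$, $\mathrm{BT}_{24}=\langle \mathrm{BD}_8,\sigma^2\rangle$, $\mathrm{BO}_{48}=\langle\mathrm{BT}_{24},\psi_8\rangle$, $\mathrm{BI}_{120}=\langle\psi_5,\kappa,\vec{j}\rangle$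 (with $\mathrm{BD}_8=\langle\vec{i},\vec{j},\vec{k}\rangle$). Right multiplication by $h$ replaces the matrix $\begin{pmatrix} x & y \\ z & w \end{pmatrix}$ by $\begin{pmatrix} x & y \\ z & w \end{pmatrix}h$. *)

(* Defs.v *)
From HB Require Import structures.
From mathcomp Require Import all_boot all_order all_algebra.
From mathcomp Require Import boolp classical_sets.
From mathcomp Require Import mpoly ring.

Set Implicit Arguments.
Unset Strict Implicit.
Unset Printing Implicit Defensive.

Import GRing.Theory.

Local Open Scope classical_set_scope.
Local Open Scope quotient_scope.
Local Open Scope ring_scope.

Definition mx2 (R : Type) (a b c d : R) : 'M[R]_2 :=
  \matrix_(i, j) (if i == 0 then if j == 0 then a else b
                  else if j == 0 then c else d).

Lemma mx2E (R : Type) (M : 'M[R]_2) : M = mx2 (M 0 0) (M 0 1) (M 1 0) (M 1 1).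
Proof.
apply/matrixP => i j; rewrite mxE.
by case: i => [[|[|//]] hi]; case: j => [[|[|//]] hj] /=;
  congr (M _ _); apply/val_inj.
Qed.

Lemma det_mx2 (R : comNzRingType) (a b c d : R) :
  \det (mx2 a b c d) = a * d - b * c.
Proof.
rewrite (expand_det_row _ 0) !big_ord_recl big_ord0 addr0 /cofactor.
rewrite !det_mx11 !mxE /= expr0 expr1 mul1r mulN1r mulrN.
by congr (_ * _ - _ * _).
Qed.

Lemma mul_mx2 (R : pzSemiRingType) (a b c d a' b' c' d' : R) :
  mx2 a b c d *m mx2 a' b' c' d' =
  mx2 (a * a' + b * c') (a * b' + b * d') (c * a' + d * c') (c * b' + d * d').
Proof. by rewrite [LHS]mx2E !mxE !big_ord_recl !big_ord0 !mxE !addr0. Qed.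

Section EvalAt.
Variables (k : fieldType) (C : comAlgType k) (n : nat) (v : n.-tuple C).

Definition eval_at (p : {mpoly k[n]}) : C := mmap (in_alg C) (tnth v) p.

Fact eval_at_zmod : zmod_morphism eval_at.
Proof. by move=> p q; rewrite /eval_at mmapB. Qed.
Fact eval_at_monoid : monoid_morphism eval_at.
Proof. by split=> [|p q]; rewrite /eval_at ?rmorph1 ?rmorphM. Qed.
HB.instance Definition _ :=
  GRing.isZmodMorphism.Build {mpoly k[n]} C eval_at eval_at_zmod.
HB.instance Definition _ :=
  GRing.isMonoidMorphism.Build {mpoly k[n]} C eval_at eval_at_monoid.

Lemma eval_atC a : eval_at a%:MP = a%:A.
Proof. exact: mmapC. Qed.

Lemma eval_atX i : eval_at 'X_i = tnth v i.
Proof. by rewrite /eval_at mmapX mmap1U. Qed.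
End EvalAt.

Section CoordinateRing.
Variable k : fieldType.

Local Notation P := {mpoly k[4]}.

(* x, y, z, w are the variables 0, 1, 2, 3. *)
Definition det_rel : P := 'X_0 * 'X_3 - 'X_1 * 'X_2 - 1.

Definition det_ideal : {pred P} := fun p => `[< exists q, p = q * det_rel >].

Lemma det_idealP p : reflect (exists q, p = q * det_rel) (p \in det_ideal).
Proof. exact: asboolP. Qed.

Lemma det_rel_in : det_rel \in det_ideal.
Proof. by apply/det_idealP; exists 1; rewrite mul1r. Qed.

Lemma det_ideal_zmod : zmod_closed det_ideal.
Proof.
split=> [|p q /det_idealP[p' ->] /det_idealP[q' ->]]; apply/det_idealP.
  by exists 0; rewrite mul0r.
by exists (p' - q'); rewrite mulrBl.
Qed.

Lemma det_ideal_proper : ring_quotient.proper_ideal det_ideal.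
Proof.
split=> [|p q /det_idealP[q' ->]]; last first.
  by apply/det_idealP; exists (p * q'); rewrite mulrA.
apply/det_idealP => -[q /(congr1 (meval (tnth [tuple 1; 0; 0; 1])))].
rewrite mevalM !mevalB mevalM mevalM !mevalXU meval1 /=.
rewrite !(tnth_nth 0) /= => /esym/eqP.
by rewrite mulr1 mulr0 subr0 subrr mulr0 eq_sym oner_eq0.
Qed.

HB.instance Definition _ := GRing.isZmodClosed.Build P det_ideal det_ideal_zmod.
HB.instance Definition _ := isProperIdeal.Build P det_ideal det_ideal_proper.

Local Notation Q := {ideal_quot det_ideal}.

(* The instances are rebuilt from the axioms rather than copied from Q: this
   makes unification between the structures of OSL2 much faster. *)
Definition OSL2 := Q.
HB.instance Definition _ := Choice.on OSL2.
HB.instance Definition _ := GRing.isZmodule.Build OSL2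
  (@addrA Q) (@addrC Q) (@add0r Q) (@addNr Q).
HB.instance Definition _ := GRing.Zmodule_isComNzRing.Build OSL2
  (@mulrA Q) (@mulrC Q) (@mul1r Q) (@mulrDl Q) (@oner_neq0 Q).

Local Notation B := OSL2.

Definition toB : P -> B := \pi_Q.
Definition liftB (b : B) : P := repr (b : Q).

Fact toB_zmod : zmod_morphism toB.
Proof. exact: (@rmorphB _ _ \pi_Q). Qed.
Fact toB_monoid : monoid_morphism toB.
Proof.
by split; [exact: (@rmorph1 _ _ \pi_Q) | exact: (@rmorphM _ _ \pi_Q)].
Qed.
HB.instance Definition _ := GRing.isZmodMorphism.Build P B toB toB_zmod.
HB.instance Definition _ := GRing.isMonoidMorphism.Build P B toB toB_monoid.

Lemma toB_liftB b : toB (liftB b) = b.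
Proof. exact: (@reprK _ Q). Qed.

Lemma toB_eq p q : toB p = toB q <-> exists r, p - q = r * det_rel.
Proof.
split=> [/eqP|pq].
  by rewrite /toB -Quotient.idealrBE => /det_idealP.
by apply/eqP; rewrite /toB -Quotient.idealrBE; apply/det_idealP.
Qed.

Definition scaleB (a : k) (b : B) : B := toB a%:MP * b.

Fact scaleB_A a b v : scaleB a (scaleB b v) = scaleB (a * b) v.
Proof. by rewrite /scaleB mulrA mpolyCM rmorphM. Qed.
Fact scaleB_1 : left_id 1 scaleB.
Proof. by move=> v; rewrite /scaleB rmorph1 mul1r. Qed.
Fact scaleB_Dr : right_distributive scaleB +%R.
Proof. by move=> a u v; rewrite /scaleB mulrDr. Qed.
Fact scaleB_Dl v : {morph scaleB^~ v : a b / a + b}.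
Proof. by move=> a b; rewrite /scaleB mpolyCD rmorphD mulrDl. Qed.
HB.instance Definition _ := GRing.Zmodule_isLmodule.Build k B
  scaleB_A scaleB_1 scaleB_Dr scaleB_Dl.
Fact scaleB_Al (a : k) (u v : B) : a *: (u * v) = a *: u * v.
Proof. exact: mulrA. Qed.
HB.instance Definition _ := GRing.Lmodule_isLalgebra.Build k B scaleB_Al.
HB.instance Definition _ := GRing.Lalgebra_isComAlgebra.Build k B.

Lemma scaleBE (a : k) (b : B) : a *: b = toB a%:MP * b.
Proof. by []. Qed.
Lemma toBC (a : k) : toB a%:MP = a *: (1 : B).
Proof. by rewrite scaleBE mulr1. Qed.
Lemma toBZ a p : toB (a *: p) = a *: toB p.
Proof. by rewrite -mul_mpolyC rmorphM. Qed.

Definition xB := toB 'X_0.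
Definition yB := toB 'X_1.
Definition zB := toB 'X_2.
Definition wB := toB 'X_3.

Lemma detB : xB * wB - yB * zB = 1.
Proof.
apply/eqP; rewrite -subr_eq0 -!rmorphM -rmorphB -(rmorph1 toB) -rmorphB.
apply/eqP; rewrite -(rmorph0 toB); apply/toB_eq.
by exists 1; rewrite subr0 mul1r.
Qed.

Lemma toB_rel : toB det_rel = 0.
Proof.
rewrite -(rmorph0 toB); apply/toB_eq.
by exists 1; rewrite subr0 mul1r.
Qed.

Lemma mderivXU (n : nat) (i j : 'I_n) :
  ('X_j : {mpoly k[n]})^`M(i) = (j == i)%:R.
Proof.
rewrite mderivX mnmE; case: eqVneq => [->|_]; last by rewrite scale0r.
suff -> : (U_(i) - U_(i))%MM = 0%MM :> 'X_{1..n} by rewrite mpolyX0 scale1r.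
by apply/mnmP => l; rewrite !mnmE subnn.
Qed.

Lemma det_rel_d0 : det_rel^`M(0) = 'X_3.
Proof.
rewrite /det_rel !mderivB !mderivM !mderivXU /= -mpolyC1 mderivC.
by rewrite !(mul0r, mulr0, addr0, subr0, mul1r).
Qed.

Lemma det_rel_d1 : det_rel^`M(1) = - 'X_2.
Proof.
rewrite /det_rel !mderivB !mderivM !mderivXU /= -mpolyC1 mderivC.
by rewrite !(mul0r, mulr0, addr0, subr0, mul1r, sub0r).
Qed.

(* The derivation z d/dx + w d/dy of k[x, y, z, w] kills xw - yz - 1, so the
   value below does not depend on the representative of b. *)
Definition upsilon (b : B) : B :=
  zB * toB (liftB b)^`M(0) + wB * toB (liftB b)^`M(1).

Lemma upsilonE p : upsilon (toB p) = zB * toB p^`M(0) + wB * toB p^`M(1).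
Proof.
have /toB_eq[r e] := toB_liftB (toB p).
have {e} e : liftB (toB p) = p + r * det_rel by rewrite -e addrC subrK.
rewrite /upsilon e !mderivD !mderivM det_rel_d0 det_rel_d1.
move: det_rel toB_rel => D D0.
by rewrite !rmorphD !rmorphM rmorphN /= D0 /zB /wB; ring.
Qed.

Lemma upsilon_is_linear (a : k) (b c : B) :
  upsilon (a *: b + c) = a *: upsilon b + upsilon c.
Proof.
rewrite -[b]toB_liftB -[c]toB_liftB -toBZ -rmorphD !upsilonE !mderivD !mderivZ.
by rewrite !rmorphD /= !toBZ !mulrDr -!scalerAr scalerDr addrACA.
Qed.

Lemma upsilonM b c : upsilon (b * c) = upsilon b * c + b * upsilon c.
Proof.
rewrite -[b]toB_liftB -[c]toB_liftB -rmorphM !upsilonE !mderivM.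
by rewrite !rmorphD !rmorphM /=; ring.
Qed.

Lemma upsilon_gen :
  [/\ upsilon xB = zB, upsilon yB = wB, upsilon zB = 0 & upsilon wB = 0].
Proof.
by split; rewrite upsilonE !mderivXU /= ?rmorph0 ?rmorph1 ?mulr0 ?mulr1
  ?addr0 ?add0r.
Qed.

Definition incl_xy : {mpoly k[2]} -> B := eval_at [tuple xB; yB].

(* msize is one more than the degree; hat is meant for homogeneous f. *)
Definition hat (f : {mpoly k[2]}) : set B :=
  let d := (msize f).-1 in
  [set b | exists c : 'I_d.+1 -> k,
     b = \sum_(j < d.+1) c j *: iter j upsilon (incl_xy f)].

Definition subalgebra_gen (S : set B) : set B :=
  smallest (fun A : set B => GRing.subalg_closed (mem A)) S.

Record SL2 := SL2Sub { SL2val : 'M[k]_2; _ : \det SL2val == 1 }.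
HB.instance Definition _ := [isSub for SL2val].
HB.instance Definition _ := [Choice of SL2 by <:].

Fact SL2_mul_subproof (g h : SL2) : \det (val g *m val h) == 1.
Proof. by rewrite det_mulmx (eqP (valP g)) (eqP (valP h)) mulr1. Qed.
Fact SL2_one_subproof : \det (1%:M : 'M[k]_2) == 1.
Proof. by rewrite det1. Qed.
Fact SL2_inv_subproof (g : SL2) : \det (invmx (val g)) == 1.
Proof. by rewrite det_inv (eqP (valP g)) invr1. Qed.
Definition SL2_mul g h := SL2Sub (SL2_mul_subproof g h).
Definition SL2_one := SL2Sub SL2_one_subproof.
Definition SL2_inv g := SL2Sub (SL2_inv_subproof g).

Fact SL2_unit (g : SL2) : val g \in unitmx.
Proof. by rewrite unitmxE (eqP (valP g)) unitr1. Qed.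
Fact SL2_mulA : associative SL2_mul.
Proof. by move=> f g h; apply/val_inj; rewrite /= mulmxA. Qed.
Fact SL2_mul1 : left_id SL2_one SL2_mul.
Proof. by move=> g; apply/val_inj; rewrite /= mul1mx. Qed.
Fact SL2_mulr1 : right_id SL2_one SL2_mul.
Proof. by move=> g; apply/val_inj; rewrite /= mulmx1. Qed.
Fact SL2_mulV : left_inverse SL2_one SL2_inv SL2_mul.
Proof. by move=> g; apply/val_inj; rewrite /= mulVmx // SL2_unit. Qed.
Fact SL2_mulrV : right_inverse SL2_one SL2_inv SL2_mul.
Proof. by move=> g; apply/val_inj; rewrite /= mulmxV // SL2_unit. Qed.
HB.instance Definition _ := isGroup.Build SL2
  SL2_mulA SL2_mul1 SL2_mulr1 SL2_mulV SL2_mulrV.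

Definition is_subgroup (H : set SL2) : Prop :=
  [/\ H 1%g, forall g h, H g -> H h -> H (g * h)%g & forall g, H g -> H g^-1%g].

Definition subgroup_gen (S : set SL2) : set SL2 := smallest is_subgroup S.

Definition coordmx : 'M[B]_2 := mx2 xB yB zB wB.

Definition evalmx (M : 'M[B]_2) : P -> B :=
  eval_at [tuple M 0 0; M 0 1; M 1 0; M 1 1].
HB.instance Definition _ M := GRing.RMorphism.copy (evalmx M)
  (eval_at [tuple M 0 0; M 0 1; M 1 0; M 1 1]).

(* The automorphism of B replacing (x y; z w) by (x y; z w) h. *)
Definition act (h : SL2) (b : B) : B :=
  evalmx (coordmx *m map_mx (in_alg B) (val h)) (liftB b).

Lemma evalmxX (M : 'M[B]_2) :
  [/\ evalmx M 'X_0 = M 0 0, evalmx M 'X_1 = M 0 1,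
      evalmx M 'X_2 = M 1 0 & evalmx M 'X_3 = M 1 1].
Proof. by split; rewrite /evalmx eval_atX. Qed.

Lemma evalmx_rel (M : 'M[B]_2) : \det M = 1 -> evalmx M det_rel = 0.
Proof.
rewrite [M]mx2E det_mx2 -mx2E => dM; case: (evalmxX M) => e0 e1 e2 e3.
by rewrite /det_rel !rmorphB !rmorphM rmorph1 /= e0 e1 e2 e3 dM subrr.
Qed.

Lemma actE h p :
  act h (toB p) = evalmx (coordmx *m map_mx (in_alg B) (val h)) p.
Proof.
have /toB_eq[r e] := toB_liftB (toB p).
have {e} e : liftB (toB p) = p + r * det_rel by rewrite -e addrC subrK.
rewrite /act e rmorphD rmorphM /= evalmx_rel ?mulr0 ?addr0 //.
rewrite det_mulmx det_mx2 detB mul1r det_map_mx (eqP (valP h)).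
exact: rmorph1.
Qed.

Fact act_zmod h : zmod_morphism (act h).
Proof.
move=> b c; rewrite -[b]toB_liftB -[c]toB_liftB -rmorphB !actE.
exact: rmorphB.
Qed.
Fact act_monoid h : monoid_morphism (act h).
Proof.
split=> [|b c]; first by rewrite -(rmorph1 toB) actE !rmorph1.
by rewrite -[b]toB_liftB -[c]toB_liftB -rmorphM !actE; apply: rmorphM.
Qed.
HB.instance Definition _ h :=
  GRing.isZmodMorphism.Build B B (act h) (act_zmod h).
HB.instance Definition _ h :=
  GRing.isMonoidMorphism.Build B B (act h) (act_monoid h).

Lemma act_alg h a : act h a%:A = a%:A.
Proof. by rewrite -toBC actE /evalmx eval_atC toBC. Qed.

Lemma act_coord h :
  map_mx (act h) coordmx = coordmx *m map_mx (in_alg B) (val h).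
Proof.
set M := RHS; have [e0 e1 e2 e3] := evalmxX M.
by rewrite [LHS]mx2E [RHS]mx2E -e0 -e1 -e2 -e3 !mxE /= !actE.
Qed.

Definition invariants (H : set SL2) : set B :=
  [set b | forall h, H h -> act h b = b].

Fact invariants_subring H : subring_closed (mem (invariants H)).
Proof.
split=> [|b c|b c]; rewrite !inE.
- by move=> h _; rewrite rmorph1.
- by move=> iB iC h Hh; rewrite rmorphB /= iB // iC.
- by move=> iB iC h Hh; rewrite rmorphM /= iB // iC.
Qed.

Definition in_invariants H : pred B := mem (invariants H).
HB.instance Definition _ H :=
  GRing.isSubringClosed.Build B (in_invariants H) (invariants_subring H).

Record invariant_ring (H : set SL2) :=
  InvariantRing { inv_val : B; inv_valP : in_invariants H inv_val }.
HB.instance Definition _ H := [isSub for @inv_val H].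
HB.instance Definition _ H := [Choice of invariant_ring H by <:].

(* Explicit instances instead of [SubChoice_isSubComNzRing of _ by <:], with
   which unification is very slow here. *)
Section InvariantRing.
Variable H : set SL2.
Implicit Types b c : invariant_ring H.
Local Notation S := (in_invariants H).

Fact inv_zero_subproof : S 0.
Proof. exact: rpred0. Qed.
Fact inv_one_subproof : S 1.
Proof. exact: rpred1. Qed.
Fact inv_opp_subproof b : S (- inv_val b).
Proof. by apply: rpredNr; apply: inv_valP. Qed.
Fact inv_add_subproof b c : S (inv_val b + inv_val c).
Proof. by apply: rpredD; apply: inv_valP. Qed.
Fact inv_mul_subproof b c : S (inv_val b * inv_val c).
Proof. by apply: rpredM; apply: inv_valP. Qed.
Definition inv_zero := InvariantRing inv_zero_subproof.
Definition inv_one := InvariantRing inv_one_subproof.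
Definition inv_opp b := InvariantRing (inv_opp_subproof b).
Definition inv_add b c := InvariantRing (inv_add_subproof b c).
Definition inv_mul b c := InvariantRing (inv_mul_subproof b c).

Fact inv_addA : associative inv_add.
Proof. by move=> a b c; apply/val_inj/addrA. Qed.
Fact inv_addC : commutative inv_add.
Proof. by move=> a b; apply/val_inj/addrC. Qed.
Fact inv_add0 : left_id inv_zero inv_add.
Proof. by move=> a; apply/val_inj/add0r. Qed.
Fact inv_addN : left_inverse inv_zero inv_opp inv_add.
Proof. by move=> a; apply/val_inj/addNr. Qed.
HB.instance Definition _ :=
  GRing.isZmodule.Build (invariant_ring H) inv_addA inv_addC inv_add0 inv_addN.

Fact inv_mulA : associative inv_mul.
Proof. by move=> a b c; apply/val_inj/mulrA. Qed.
Fact inv_mulC : commutative inv_mul.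
Proof. by move=> a b; apply/val_inj/mulrC. Qed.
Fact inv_mul1 : left_id inv_one inv_mul.
Proof. by move=> a; apply/val_inj/mul1r. Qed.
Fact inv_mulDl : left_distributive inv_mul inv_add.
Proof. by move=> a b c; apply/val_inj/mulrDl. Qed.
Fact inv_one_neq0 : inv_one != inv_zero.
Proof. by rewrite -val_eqE oner_neq0. Qed.
HB.instance Definition _ := GRing.Zmodule_isComNzRing.Build (invariant_ring H)
  inv_mulA inv_mulC inv_mul1 inv_mulDl inv_one_neq0.

Fact inv_val_zmod : zmod_morphism (@inv_val H).
Proof. by []. Qed.
Fact inv_val_monoid : monoid_morphism (@inv_val H).
Proof. by []. Qed.
HB.instance Definition _ :=
  GRing.isZmodMorphism.Build (invariant_ring H) B (@inv_val H) inv_val_zmod.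
HB.instance Definition _ :=
  GRing.isMonoidMorphism.Build (invariant_ring H) B (@inv_val H) inv_val_monoid.

Lemma inv_val_image (b : B) :
  (exists c : invariant_ring H, inv_val c = b) <-> invariants H b.
Proof.
split=> [[[c ic] <-]|ib]; first by move: ic; rewrite /in_invariants /= inE.
have ic : S b by rewrite /in_invariants /= inE.
by exists (InvariantRing ic).
Qed.
End InvariantRing.

End CoordinateRing.

Section Generators.
Variable k : fieldType.
Implicit Types z i s : k.

Definition psi z : 'M[k]_2 := mx2 z 0 0 z^-1.
Definition quat_i i : 'M[k]_2 := mx2 i 0 0 (- i).
Definition quat_j : 'M[k]_2 := mx2 0 1 (-1) 0.
Definition quat_k i : 'M[k]_2 := mx2 0 i i 0.
Definition sigma i : 'M[k]_2 :=
  2%:R^-1 *: (1%:M + quat_i i + quat_j + quat_k i).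
Definition kappa z s : 'M[k]_2 :=
  s^-1 *: mx2 (z ^+ 4 - z) (z ^+ 2 - z ^+ 3) (z ^+ 2 - z ^+ 3) (z - z ^+ 4).

(* The elements of SL_2 whose matrix lies in S. The lemmas below show that no
   generator is lost when S is a set of the matrices above. *)
Definition SL2_of (S : set 'M[k]_2) : set (SL2 k) := [set g | S (val g)].

Lemma det_psi z : z != 0 -> \det (psi z) = 1.
Proof. by move=> z0; rewrite det_mx2 mulfV // mulr0 subr0. Qed.

Lemma det_quat i : i ^+ 2 = -1 ->
  [/\ \det (quat_i i) = 1, \det quat_j = 1 & \det (quat_k i) = 1].
Proof.
rewrite expr2 => ii; split; rewrite det_mx2 ?mulrN ?ii;
  by rewrite ?mulr0 ?mul0r ?mulr1 ?subr0 ?sub0r ?opprK.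
Qed.

Lemma det_sigma i : i ^+ 2 = -1 -> 2%:R != 0 :> k -> \det (sigma i) = 1.
Proof.
move=> ii two0; rewrite /sigma [X in _ *: X]mx2E detZ det_mx2 !mxE /=.
set e := (X in _ * X); have -> : e = 2%:R * 2%:R by rewrite /e; ring: ii.
by rewrite expr2 mulrACA mulVf // mulr1.
Qed.

Lemma det_kappa z s : 5.-primitive_root z -> s ^+ 2 = 5%:R -> 5%:R != 0 :> k ->
  \det (kappa z s) = 1.
Proof.
move=> pz ss five0; have z5 := prim_expr_order pz.
have sum0 : 1 + z + z ^+ 2 + z ^+ 3 + z ^+ 4 = 0.
  have z1 : z - 1 != 0 by rewrite subr_eq0 -(expr1 z) -(prim_order_dvd pz).
  apply: (mulfI z1); transitivity (z ^+ 5 - 1); first by ring.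
  by rewrite z5 subrr mulr0.
have s0 : s != 0 by apply: contraNneq five0 => s0; rewrite -ss s0 expr0n.
rewrite /kappa detZ det_mx2; set e := (X in _ * X).
have -> : e = s ^+ 2.
  rewrite ss -[RHS]addr0 -(mulr0 (-1)) -sum0 /e.
  have -> : 1 + z + z ^+ 2 + z ^+ 3 + z ^+ 4 =
    1 + z + z ^+ 2 + z ^+ 3 + z ^+ 4 - (4 - z - z ^+ 3) * (z ^+ 5 - 1).
    by rewrite z5 subrr mulr0 subr0.
  ring.
by rewrite exprVn mulVf // expf_neq0.
Qed.

(* Zgroup z is Z_n for z of order n, BDgroup z is BD_{4n} for z of order 2n. *)
Definition Zgroup z : set (SL2 k) := subgroup_gen (SL2_of [set psi z]).
Definition BDgroup z : set (SL2 k) := subgroup_gen (SL2_of [set psi z; quat_j]).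
Definition BD8 i : set (SL2 k) :=
  subgroup_gen (SL2_of [set quat_i i; quat_j; quat_k i]).
Definition BT24 i : set (SL2 k) :=
  subgroup_gen (BD8 i `|` SL2_of [set sigma i ^+ 2]).
Definition BO48 i z8 : set (SL2 k) :=
  subgroup_gen (BT24 i `|` SL2_of [set psi z8]).
Definition BI120 z5 s : set (SL2 k) :=
  subgroup_gen (SL2_of [set psi z5; kappa z5 s; quat_j]).

Lemma BD8E i z : i ^+ 2 = -1 -> 4.-primitive_root z -> BDgroup z = BD8 i.
Proof.
move=> ii pz; have i0 : i != 0.
  by apply/eqP => i0; move/eqP: ii; rewrite i0 expr0n eq_sym oppr_eq0 oner_eq0.
have iV : i^-1 = - i.
  by apply: (mulfI i0); rewrite mulfV // mulrN -expr2 ii opprK.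
have kE : quat_i i *m quat_j = quat_k i.
  by rewrite mul_mx2 !(mul0r, mulr0, mulr1, addr0, add0r) mulrN1 opprK.
have zi : z = i \/ z = - i.
  suff : (z == i) || (z == - i) by case/orP => /eqP ->; [left | right].
  rewrite -eqf_sqr ii.
  have z4 : (z ^+ 2 - 1) * (z ^+ 2 + 1) = 0.
    by rewrite -subr_sqr expr1n -exprM (prim_expr_order pz) subrr.
  move/eqP: z4; rewrite mulf_eq0 => /orP[|]; last by rewrite addr_eq0.
  by rewrite subr_eq0 -(prim_order_dvd pz).
have gen_group (S : set (SL2 k)) : is_subgroup (subgroup_gen S).
  split=> [H [[] //]|g h Sg Sh H HS|g Sg H HS]; case: (HS) => -[_ mulH invH] _.
    by apply: mulH; [apply: Sg | apply: Sh].
  by apply: invH; apply: Sg.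
have [di dj dk] := det_quat ii.
pose gi := SL2Sub (introT eqP di); pose gj := SL2Sub (introT eqP dj).
pose gk := SL2Sub (introT eqP dk).
have ijk : gk = (gi * gj)%g by apply/val_inj; rewrite /= kE.
have giV : val (gi^-1)%g = mx2 (- i) 0 0 i.
  have e : mx2 (- i) 0 0 i *m val gi = 1%:M.
    rewrite mul_mx2 !(mul0r, mulr0, addr0, add0r) mulNr mulrN -expr2 ii opprK.
    by rewrite [RHS]mx2E !mxE.
  by rewrite -[LHS]mul1mx -e mulmxK // SL2_unit.
have psiE : val gi = psi z \/ val (gi^-1)%g = psi z.
  rewrite giV /psi; case: zi => ->; rewrite ?invrN iV ?opprK.
    by left.
  by right.
rewrite /BDgroup /BD8; apply/seteqP; split; apply: smallest_sub => //.
  have [_ _ invG] := gen_group (SL2_of [set quat_i i; quat_j; quat_k i]).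
  have Gi : subgroup_gen (SL2_of [set quat_i i; quat_j; quat_k i]) gi.
    by apply: sub_gen_smallest; left; left.
  move=> g [|] ge.
    have [e|e] := psiE.
      by rewrite (_ : g = gi) //; apply: val_inj; rewrite ge e.
    by rewrite (_ : g = gi^-1)%g; [apply: invG | apply: val_inj; rewrite ge].
  by apply: sub_gen_smallest; left; right.
have [_ mulG invG] := gen_group (SL2_of [set psi z; quat_j]).
have Gj : subgroup_gen (SL2_of [set psi z; quat_j]) gj.
  by apply: sub_gen_smallest; right.
have Gi : subgroup_gen (SL2_of [set psi z; quat_j]) gi.
  have [e|e] := psiE; first by apply: sub_gen_smallest; left.
  by rewrite -[gi]invgK; apply: invG; apply: sub_gen_smallest; left.
move=> g [[|]|] ge.
- by rewrite (_ : g = gi) //; apply: val_inj.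
- by rewrite (_ : g = gj) //; apply: val_inj.
by rewrite (_ : g = gi * gj)%g; [apply: mulG | rewrite -ijk; apply: val_inj].
Qed.

End Generators.

Section UFD.
Variable R : comNzRingType.

Definition is_unit (u : R) : Prop := exists v, u * v = 1.
Definition irreducible (p : R) : Prop :=
  ~ is_unit p /\ forall a b, p = a * b -> is_unit a \/ is_unit b.
Definition associate (a b : R) : Prop := exists2 u, is_unit u & b = u * a.

Definition is_UFD : Prop :=
  [/\ forall a b : R, a * b = 0 -> a = 0 \/ b = 0,
      forall a : R, a <> 0 -> ~ is_unit a ->
        exists2 s : seq R,
          {in s, forall p, irreducible p} & a = \prod_(p <- s) p
    & forall s t : seq R,
        {in s, forall p, irreducible p} -> {in t, forall p, irreducible p} ->
        \prod_(p <- s) p = \prod_(p <- t) p ->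
        exists2 t', perm_eq t' t &
          size s = size t' /\
          forall j, (j < size s)%N -> associate s`_j t'`_j].
End UFD.

(* Main.v *)
Require Import Defs.
From HB Require Import structures.
From mathcomp Require Import all_boot all_order all_algebra.
From mathcomp Require Import generic_quotient.
From mathcomp Require Import boolp classical_sets mpoly.
From mathcomp Require Import ring zify.

(** From functions to forms. Upsilon belongs to the infinitesimal action of SL_2 on
itself by left multiplication, so it commutes with the right action of [H]. So does
the opposite derivation [V] with [V z = x], [V w = y], [V x = V y = 0], and the two
generate an action of the Lie algebra sl_2 on [B = k[SL2]]. The binary forms
[f (x, y)] are killed by [V], and every function is a sum of iterates [upsilon^j f]
of forms ([upsum_all]). In an invariant function the forms of
highest order [j = J] are recovered by applying [V^J]; they are therefore invariant
too, and can be subtracted ([invariants_sub]). So [B^H] is spanned by the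
[upsilon^j f] with [f] an invariant form, and the algebra [A] generated by the hats
of some invariant forms is [B^H] as soon as it contains all invariant forms.

Transvectants. The algebra [A] is stable under upsilon. Euler's identity expresses
the derivatives of a form [f] through [f], [upsilon f] and the coordinates, and in
the combination [f_x g_y - f_y g_x] the coordinates cancel by the relation
[x w - y z = 1]. Iterating, all transvectants of forms in [A] are in [A]
([tv_in]). This is why one form can suffice: its transvectants provide the other
classical generators of the ring of invariant forms
([invariants_generated_by_forms]).

The groups. For the cyclic and binary dihedral groups, invariant forms are described
by monomials, and the generators come from transvectants that are computed
explicitly; when the group has order [2 n] with [n] odd, it must be shown that an
alternating sum of products of binomial coefficients is not zero
([tv_ff_neq0]). For the binary tetrahedral and icosahedral groups, Klein's argument
applies: the form vanishes exactly on the orbit of [(1, 0)], and any invariant form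
can be made to vanish there by subtracting a product of powers of the Hessian [H] of
the form and of its Jacobian with [H] ([klein_induction]). The binary octahedral
group is reduced to the tetrahedral one, of index 2: the Hessian of [v1] is a
multiple of the square of [v3] ([octahedral_forms]).

Factoriality. By Nagata's criterion ([nagata]) [B] is factorial: the coordinate [z] is
prime, and inverting it gives a localization of a polynomial ring in three variables
([SL2_factorial]); the same chart shows that units are scalars. If an irreducible
invariant [p] divides a product [a b] of invariants, then the greatest common
divisor of [p] and [a] in [B] is multiplied by a scalar by each element of the group.
These scalars define a character of the binary icosahedral group, which is perfect
([BI_weight_trivial]). So this divisor is invariant, and [p] divides [a] or [b]
([irreducible_prime]): the irreducible invariants are prime. *)

Set Implicit Arguments.
Unset Strict Implicit.
Unset Printing Implicit Defensive.

Import GRing.Theory.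
Local Open Scope classical_set_scope.
Local Open Scope ring_scope.

(** * Binary forms and Euler's identity *)
Lemma mpoly_gen_ind n (R : comNzRingType) (Q : {mpoly R[n]} -> Prop) :
  (forall a, Q a%:MP) -> (forall p q, Q p -> Q q -> Q (p + q)) ->
  (forall p q, Q p -> Q q -> Q (p * q)) -> (forall i, Q 'X_i) -> forall p, Q p.
Proof.
move=> QC QD QM QX; have Q0 : Q 0 by rewrite -mpolyC0.
elim/mpolyind => [//|c m p _ _ Qp]; apply: (QD) => //.
rewrite -mul_mpolyC; apply: (QM) => //; rewrite mpolyXE_id.
apply: big_ind => [||i _]; [by rewrite -mpolyC1 | exact: QM | ].
elim: (m i) => [|j IH]; first by rewrite expr0 -mpolyC1.
by rewrite exprS; apply: QM.
Qed.

Lemma form_ind (R : comNzRingType) (Q : {mpoly R[2]} -> Prop) :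
  (forall a, Q a%:MP) -> (forall p q, Q p -> Q q -> Q (p + q)) ->
  (forall p q, Q p -> Q q -> Q (p * q)) -> Q 'X_0 -> Q 'X_1 -> forall p, Q p.
Proof.
move=> QC QD QM Q0 Q1; apply: mpoly_gen_ind => // -[[|[|//]] hi].
  by rewrite (_ : Ordinal hi = 0) //; apply/val_inj.
by rewrite (_ : Ordinal hi = 1) //; apply/val_inj.
Qed.

Section Euler.
Variable k : fieldType.
Local Notation P := {mpoly k[2]}.

(** Euler's identity with an arbitrary scalar [m] in place of the degree: it
passes to derivatives as [m - 1], even from [m = 0], and it is all that the
computations below use of homogeneity. *)
Definition eul (m : k) (f : P) := 'X_0 * f^`M(0) + 'X_1 * f^`M(1) = m *: f.

Lemma eul_deriv m f i : eul m f -> eul (m - 1) f^`M(i).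
Proof.
move=> /(congr1 (mderiv i)); rewrite mderivD !mderivM mderivZ !mderivXU.
rewrite /eul (mderiv_comm i 0) (mderiv_comm i 1) scalerBl scale1r => <-.
move: ('X_0) ('X_1) (f^`M(0)^`M(i)) (f^`M(1)^`M(i)) => X Y a b.
case: i => [[|[|//]] hi].
  rewrite (_ : Ordinal hi = 0) /=; last exact/val_inj.
  by move: (f^`M(0)) (f^`M(1)) => c d; ring.
rewrite (_ : Ordinal hi = 1) /=; last exact/val_inj.
by move: (f^`M(0)) (f^`M(1)) => c d; ring.
Qed.

Lemma dhomog_eul d f : f \is d.-homog -> eul d%:R f.
Proof.
move=> hf; have fE := mpolyE f; rewrite /eul [in RHS]fE.
rewrite [in X in X + _]fE [in X in _ + X]fE !linear_sum /= !mulr_sumr.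
rewrite -big_split !big_seq; apply: eq_bigr => m hm.
have {hm} /= <- := dhomog_mf hf hm.
have XU i : 'X_i * 'X_[m]^`M(i) = (m i)%:R *: 'X_[m] :> P.
  rewrite mderivX -scalerAr -mpolyXD; case: (posnP (m i)) => [->|m0].
    by rewrite !scale0r.
  congr (_ *: 'X_[_]); apply/mnmP => j; rewrite !mnmE.
  by rewrite subnKC //; case: (i =P j) => [<-|_] /=; first exact: m0.
rewrite !mderivZ -!scalerAr !XU -scalerDr -scalerDl -natrD !scalerA mulrC.
rewrite mdegE !big_ord_recl big_ord0 addn0.
by congr ((_ + m _)%:R * _ *: _); apply/val_inj.
Qed.
Lemma mderiv_dhomog d (f : P) i : f \is d.-homog -> f^`M(i) \is d.-1.-homog.
Proof.
move=> hf; rewrite [f]mpolyE linear_sum /= big_seq; apply: rpred_sum => m hm.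
rewrite linearZ /= rpredZ // mderivX.
case: (posnP (m i)) => [->|mi]; first by rewrite scale0r rpred0.
rewrite rpredZ // dhomogX /=; have /= <- := dhomog_mf hf hm.
have Um : (U_(i) <= m)%MM.
  by apply/mnm_lepP => l; rewrite mnmE; case: (i =P l) => [<-|].
by rewrite -{2}(submK Um) mdegD mdeg1 addn1.
Qed.

Lemma char0_natr_neq0 n : [pchar k] =i pred0 -> (0 < n)%N -> n%:R != 0 :> k.
Proof. by move=> char0; rewrite ((pcharf0P k).1 char0) -lt0n. Qed.
End Euler.

(** * The two derivations of k[SL2] and their common invariants *)

(** [B] is kept abstract: only its four generators, the relation and the two
derivations matter. [U] is upsilon and [V] is the opposite derivation
[z |-> x], [w |-> y]; together they generate the infinitesimal action of SL_2
by left multiplication, which commutes with right multiplication. *)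
Section SL2Algebra.
Variables (k : fieldType) (B : comAlgType k) (x y z w : B).
Hypothesis det1 : x * w - y * z = 1.
Hypothesis genB : forall Q : B -> Prop,
  (forall a, Q a%:A) -> (forall b c, Q b -> Q c -> Q (b + c)) ->
  (forall b c, Q b -> Q c -> Q (b * c)) ->
  Q x -> Q y -> Q z -> Q w -> forall b, Q b.
Variables U V : {linear B -> B}.
Hypothesis UM : forall b c : B, U (b * c) = U b * c + b * U c.
Hypothesis VM : forall b c : B, V (b * c) = V b * c + b * V c.
Hypothesis Ux : U x = z. Hypothesis Uy : U y = w.
Hypothesis Uz : U z = 0. Hypothesis Uw : U w = 0.
Hypothesis Vx : V x = 0. Hypothesis Vy : V y = 0.
Hypothesis Vz : V z = x. Hypothesis Vw : V w = y.
Hypothesis char0 : [pchar k] =i pred0.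
Local Notation P := {mpoly k[2]}.
Implicit Types (b c : B) (f g : P).

Definition eval_xy f : B := eval_at [tuple x; y] f.
Local Notation incl := eval_xy.

Lemma inclX : incl 'X_0 = x. Proof. exact: eval_atX. Qed.
Lemma inclY : incl 'X_1 = y. Proof. exact: eval_atX. Qed.
Lemma inclC a : incl a%:MP = a%:A. Proof. exact: eval_atC. Qed.
Lemma inclD f g : incl (f + g) = incl f + incl g. Proof. exact: rmorphD. Qed.
Lemma inclB f g : incl (f - g) = incl f - incl g. Proof. exact: rmorphB. Qed.
Lemma inclM f g : incl (f * g) = incl f * incl g. Proof. exact: rmorphM. Qed.
Lemma inclZ a f : incl (a *: f) = a *: incl f.
Proof. by rewrite -mul_mpolyC inclM inclC -scalerAl mul1r. Qed.
Lemma incl0 : incl 0 = 0. Proof. exact: rmorph0. Qed.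
Lemma incl1 : incl 1 = 1. Proof. exact: rmorph1. Qed.
Lemma incl_sum I r (F : I -> P) :
  incl (\sum_(i <- r) F i) = \sum_(i <- r) incl (F i).
Proof. exact: rmorph_sum. Qed.

Definition upsn j b : B := iter j U b.
Arguments upsn : simpl never.
Fact upsn_is_linear j : linear (upsn j).
Proof.
by elim: j => [|j IH] // a b c; rewrite /upsn !iterS -!/(upsn _ _) IH linearP.
Qed.
HB.instance Definition _ j :=
  GRing.isLinear.Build k B B *:%R (upsn j) (upsn_is_linear j).

Lemma upsnS j b : upsn j.+1 b = U (upsn j b). Proof. by []. Qed.
Lemma upsnSr j b : upsn j.+1 b = upsn j (U b).
Proof. by rewrite /upsn iterSr. Qed.

Lemma der1 (D : {linear B -> B}) :
  (forall b c, D (b * c) = D b * c + b * D c) -> D 1 = 0.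
Proof. by move=> DM; apply: (addrI (D 1)); rewrite addr0 -{3}[1]mulr1 DM mulr1 mul1r. Qed.
Lemma derA (D : {linear B -> B}) a :
  (forall b c, D (b * c) = D b * c + b * D c) -> D a%:A = 0.
Proof. by move=> DM; rewrite linearZ /= der1 ?scaler0. Qed.

Lemma mulz_upsn j b : upsn j (z * b) = z * upsn j b.
Proof. by elim: j => // j IH; rewrite !upsnS IH UM Uz mul0r add0r. Qed.
Lemma mulw_upsn j b : upsn j (w * b) = w * upsn j b.
Proof. by elim: j => // j IH; rewrite !upsnS IH UM Uw mul0r add0r. Qed.
Lemma mulx_upsn j b :
  upsn j.+1 (x * b) = x * upsn j.+1 b + (z * upsn j b) *+ j.+1.
Proof.
elim: j => [|j IH]; first by rewrite !upsnS {1}/upsn /= UM Ux mulr1n addrC.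
rewrite upsnS IH raddfD raddfMn /= !UM Ux Uz mul0r add0r -!upsnS.
by rewrite addrAC -mulrS addrC.
Qed.
Lemma muly_upsn j b :
  upsn j.+1 (y * b) = y * upsn j.+1 b + (w * upsn j b) *+ j.+1.
Proof.
elim: j => [|j IH]; first by rewrite !upsnS {1}/upsn /= UM Uy mulr1n addrC.
rewrite upsnS IH raddfD raddfMn /= !UM Uy Uw mul0r add0r -!upsnS.
by rewrite addrAC -mulrS addrC.
Qed.

Lemma U_incl f : U (incl f) = z * incl f^`M(0) + w * incl f^`M(1).
Proof.
elim/form_ind: f => [a|p q IHp IHq|p q IHp IHq||].
- by rewrite inclC derA // !mderivC incl0 !mulr0 addr0.
- by rewrite !mderivD !inclD raddfD /= IHp IHq !mulrDr addrACA.
- rewrite !mderivM !inclD !inclM UM IHp IHq.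
  by move: (incl p) (incl q) (incl _) (incl _) (incl _) (incl _) => *; ring.
- by rewrite inclX Ux !mderivXU /= ?incl0 ?incl1 mulr1 mulr0 addr0.
- by rewrite inclY Uy !mderivXU /= ?incl0 ?incl1 mulr1 mulr0 add0r.
Qed.

Lemma V_incl f : V (incl f) = 0.
Proof.
elim/form_ind: f => [a|p q IHp IHq|p q IHp IHq||].
- by rewrite inclC derA.
- by rewrite inclD raddfD /= IHp IHq addr0.
- by rewrite inclM VM IHp IHq mulr0 mul0r addr0.
- by rewrite inclX.
- by rewrite inclY.
Qed.

(** The functions [U^j f_x], [U^j f_y] and [U^j f], [U^(j+1) f] determine each
other: Euler's identity and [U f = z f_x + w f_y] are two linear equations whose
matrix is the generic element of SL_2, so Cramer's rule has no denominator. *)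
Lemma upsn_dx m f j : eul m f -> upsn j (incl f^`M(0)) =
  w * ((m - j%:R) *: upsn j (incl f)) - y * upsn j.+1 (incl f).
Proof.
move=> ef; elim: j => [|j IH].
  rewrite subr0 upsnS /upsn /= U_incl -inclZ -ef inclD !inclM inclX inclY.
  rewrite -[LHS]mul1r -det1.
  by move: (incl f^`M(0)) (incl f^`M(1)) => a b; ring.
rewrite upsnS IH raddfB /= !UM Uw Uy linearZ /= -!upsnS.
have -> : m - j.+1%:R = m - j%:R - 1 by rewrite -natr1 opprD addrA.
rewrite mul0r add0r opprD addrA -mulrBr.
by rewrite [(_ - 1) *: _]scalerBl scale1r.
Qed.

Lemma upsn_dy m f j : eul m f -> upsn j (incl f^`M(1)) =
  x * upsn j.+1 (incl f) - z * ((m - j%:R) *: upsn j (incl f)).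
Proof.
move=> ef; elim: j => [|j IH].
  rewrite subr0 upsnS /upsn /= U_incl -inclZ -ef inclD !inclM inclX inclY.
  rewrite -[LHS]mul1r -det1.
  by move: (incl f^`M(0)) (incl f^`M(1)) => a b; ring.
rewrite upsnS IH raddfB /= !UM Uz Ux linearZ /= -!upsnS.
have -> : m - j.+1%:R = m - j%:R - 1 by rewrite -natr1 opprD addrA.
rewrite mul0r add0r [(_ - 1) *: _]scalerBl scale1r mulrBr opprB addrA.
by rewrite [z * _ + _]addrC.
Qed.

Lemma upsnS_incl f j :
  upsn j.+1 (incl f) = z * upsn j (incl f^`M(0)) + w * upsn j (incl f^`M(1)).
Proof. by rewrite upsnSr U_incl raddfD /= mulz_upsn mulw_upsn. Qed.

(** The commutation rule of sl_2 on the irreducible representation spanned by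
[f, U f, U^2 f, ...], of which [f] is the vector killed by [V]. *)
Lemma V_upsnS m f j : eul m f ->
  V (upsn j.+1 (incl f)) = ((m - j%:R) * j.+1%:R) *: upsn j (incl f).
Proof.
elim: j m f => [|j IH] m f ef; rewrite upsnS_incl raddfD /= !VM Vz Vw.
  rewrite !(V_incl : forall f, V (upsn 0 (incl f)) = 0) !mulr0 !addr0 (upsn_dx _ ef) (upsn_dy _ ef) subr0 mulr1.
  rewrite -[RHS]mul1r -det1.
  by move: (_ *: upsn 0 _) (upsn 1 _) => a b; ring.
rewrite (IH _ _ (eul_deriv 0 ef)) (IH _ _ (eul_deriv 1 ef)) -!scalerAr.
rewrite addrACA -scalerDr -upsnS_incl (upsn_dx _ ef) (upsn_dy _ ef).
set a := (m - j.+1%:R) *: _; set b := upsn j.+2 _.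
have -> : x * (w * a - y * b) + y * (x * b - z * a) = a.
  by rewrite -[RHS]mul1r -det1; ring.
by rewrite -scalerDl; congr (_ *: _); rewrite -!natr1; ring.
Qed.

(** [f] is a highest weight vector of weight [d], so that its representation has
dimension [d + 1]; by induction on [d] through the partial derivatives. *)
Lemma upsn_dhomog_eq0 d f j : f \is d.-homog -> (d < j)%N ->
  upsn j (incl f) = 0.
Proof.
suff ud g : g \is d.-homog -> upsn d.+1 (incl g) = 0.
  move=> hf; elim: j => // j IH; rewrite ltnS leq_eqVlt => /orP[/eqP <-|/IH uj].
    exact: ud.
  by rewrite upsnS uj raddf0.
elim: d g => [|d IH] g hg.
  have ec := dhomog_eul hg.
  have [g0 g1] : g^`M(0) = 0 /\ g^`M(1) = 0.
    have gE : g = (g@_0%MM)%:MP.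
      apply/mpolyP => m; rewrite mcoeffC; case: eqVneq => [->|m0].
        by rewrite mulr1.
      rewrite mulr0; apply: (dhomog_nemf_coeff hg).
      by apply: contraNneq m0 => /eqP; rewrite mdeg_eq0 eq_sym.
    by rewrite gE !mderivC.
  by rewrite upsnS /upsn /= U_incl g0 g1 !incl0 !mulr0 addr0.
have dg i : g^`M(i) \is d.-homog by have := mderiv_dhomog i hg.
have eg := dhomog_eul hg.
have /eqP := IH _ (dg 0); have /eqP := IH _ (dg 1).
rewrite (upsn_dx _ eg) (upsn_dy _ eg) subrr scale0r !mulr0 sub0r subr0.
rewrite oppr_eq0 => /eqP ex /eqP ey.
rewrite -[LHS]mul1r -det1 mulrBl -!mulrA mulrCA ex.
by rewrite mulr0 sub0r mulrCA ey mulr0 oppr0.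
Qed.

(** Membership in the span of the [U^j f]; the sum over [j] absorbs the
coefficients because [U^j] is linear in [f]. *)
Definition upsum b := exists J (F : nat -> P),
  b = \sum_(j < J) upsn j (incl (F j)).

Lemma upsum_widen b : upsum b -> exists J (F : nat -> P),
  forall N, (J <= N)%N -> b = \sum_(j < N) upsn j (incl (F j)).
Proof.
move=> [J [F ->]]; exists J, (fun j => if (j < J)%N then F j else 0) => N JN.
rewrite (big_ord_widen N (fun j => upsn j (incl (F j))) JN) big_mkcond /=.
by apply: eq_bigr => j _; case: ifP; rewrite ?incl0 ?raddf0.
Qed.

Lemma upsumD b c : upsum b -> upsum c -> upsum (b + c).
Proof.
move=> /upsum_widen[J [F eF]] /upsum_widen[K [G eG]].
exists (maxn J K), (fun j => F j + G j).
rewrite (eF _ (leq_maxl J K)) (eG _ (leq_maxr J K)) -big_split /=.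
by apply: eq_bigr => j _; rewrite inclD raddfD.
Qed.

Lemma upsum_incl f j : upsum (upsn j (incl f)).
Proof.
exists j.+1, (fun i => if i == j then f else 0).
rewrite big_ord_recr /= eqxx big1 ?add0r // => i _.
by rewrite (ltn_eqF (ltn_ord i)) incl0 raddf0.
Qed.

Lemma upsumZ a b : upsum b -> upsum (a *: b).
Proof.
move=> [J [F ->]]; exists J, (fun j => a *: F j); rewrite scaler_sumr.
by apply: eq_bigr => j _; rewrite inclZ linearZ.
Qed.

Lemma upsum_sum I (r : seq I) (F : I -> B) :
  (forall i, upsum (F i)) -> upsum (\sum_(i <- r) F i).
Proof.
move=> uF; apply: big_ind => // [|b c]; last exact: upsumD.
by exists 0%N, (fun=> 0); rewrite big_ord0.
Qed.

Lemma form_partition f : f = \sum_(d < msize f) pihomog mdeg d f.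
Proof. exact: pihomog_partitionE. Qed.

Lemma upsum_mul t :
  (forall d f j, f \is d.-homog -> upsum (t * upsn j (incl f))) ->
  forall b, upsum b -> upsum (t * b).
Proof.
move=> ut b [J [F ->]]; rewrite mulr_sumr; apply: upsum_sum => j.
rewrite [F j]form_partition incl_sum raddf_sum mulr_sumr /=.
by apply: upsum_sum => d; apply: ut (pihomogP _ _ _).
Qed.

Lemma upsum_scaled n b : upsum (n.+1%:R *: b) -> upsum b.
Proof. by move/(upsumZ n.+1%:R^-1); rewrite scalerK // char0_natr_neq0. Qed.

(** In [U^(j+1) (x f) = x U^(j+1) f + (j+1) z U^j f] the first term is traded for
[U^j f_y] and another multiple of [z U^j f]. The multiples add up to [d + 1],
which is invertible in characteristic zero. *)
Lemma upsum_zj d f j : f \is d.-homog -> upsum (z * upsn j (incl f)).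
Proof.
move=> /dhomog_eul ef; apply: (@upsum_scaled d).
have -> : d.+1%:R *: (z * upsn j (incl f)) =
  upsn j.+1 (incl ('X_0 * f)) + (-1) *: upsn j (incl f^`M(1)).
  rewrite inclM inclX mulx_upsn (upsn_dy _ ef) -scaler_nat scaleN1r opprB.
  rewrite [RHS]addrC addrA subrK -scalerAr -scalerDl -natr1 -[j.+1%:R]natr1.
  by congr (_ *: _); ring.
apply: upsumD; first exact: upsum_incl.
by apply: upsumZ; apply: upsum_incl.
Qed.

Lemma upsum_wj d f j : f \is d.-homog -> upsum (w * upsn j (incl f)).
Proof.
move=> /dhomog_eul ef; apply: (@upsum_scaled d).
have -> : d.+1%:R *: (w * upsn j (incl f)) =
  upsn j.+1 (incl ('X_1 * f)) + upsn j (incl f^`M(0)).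
  rewrite inclM inclY muly_upsn (upsn_dx _ ef) -scaler_nat [RHS]addrC.
  rewrite addrA subrK -scalerAr -scalerDl -natr1 -[j.+1%:R]natr1.
  by congr (_ *: _); ring.
by apply: upsumD; apply: upsum_incl.
Qed.

Lemma upsum_xj d f j : f \is d.-homog -> upsum (x * upsn j (incl f)).
Proof.
move=> hf; have ef := dhomog_eul hf; case: j => [|j].
  have -> : x * upsn 0 (incl f) = upsn 0 (incl ('X_0 * f)).
    by rewrite /upsn /= inclM inclX.
  exact: upsum_incl.
have -> : x * upsn j.+1 (incl f) =
  upsn j (incl f^`M(1)) + (d%:R - j%:R) *: (z * upsn j (incl f)).
  by rewrite (upsn_dy _ ef) scalerAr subrK.
apply: upsumD; first exact: upsum_incl.
by apply: upsumZ; apply: upsum_zj hf.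
Qed.

Lemma upsum_yj d f j : f \is d.-homog -> upsum (y * upsn j (incl f)).
Proof.
move=> hf; have ef := dhomog_eul hf; case: j => [|j].
  have -> : y * upsn 0 (incl f) = upsn 0 (incl ('X_1 * f)).
    by rewrite /upsn /= inclM inclY.
  exact: upsum_incl.
have -> : y * upsn j.+1 (incl f) =
  (d%:R - j%:R) *: (w * upsn j (incl f)) + (-1) *: upsn j (incl f^`M(0)).
  by rewrite (upsn_dx _ ef) scalerAr scaleN1r opprB addrC subrK.
apply: upsumD; last by apply: upsumZ; apply: upsum_incl.
by apply: upsumZ; apply: upsum_wj hf.
Qed.

(** The algebraic Peter-Weyl decomposition: the span of the [U^j f] contains 1 and
is stable under multiplication by the generators. *)
Lemma upsum_all b : upsum b.
Proof.
rewrite -[b]mulr1; have : upsum 1 by rewrite -incl1; apply: upsum_incl 0%N.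
move: b 1; apply: genB => [a|b c ub uc|b c ub uc||||] e ue.
- by rewrite -scalerAl mul1r; apply: upsumZ.
- by rewrite mulrDl; apply: upsumD; [apply: ub | apply: uc].
- by rewrite -mulrA; apply: ub; apply: uc.
- by apply: upsum_mul ue => d f j; apply: upsum_xj.
- by apply: upsum_mul ue => d f j; apply: upsum_yj.
- by apply: upsum_mul ue => d f j; apply: upsum_zj.
- by apply: upsum_mul ue => d f j; apply: upsum_wj.
Qed.

(** The scalar by which [V^J U^J] acts on forms of degree [m]; for a natural number
[m] it vanishes exactly when [m < J]. *)
Definition vscal (m : k) J : k := \prod_(i < J) ((m - i%:R) * i.+1%:R).

Lemma iterV_upsn m f J : eul m f ->
  iter J V (upsn J (incl f)) = vscal m J *: incl f.
Proof.
move=> ef; elim: J => [|J IH]; first by rewrite /vscal big_ord0 scale1r.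
rewrite iterSr (V_upsnS _ ef).
have -> a b : iter J V (a *: b) = a *: iter J V b.
  by elim: (J) => //= i ->; rewrite linearZ.
by rewrite IH scalerA /vscal big_ord_recr /= mulrC.
Qed.

Lemma iterV_add J b c : iter J V (b + c) = iter J V b + iter J V c.
Proof. by elim: J => //= J ->; rewrite raddfD. Qed.
Lemma iterV_sum J I (r : seq I) (F : I -> B) :
  iter J V (\sum_(i <- r) F i) = \sum_(i <- r) iter J V (F i).
Proof.
by elim: J => //= J ->; rewrite raddf_sum.
Qed.

Lemma vscal_neq0 d J : (J <= d)%N -> vscal d%:R J != 0.
Proof.
move=> Jd; apply/prodf_neq0 => i _.
have iled : (i < d)%N by apply: leq_trans Jd.
by rewrite -natrB ?(ltnW iled) // -natrM ((pcharf0P k).1 char0) muln_eq0 negb_or -!lt0n subn_gt0 iled.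
Qed.

Lemma iterV_upsn_lt f j J : (j < J)%N -> iter J V (upsn j (incl f)) = 0.
Proof.
move=> jJ; rewrite [f]form_partition incl_sum raddf_sum iterV_sum big1 // => d _.
have ef := dhomog_eul (pihomogP mdeg d f).
rewrite -(subnK jJ) addnS -addSn iterD (iterV_upsn _ ef) iterSr.
rewrite linearZ /= V_incl scaler0; elim: (J - j.+1)%N => //= n ->; exact: raddf0.
Qed.

Section Invariants.
Variables (I : Type) (g : I -> {additive B -> B}) (s : I -> {additive P -> P}).
Hypothesis gU : forall i b, g i (U b) = U (g i b).
Hypothesis gV : forall i b, g i (V b) = V (g i b).
Hypothesis g_incl : forall i f, g i (incl f) = incl (s i f).
Hypothesis s_homog : forall i d f, f \is d.-homog -> s i f \is d.-homog.
Hypothesis sZ : forall i a f, s i (a *: f) = a *: s i f.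
Hypothesis incl_inj : injective incl.

Lemma sub_pihomog i d f : s i (pihomog mdeg d f) = pihomog mdeg d (s i f).
Proof.
rewrite [in RHS](form_partition f) [in RHS](raddf_sum (s i)) [RHS]raddf_sum /=.
case: (ltnP d (msize f)) => [df|fd].
  rewrite (bigD1 (Ordinal df)) //= [in X in _ = X + _]pihomog_dE ?s_homog ?pihomogP //.
  rewrite [X in _ + X]big1 ?addr0 // => e; rewrite -val_eqE /= => ed.
  exact: (pihomog_ne0 ed (s_homog i (pihomogP mdeg e f))).
rewrite [RHS]big1 => [|e _].
  rewrite /pihomog big_seq_cond big1 ?raddf0 // => m /andP[/msize_mdeg_lt + /eqP e].
  by rewrite e ltnNge fd.
apply: (pihomog_ne0 _ (s_homog i (pihomogP mdeg e f))).
by rewrite neq_ltn (leq_trans (ltn_ord e) fd).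
Qed.

Variable A : B -> Prop.
Hypothesis AD : forall b c, A b -> A c -> A (b + c).
Hypothesis A0 : A 0.
Hypothesis AU : forall b, A b -> A (U b).
Hypothesis A_form : forall d f, f \is d.-homog -> (forall i, s i f = f) -> A (incl f).

(** Reduction of invariant functions to invariant forms. In an invariant
[b = sum_(j <= J) U^j f_j], applying [V^J] leaves nonzero multiples of the
components of degree at least [J] of [f_J], in k[x, y]. As [V] commutes with the
group these components are invariant forms; the others are killed by [U^J]. So
[U^J f_J] can be subtracted from [b], and the induction is on [J]. *)
Lemma invariants_sub b : (forall i, g i b = b) -> A b.
Proof.
have [J [F ->]] := upsum_all b; elim: J => [|J IH]; first by rewrite big_ord0.
rewrite big_ord_recr /= => ib.
pose f d := pihomog mdeg d (F J); set N := msize (F J).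
have FE : F J = \sum_(d < N) f d by exact: form_partition.
have gup i j f' : g i (upsn j (incl f')) = upsn j (g i (incl f')).
  by elim: j => // j IHj; rewrite upsnS gU IHj.
have giV i j c : g i (iter j V c) = iter j V (g i c).
  by elim: j => // j IHj; rewrite iterS gV IHj.
have sf i d : (J <= d)%N -> (d < N)%N -> s i (f d) = f d.
  move=> Jd dN; pose G := \sum_(e < N) vscal e%:R J *: f e.
  have GE : incl G = iter J V
    (\sum_(j < J) upsn j (incl (F j)) + upsn J (incl (F J))).
    rewrite iterV_add iterV_sum big1 ?add0r => [|j _]; last first.
      exact: iterV_upsn_lt.
    rewrite FE !incl_sum raddf_sum iterV_sum; apply: eq_bigr => e _.
    by rewrite inclZ (iterV_upsn _ (dhomog_eul (pihomogP mdeg e _))).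
  have sG : s i G = G.
    by apply: incl_inj; rewrite -g_incl GE giV ib.
  have fG : pihomog mdeg d G = vscal d%:R J *: f d.
    rewrite /G raddf_sum (bigD1 (Ordinal dN)) //= linearZ /= pihomog_id.
    rewrite big1 ?addr0 // => e; rewrite -val_eqE /= => ed.
    by rewrite linearZ /= (pihomog_ne0 ed (pihomogP _ _ _)) scaler0.
  apply: (scalerI (vscal_neq0 Jd)); rewrite -sZ -fG sub_pihomog.
  by rewrite sG.
have upF : upsn J (incl (F J)) =
  \sum_(d < N | (J <= d)%N) upsn J (incl (f d)).
  rewrite {1}FE incl_sum raddf_sum /= [RHS]big_mkcond; apply: eq_bigr => d _.
  case: leqP => // dJ; exact: upsn_dhomog_eq0 (pihomogP _ _ _) dJ.
have AF : A (upsn J (incl (F J))).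
  rewrite upF; apply: big_ind => // d Jd.
  have : A (incl (f d)) by apply: (A_form (pihomogP _ _ _)) => i; apply: sf.
  by elim: (J) => // j IHj Af; rewrite upsnS; apply: AU; apply: IHj.
have iF i : g i (upsn J (incl (F J))) = upsn J (incl (F J)).
  rewrite upF raddf_sum /=; apply: eq_bigr => d Jd.
  by rewrite gup g_incl sf.
apply: AD => //; apply: IH => i.
by apply: (addIr (g i (upsn J (incl (F J))))); rewrite -raddfD ib iF.
Qed.
End Invariants.

(** The transvectant written with the symbols [E f = (m - j) U^j f] and
[D f = U^(j+1) f] in the role of the partial derivatives. Sequences stand for
[j |-> U^j f], and [m], [n] for the degrees. *)
Fixpoint seq_tv p (m n : k) (u v : nat -> B) : B :=
  if p is q.+1 then
    seq_tv q (m - 1) (n - 1) (fun j => (m - j%:R) *: u j) (fun j => v j.+1) -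
    seq_tv q (m - 1) (n - 1) (fun j => u j.+1) (fun j => (n - j%:R) *: v j)
  else u 0 * v 0.

Lemma seq_tv_linl p m n a b (u u1 u2 v : nat -> B) :
  (forall i, u i = a * u1 i + b * u2 i) ->
  seq_tv p m n u v = a * seq_tv p m n u1 v + b * seq_tv p m n u2 v.
Proof.
elim: p m n u u1 u2 v => [|p IH] m n u u1 u2 v eu /=.
  by rewrite eu mulrDl !mulrA.
rewrite (IH _ _ _ (fun i => (m - i%:R) *: u1 i) (fun i => (m - i%:R) *: u2 i)).
  rewrite (IH _ _ (fun i => u i.+1) (fun i => u1 i.+1) (fun i => u2 i.+1)) //.
  by rewrite opprD addrACA -!mulrBr.
by move=> i; rewrite eu scalerDr -!scalerAr.
Qed.

Lemma seq_tv_linr p m n a b (u v v1 v2 : nat -> B) :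
  (forall i, v i = a * v1 i + b * v2 i) ->
  seq_tv p m n u v = a * seq_tv p m n u v1 + b * seq_tv p m n u v2.
Proof.
elim: p m n u v v1 v2 => [|p IH] m n u v v1 v2 ev /=.
  by rewrite ev mulrDr !mulrA ![u 0 * _]mulrC.
rewrite (IH _ _ _ (fun i => v i.+1) (fun i => v1 i.+1) (fun i => v2 i.+1)) //.
rewrite (IH _ _ _ (fun i => (n - i%:R) *: v i)
  (fun i => (n - i%:R) *: v1 i) (fun i => (n - i%:R) *: v2 i)).
  by rewrite opprD addrACA -!mulrBr.
by move=> i; rewrite ev scalerDr -!scalerAr.
Qed.

(** The [p]-th transvectant of two binary forms, up to a numerical factor: [tv 1] is
the Jacobian, and [tv 2 f f] is twice the Hessian. *)
Fixpoint tv p f g : P :=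
  if p is q.+1 then tv q f^`M(0) g^`M(1) - tv q f^`M(1) g^`M(0) else f * g.

(** The pairs [(f_x, f_y)] and [(E f, D f)] differ by the matrix
[(w, -y; -z, x)] of determinant 1, so [f_x g_y - f_y g_x = E f D g - D f E g]:
the coordinates disappear from the transvectant. *)
Lemma incl_tv p m n f g : eul m f -> eul n g ->
  incl (tv p f g) =
  seq_tv p m n (fun j => upsn j (incl f)) (fun j => upsn j (incl g)).
Proof.
elim: p m n f g => [|p IH] m n f g ef eg /=; first exact: inclM.
have [ef0 ef1] := (eul_deriv 0 ef, eul_deriv 1 ef).
have [eg0 eg1] := (eul_deriv 0 eg, eul_deriv 1 eg).
rewrite inclB (IH _ _ _ _ ef0 eg1) (IH _ _ _ _ ef1 eg0).
pose Ef j := (m - j%:R) *: upsn j (incl f); pose Df j := upsn j.+1 (incl f).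
pose Eg j := (n - j%:R) *: upsn j (incl g); pose Dg j := upsn j.+1 (incl g).
have fx j : upsn j (incl f^`M(0)) = w * Ef j + (- y) * Df j.
  by rewrite (upsn_dx _ ef) mulNr.
have fy j : upsn j (incl f^`M(1)) = x * Df j + (- z) * Ef j.
  by rewrite (upsn_dy _ ef) mulNr.
have gx j : upsn j (incl g^`M(0)) = w * Eg j + (- y) * Dg j.
  by rewrite (upsn_dx _ eg) mulNr.
have gy j : upsn j (incl g^`M(1)) = x * Dg j + (- z) * Eg j.
  by rewrite (upsn_dy _ eg) mulNr.
rewrite (seq_tv_linl _ _ _ _ fx) (seq_tv_linl _ _ _ _ fy).
rewrite !(seq_tv_linr _ _ _ _ gx) !(seq_tv_linr _ _ _ _ gy).
rewrite -/Ef -/Df -/Eg -/Dg.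
move: (seq_tv _ _ _ Ef Eg) (seq_tv _ _ _ Df Dg) => EE DD.
move: (seq_tv _ _ _ Ef Dg) (seq_tv _ _ _ Df Eg) => ED DE.
by rewrite -[RHS]mul1r -det1; ring.
Qed.

Lemma rmorph_eq_gen (g1 g2 : {rmorphism B -> B}) :
  (forall a, g1 a%:A = g2 a%:A) ->
  g1 x = g2 x -> g1 y = g2 y -> g1 z = g2 z -> g1 w = g2 w -> g1 =1 g2.
Proof.
move=> eA ex ey ez ew; apply: genB => // b c eb ec.
  by rewrite !rmorphD eb ec.
by rewrite !rmorphM eb ec.
Qed.

Lemma rmorph_lin (g : {rmorphism B -> B}) :
  (forall a, g a%:A = a%:A) -> forall (a b : k) (c d : B),
  g (a *: c + b *: d) = a *: g c + b *: g d.
Proof.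
move=> gA a b c d; rewrite rmorphD -(mulr_algl a c) -(mulr_algl b d).
by rewrite !rmorphM /= !gA !mulr_algl.
Qed.

Section LinearSubstitution.
Variables (g : {rmorphism B -> B}) (a11 a12 a21 a22 : k).
Hypothesis gA : forall a, g a%:A = a%:A.
Hypothesis gx : g x = a11 *: x + a21 *: y.
Hypothesis gy : g y = a12 *: x + a22 *: y.
Hypothesis gz : g z = a11 *: z + a21 *: w.
Hypothesis gw : g w = a12 *: z + a22 *: w.

Lemma g_comm_der (D : {linear B -> B}) :
  (forall b c : B, D (b * c) = D b * c + b * D c) ->
  g (D x) = D (g x) -> g (D y) = D (g y) ->
  g (D z) = D (g z) -> g (D w) = D (g w) -> forall b, g (D b) = D (g b).
Proof.
move=> DM ex ey ez ew; apply: genB => // [a|b c eb ec|b c eb ec].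
- by rewrite gA !derA // raddf0.
- by rewrite !raddfD /= eb ec.
- by rewrite DM !(rmorphM, rmorphD) DM /= eb ec.
Qed.

Lemma g_comm_U b : g (U b) = U (g b).
Proof.
apply: g_comm_der => //.
- by rewrite Ux gz gx linearD !linearZ /= Ux Uy.
- by rewrite Uy gw gy linearD !linearZ /= Ux Uy.
- by rewrite Uz raddf0 gz linearD !linearZ /= Uz Uw !scaler0 addr0.
- by rewrite Uw raddf0 gw linearD !linearZ /= Uz Uw !scaler0 addr0.
Qed.
Lemma g_comm_V b : g (V b) = V (g b).
Proof.
apply: g_comm_der => //.
- by rewrite Vx raddf0 gx linearD !linearZ /= Vx Vy !scaler0 addr0.
- by rewrite Vy raddf0 gy linearD !linearZ /= Vx Vy !scaler0 addr0.
- by rewrite Vz gx gz linearD !linearZ /= Vz Vw.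
- by rewrite Vw gy gw linearD !linearZ /= Vz Vw.
Qed.

Lemma g_incl f : g (incl f) =
  incl (f \mPo [tuple a11 *: 'X_0 + a21 *: 'X_1; a12 *: 'X_0 + a22 *: 'X_1]).
Proof.
elim/form_ind: f => [a|p q IHp IHq|p q IHp IHq||].
- by rewrite comp_mpolyC inclC gA.
- by rewrite comp_mpolyD !inclD -IHp -IHq raddfD.
- by rewrite rmorphM /= !inclM -IHp -IHq rmorphM.
- by rewrite comp_mpolyXU /= inclX gx inclD !inclZ inclX inclY.
- by rewrite comp_mpolyXU /= inclY gy inclD !inclZ inclX inclY.
Qed.
End LinearSubstitution.

(** A [U]-stable subalgebra is closed under transvectants, since these are
polynomials in the [U^i f] and [U^j g]. *)
Section TransvectantIn.
Variable A : B -> Prop.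
Hypothesis AB : forall b c, A b -> A c -> A (b - c).
Hypothesis AM : forall b c, A b -> A c -> A (b * c).
Hypothesis AZ : forall a b, A b -> A (a *: b).
Hypothesis AU : forall b, A b -> A (U b).

Lemma tv_in p d e f g : f \is d.-homog -> g \is e.-homog ->
  A (incl f) -> A (incl g) -> A (incl (tv p f g)).
Proof.
move=> /dhomog_eul ef /dhomog_eul eg Af Ag; rewrite (incl_tv _ ef eg).
have Aup b : A b -> forall j, A (upsn j b).
  by move=> Ab; elim=> // j IH; rewrite upsnS; apply: AU.
have seq_tv_in q m n u v : (forall j, A (u j)) -> (forall j, A (v j)) ->
    A (seq_tv q m n u v).
  elim: q m n u v => [|q IH] m n u v Au Av /=; first exact: AM.
  by apply: AB; apply: IH => // j; apply: AZ.
by apply: seq_tv_in; apply: Aup.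
Qed.
End TransvectantIn.
End SL2Algebra.

Lemma eval_at_rmorph (k : fieldType) (B : comAlgType k) (C : comNzRingType) n
    (v : n.-tuple B) (f : {rmorphism B -> C}) (g : {rmorphism {mpoly k[n]} -> C}) :
  (forall t, f t%:A = g t%:MP) -> (forall i, f (tnth v i) = g 'X_i) ->
  forall q, f (eval_at v q) = g q.
Proof.
move=> fA fX; elim/mpoly_gen_ind => [a|p q IHp IHq|p q IHp IHq|i].
- by rewrite eval_atC.
- by rewrite (rmorphD (eval_at v)) (rmorphD f) (rmorphD g) IHp IHq.
- by rewrite (rmorphM (eval_at v)) (rmorphM f) (rmorphM g) IHp IHq.
- by rewrite eval_atX.
Qed.

(** * The coordinate ring of SL2 *)
Section Bridge.
Variable k : fieldType.
Local Notation B := (OSL2 k).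
Local Notation P4 := {mpoly k[4]}.
Local Notation P := {mpoly k[2]}.
Local Notation x := (xB k).
Local Notation y := (yB k).
Local Notation z := (zB k).
Local Notation w := (wB k).
Local Notation U := (@upsilon k).
Local Notation incl := (@incl_xy k).

Lemma OSL2_ind (Q : B -> Prop) :
  (forall a, Q a%:A) -> (forall b c, Q b -> Q c -> Q (b + c)) ->
  (forall b c, Q b -> Q c -> Q (b * c)) ->
  Q x -> Q y -> Q z -> Q w -> forall b, Q b.
Proof.
move=> QC QD QM Qx Qy Qz Qw b; rewrite -[b]toB_liftB.
elim/mpoly_gen_ind: (liftB b) => [a|p q|p q|i].
- by rewrite toBC.
- by rewrite rmorphD; apply: QD.
- by rewrite rmorphM; apply: QM.
case: i => [[|[|[|[|//]]]] hi].
- by rewrite (_ : Ordinal hi = 0) //; apply/val_inj.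
- by rewrite (_ : Ordinal hi = 1) //; apply/val_inj.
- by rewrite (_ : Ordinal hi = 2) //; apply/val_inj.
- by rewrite (_ : Ordinal hi = 3) //; apply/val_inj.
Qed.

HB.instance Definition _ :=
  GRing.isLinear.Build k B B *:%R U (@upsilon_is_linear k).

(** The derivation [x d/dz + y d/dw] also kills [x w - y z - 1], so the
representative of [b] does not matter. *)
Definition dual_upsilon (b : B) : B :=
  x * toB (liftB b)^`M(2) + y * toB (liftB b)^`M(3).

Lemma det_rel_d2 : (det_rel k)^`M(2) = - 'X_1.
Proof.
rewrite /det_rel !mderivB !mderivM !mderivXU /= -mpolyC1 mderivC.
by rewrite !(mul0r, mulr0, addr0, subr0, mul1r, mulr1, sub0r, add0r).
Qed.
Lemma det_rel_d3 : (det_rel k)^`M(3) = 'X_0.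
Proof.
rewrite /det_rel !mderivB !mderivM !mderivXU /= -mpolyC1 mderivC.
by rewrite !(mul0r, mulr0, addr0, subr0, mul1r, mulr1, sub0r, add0r).
Qed.

Lemma dual_upsilonE p : dual_upsilon (toB p) = x * toB p^`M(2) + y * toB p^`M(3).
Proof.
have /toB_eq[r e] := toB_liftB (toB p).
have {e} e : liftB (toB p) = p + r * det_rel k by rewrite -e addrC subrK.
rewrite /dual_upsilon e !mderivD !mderivM det_rel_d2 det_rel_d3.
move: (det_rel k) (toB_rel k) => D D0.
by rewrite !rmorphD !rmorphM rmorphN /= D0 /xB /yB; ring.
Qed.

Fact dual_upsilon_is_linear : linear dual_upsilon.
Proof.
move=> a b c.
rewrite -[b]toB_liftB -[c]toB_liftB -toBZ -rmorphD !dual_upsilonE !mderivD !mderivZ.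
by rewrite !rmorphD /= !toBZ !mulrDr -!scalerAr scalerDr addrACA.
Qed.
HB.instance Definition _ :=
  GRing.isLinear.Build k B B *:%R dual_upsilon dual_upsilon_is_linear.

Lemma dual_upsilonM b c : dual_upsilon (b * c) = dual_upsilon b * c + b * dual_upsilon c.
Proof.
rewrite -[b]toB_liftB -[c]toB_liftB -rmorphM !dual_upsilonE !mderivM.
by rewrite !rmorphD !rmorphM /=; ring.
Qed.
Lemma dual_upsilon_gen : [/\ dual_upsilon x = 0, dual_upsilon y = 0, dual_upsilon z = x & dual_upsilon w = y].
Proof.
by split; rewrite dual_upsilonE !mderivXU /= ?rmorph0 ?rmorph1 ?mulr0 ?mulr1
  ?addr0 ?add0r.
Qed.

Lemma incl_xyC a : incl a%:MP = a%:A. Proof. exact: inclC. Qed.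
Lemma incl_xyD f g : incl (f + g) = incl f + incl g. Proof. exact: inclD. Qed.
Lemma incl_xyM f g : incl (f * g) = incl f * incl g. Proof. exact: inclM. Qed.

(** The universal property: homomorphisms from k[SL2] to [C] are the matrices of
determinant 1 over [C]. *)
Lemma OSL2_eval (C : comNzRingType) (phi : {rmorphism k -> C}) (a b c d : C) :
  a * d - b * c = 1 -> exists f : {rmorphism B -> C},
  [/\ forall t, f t%:A = phi t, f x = a, f y = b, f z = c & f w = d].
Proof.
move=> det1; pose v := [tuple a; b; c; d].
have vE j : mmap phi (tnth v) 'X_j = tnth v j by rewrite mmapX mmap1U.
have gD : mmap phi (tnth v) (det_rel k) = 0.
  rewrite /det_rel !mmapB !(rmorphM (mmap phi (tnth v))) rmorph1 /= !vE.
  by rewrite !(tnth_nth 0) /= det1 subrr.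
pose f (t : B) := mmap phi (tnth v) (liftB t).
have fE p : f (toB p) = mmap phi (tnth v) p.
  have /toB_eq[r e] := toB_liftB (toB p).
  have {}e : liftB (toB p) = p + r * det_rel k by rewrite -e addrC subrK.
  by rewrite /f e mmapD (rmorphM (mmap phi (tnth v))) /= gD mulr0 addr0.
have fB : zmod_morphism f.
  move=> s t; rewrite -[s]toB_liftB -[t]toB_liftB -(rmorphB (@toB k)) !fE.
  exact: mmapB.
have fM : monoid_morphism f.
  split=> [|s t]; first by rewrite -(rmorph1 (@toB k)) fE rmorph1.
  rewrite -[s]toB_liftB -[t]toB_liftB -(rmorphM (@toB k)) !fE.
  exact: (rmorphM (mmap phi (tnth v))).
pose fZ := GRing.isZmodMorphism.Build B C f fB.
pose fR := GRing.isMonoidMorphism.Build B C f fM.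
exists (HB.pack_for {rmorphism B -> C} f fZ fR); split.
- by move=> t; have := fE t%:MP; rewrite toBC mmapC.
- exact: etrans (fE 'X_0) (vE 0).
- exact: etrans (fE 'X_1) (vE 1).
- exact: etrans (fE 'X_2) (vE 2).
- exact: etrans (fE 'X_3) (vE 3).
Qed.

(** Evaluation at the generic upper triangular matrix [('X_0, 'X_1; 0, 'X_0^-1)];
it detects both the polynomials in [x] and [y] and the ideal of [z]. *)
Lemma OSL2_triangular : exists f : {rmorphism B -> {fraction P}},
  (forall q, f (incl q) = tofrac q) /\ f z = 0.
Proof.
have X0 : tofrac ('X_0 : P) != 0 by rewrite tofrac_eq0 -msize_poly_eq0 msizeX.
have det1 : tofrac ('X_0 : P) * (tofrac 'X_0)^-1 - tofrac ('X_1 : P) * 0 = 1.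
  by rewrite mulr0 subr0 divff.
have [f [fA fx fy fz _]] := OSL2_eval (@tofrac P \o @mpolyC 2 k) det1.
exists f; split=> //.
apply: (@eval_at_rmorph k B _ 2 [tuple x; y] f (@tofrac P)) => [//|j].
case: j => [[|[|//]] hj]; rewrite (tnth_nth 0) /= ?fx ?fy;
  by congr (tofrac 'X_ _); apply/val_inj.
Qed.

Lemma incl_inj : injective incl.
Proof.
have [f [fE _]] := OSL2_triangular.
move=> p q e; have := etrans (esym (fE p)) (etrans (congr1 f e) (fE q)).
by move=> /eqP; rewrite tofrac_eq => /eqP.
Qed.

Definition linsub (h : 'M[k]_2) (f : P) : P :=
  f \mPo [tuple h 0 0 *: 'X_0 + h 1 0 *: 'X_1; h 0 1 *: 'X_0 + h 1 1 *: 'X_1].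

Lemma act_gen (h : SL2 k) :
  [/\ act h x = val h 0 0 *: x + val h 1 0 *: y,
      act h y = val h 0 1 *: x + val h 1 1 *: y,
      act h z = val h 0 0 *: z + val h 1 0 *: w &
      act h w = val h 0 1 *: z + val h 1 1 *: w].
Proof.
have := act_coord h; rewrite [map_mx (in_alg _) _]mx2E mul_mx2 [map_mx _ _]mx2E.
rewrite !mxE /= => /matrixP e.
have := e 0 0; have := e 0 1; have := e 1 0; have := e 1 1.
rewrite !mxE /= ![_ * (_ *: 1)]mulrC -!scalerAl !mul1r.
by move=> -> -> -> ->.
Qed.

Lemma act_incl (h : SL2 k) f : act h (incl f) = incl (linsub (val h) f).
Proof.
have [hx hy _ _] := act_gen h.
exact: (g_incl (act_alg h) hx hy).
Qed.

Lemma act_ups (h : SL2 k) b : act h (U b) = U (act h b).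
Proof.
have [hx hy hz hw] := act_gen h; have [ux uy uz uw] := upsilon_gen k.
exact: (g_comm_U OSL2_ind (@upsilonM k) ux uy uz uw (act_alg h) hx hy hz hw).
Qed.

Lemma act_dual_upsilon (h : SL2 k) b : act h (dual_upsilon b) = dual_upsilon (act h b).
Proof.
have [hx hy hz hw] := act_gen h; have [ux uy uz uw] := dual_upsilon_gen.
exact: (g_comm_V OSL2_ind dual_upsilonM ux uy uz uw (act_alg h) hx hy hz hw).
Qed.

Lemma act_lin (h : SL2 k) (a b : k) (c d : B) :
  act h (a *: c + b *: d) = a *: act h c + b *: act h d.
Proof. exact: (rmorph_lin (act_alg h)). Qed.

Lemma act_mul (g h : SL2 k) (b : B) : act (g * h)%g b = act g (act h b).
Proof.
have [gx gy gz gw] := act_gen g; have [hx hy hz hw] := act_gen h.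
have [ghx ghy ghz ghw] := act_gen (g * h)%g.
have mE i j : val (g * h)%g i j = val g i 0 * val h 0 j + val g i 1 * val h 1 j.
  rewrite /= mxE !big_ord_recl big_ord0 addr0; congr (_ + val g _ _ * val h _ _).
    exact/val_inj.
  exact/val_inj.
have E (c d e f : B) j :
    e = val g 0 0 *: c + val g 1 0 *: d -> f = val g 0 1 *: c + val g 1 1 *: d ->
    (val (g * h)%g 0 j *: c + val (g * h)%g 1 j *: d) =
    val h 0 j *: e + val h 1 j *: f.
  move=> -> ->; rewrite !mE !scalerDl !scalerDr !scalerA addrACA.
  by rewrite ![val h _ _ * _]mulrC.
apply: (rmorph_eq_gen OSL2_ind (g1 := act (g * h)%g) (g2 := act g \o act h)).
- by move=> a; rewrite /= !act_alg.
- by rewrite /= ghx hx act_lin; apply: E.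
- by rewrite /= ghy hy act_lin; apply: E.
- by rewrite /= ghz hz act_lin; apply: E.
- by rewrite /= ghw hw act_lin; apply: E.
Qed.

Lemma act_one (b : B) : act (1%g : SL2 k) b = b.
Proof.
have [hx hy hz hw] := act_gen (1%g : SL2 k).
move: hx hy hz hw; rewrite !mxE /= !scale1r !scale0r !addr0 !add0r => hx hy hz hw.
apply: (rmorph_eq_gen OSL2_ind (g1 := act 1%g) (g2 := idfun)) => // a.
exact: act_alg.
Qed.

Lemma invariants_gen (S : set (SL2 k)) : invariants (subgroup_gen S) = invariants S.
Proof.
apply/seteqP; split=> b bS h hS; first by apply: bS; apply: sub_gen_smallest.
have : is_subgroup [set g | act g b = b].
  split=> [|g g' /= eg eg'|g /= eg]; first exact: act_one.
    by rewrite act_mul eg' eg.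
  by rewrite -[in LHS]eg -act_mul mulVg act_one.
by move=> /smallest_sub Sfix; apply: (Sfix _ _ _ hS) => g; apply: bS.
Qed.

(** The closure properties of the forms contained in an upsilon-stable subalgebra;
everything that follows about invariant forms is deduced from them. *)
Definition tv_closed (Q : P -> Prop) := [/\ forall a, Q a%:MP,
  forall f g, Q f -> Q g -> Q (f + g), forall f g, Q f -> Q g -> Q (f * g) &
  forall p d e f g, f \is d.-homog -> g \is e.-homog -> Q f -> Q g -> Q (tv p f g)].

Definition fixed_form (S : set (SL2 k)) f := forall h, S h -> linsub (val h) f = f.

Hypothesis char0 : [pchar k] =i pred0.

Lemma hat_ups d f b : f \is d.-homog -> hat f b -> hat f (U b).
Proof.
move=> hf [c ->]; have [ux uy uz uw] := upsilon_gen k.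
have up0 : iter (msize f).-1.+1 U (incl f) = 0.
  have [->|f0] := eqVneq f 0.
    rewrite [incl 0]incl0.
    by elim: _.+1 => // j IH; rewrite iterS IH raddf0.
  have <- : d = (msize f).-1 by exact: dhomog_uniq f0 hf (dhomog_msize hf).
  exact: (upsn_dhomog_eq0 (detB k) (@upsilonM k) ux uy uz uw hf (ltnSn d)).
exists (fun j => if j == ord0 then 0 else c (inord j.-1)).
rewrite raddf_sum big_ord_recr /= linearZ /= -iterS up0 scaler0 addr0.
rewrite [RHS]big_ord_recl eqxx scale0r add0r; apply: eq_bigr => j _.
rewrite linearZ /=; congr (c _ *: _); apply/val_inj.
by rewrite /= inordK // add0n ltnW // ltnS.
Qed.

Lemma sub_dhomog (h : 'M[k]_2) d f : f \is d.-homog -> linsub h f \is d.-homog.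
Proof.
move=> hf; rewrite /linsub [f]mpolyE raddf_sum big_seq rpred_sum // => m hm.
rewrite /= comp_mpolyZ rpredZ // comp_mpolyX.
have {hm} /= <- := dhomog_mf hf hm.
rewrite big_ord_recl big_ord_recl big_ord0 mulr1 mdegE !big_ord_recl big_ord0 addn0.
have h1 a b : (a *: 'X_0 + b *: 'X_1 : P) \is 1.-homog.
  by rewrite rpredD // rpredZ // dhomogX /= mdeg1.
apply: dhomogM; rewrite -[X in X.-homog for _]mul1n; apply: dhomogMn; exact: h1.
Qed.

Fact sub_is_additive h : zmod_morphism (linsub h).
Proof. by move=> f g; apply: raddfB. Qed.
HB.instance Definition _ h := GRing.isZmodMorphism.Build P P (linsub h) (sub_is_additive h).
Fact sub_is_monoid h : monoid_morphism (linsub h).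
Proof. by split; [exact: rmorph1 | exact: (rmorphM (comp_mpoly _))]. Qed.
HB.instance Definition _ h := GRing.isMonoidMorphism.Build P P (linsub h) (sub_is_monoid h).
Lemma subZ h a f : linsub h (a *: f) = a *: linsub h f.
Proof. exact: comp_mpolyZ. Qed.

Lemma subalgebra_gen_closed (S : set B) : GRing.subalg_closed (mem (subalgebra_gen S)).
Proof.
split=> [|a b c|b c].
- by rewrite inE => A [[c1 _ _] _]; move: c1; rewrite inE.
- rewrite !inE => bS cS A AS; have [[_ cl _] _] := AS.
  have := cl a b c; rewrite !inE; apply; [exact: bS | exact: cS].
- rewrite !inE => bS cS A AS; have [[_ _ cl] _] := AS.
  have := cl b c; rewrite !inE; apply; [exact: bS | exact: cS].
Qed.

Lemma subalgP (A : set B) : GRing.subalg_closed (mem A) ->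
  [/\ forall a, A a%:A, forall b c, A b -> A c -> A (b + c),
      forall b c, A b -> A c -> A (b * c), forall b c, A b -> A c -> A (b - c) &
      forall a b, A b -> A (a *: b)].
Proof.
move=> [c1 clin cM].
have A1 : A 1 by move: c1; rewrite inE.
have lin a b c : A b -> A c -> A (a *: b + c).
  by move=> Ab Ac; have := clin a b c; rewrite !inE; apply.
have A0 : A 0 by have := lin (-1) _ _ A1 A1; rewrite scaleN1r addNr.
split=> [a|b c Ab Ac|b c Ab Ac|b c Ab Ac|a b Ab].
- by have := lin a _ _ A1 A0; rewrite addr0.
- by have := lin 1 _ _ Ab Ac; rewrite scale1r.
- by have := cM b c; rewrite !inE; apply.
- by have := lin (-1) _ _ Ac Ab; rewrite scaleN1r addrC.
- by have := lin a _ _ Ab A0; rewrite addr0.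
Qed.

Lemma subalg_sub (S A : set B) : GRing.subalg_closed (mem A) -> S `<=` A ->
  subalgebra_gen S `<=` A.
Proof. by move=> cA SA b; apply. Qed.

Lemma invariants_subalg (S : set (SL2 k)) : GRing.subalg_closed (mem (invariants S)).
Proof.
split=> [|a b c|b c]; rewrite !inE.
- by move=> h _; rewrite rmorph1.
- move=> bS cS h hS; have := act_lin h a 1 b c; rewrite !scale1r => ->.
  by congr (_ *: _ + _); [apply: bS | apply: cS].
- by move=> bS cS h hS; rewrite rmorphM; congr (_ * _); [apply: bS | apply: cS].
Qed.

(** The algebra generated by the hats of [G] is stable under upsilon, because each
hat is. Hence its forms are closed under transvectants, and it suffices that the
invariant forms be obtained from [G] by sums, products and transvectants. *)
Lemma invariants_generated_by_forms (S : set (SL2 k)) (G : set P) :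
  (forall f, G f -> (exists d, f \is d.-homog) /\ fixed_form S f) ->
  (forall Q : P -> Prop, tv_closed Q -> (forall f, G f -> Q f) ->
    (forall f, Q f -> fixed_form S f) ->
    forall d f, f \is d.-homog -> fixed_form S f -> Q f) ->
  invariants S = subalgebra_gen (\bigcup_(f in G) hat f).
Proof.
move=> Gfix Gall; set T := \bigcup_(f in G) _; set A := subalgebra_gen T.
have cA : GRing.subalg_closed (mem A) by exact: subalgebra_gen_closed.
have [AC AD AM AB AZ] := subalgP cA.
have [ux uy uz uw] := upsilon_gen k; have [vx vy vz vw] := dual_upsilon_gen.
have AS : A `<=` invariants S.
  apply: subalg_sub; first exact: invariants_subalg.
  move=> b [f Gf [c ->]] h hS; have [_ ff] := Gfix f Gf.
  rewrite raddf_sum; apply: eq_bigr => j _.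
  have actZ a e : act h (a *: e) = a *: act h e.
    by have := act_lin h a 0 e 0; rewrite !scale0r !addr0.
  rewrite /= actZ; congr (_ *: _); elim: (j : nat) => [|i IH].
    by rewrite act_incl ff.
  by rewrite iterS act_ups IH.
have AU b : A b -> A (U b).
  suff /(_ b) : A `<=` [set b | A b /\ A (U b)] by move=> AA /AA[].
  apply: subalg_sub => [|{}b bT].
    split=> [|a c e|c e]; rewrite !inE /=.
    - rewrite der1; last exact: upsilonM.
      by rewrite -[1]scale1r -[0](scale0r 1).
    - move=> [Ac AUc] [Ae AUe]; rewrite linearP.
      by split; apply: AD => //; apply: AZ.
    - move=> [Ac AUc] [Ae AUe]; rewrite upsilonM.
      by split; [exact: AM | apply: AD; apply: AM].
  have ST : T `<=` A by exact: sub_gen_smallest.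
  split; first exact: ST.
  by apply: ST; case: bT => f Gf fb; exists f => //; have [[d hf] _] := Gfix f Gf; apply: hat_ups hf fb.
have Gincl f : G f -> A (incl f).
  move=> Gf; apply: sub_gen_smallest; exists f => //.
  exists (fun j => if j == ord0 then 1 else 0).
  by rewrite big_ord_recl eqxx scale1r big1 ?addr0 // => j _; rewrite scale0r.
pose Q f := A (incl f).
have Qfix f : Q f -> fixed_form S f.
  by move=> /AS Qf h hS; apply: incl_inj; rewrite -act_incl Qf.
have Qtv : tv_closed Q.
  split=> [a|f g Qf Qg|f g Qf Qg|p d e f g hf hg Qf Qg].
  - have := AC a; rewrite -incl_xyC; exact.
  - by have := AD _ _ Qf Qg; rewrite -incl_xyD.
  - by have := AM _ _ Qf Qg; rewrite -incl_xyM.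
  - exact: (tv_in (detB k) (@upsilonM k) ux uy uz uw AB AM AZ AU p hf hg Qf Qg).
have QG f : G f -> Q f by exact: Gincl.
apply/seteqP; split => // b bS.
have := invariants_sub (detB k) OSL2_ind (@upsilonM k) dual_upsilonM ux uy uz uw vx vy vz vw char0
  (I := {h | S h}) (g := fun i => act (sval i)) (s := fun i => linsub (val (sval i))).
move=> /(_ (fun i => act_ups _) (fun i => act_dual_upsilon _) (fun i => act_incl _)).
move=> /(_ (fun i => @sub_dhomog _) (fun i => subZ _) incl_inj A AD).
apply=> //.
- by have := AC 0; rewrite scale0r.
- move=> d f hf ff; apply: (Gall Q Qtv QG Qfix d f hf) => h hS.
  exact: (ff (exist _ h hS)).
- by move=> [h hS]; apply: bS.
Qed.
End Bridge.

(** * Binary forms and their dehomogenizations *)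
Section Forms.
Variable k : fieldType.
Local Notation P := {mpoly k[2]}.
Implicit Types (f g F : P) (p q : {poly k}).

Definition at2 (a b : k) f : k := f.@[tnth [tuple a; b]].
Fact at2_zmod a b : zmod_morphism (at2 a b).
Proof. exact: mevalB. Qed.
Fact at2_monoid a b : monoid_morphism (at2 a b).
Proof. by split; [exact: meval1 | exact: mevalM]. Qed.
HB.instance Definition _ a b := GRing.isZmodMorphism.Build P k (at2 a b) (at2_zmod a b).
HB.instance Definition _ a b := GRing.isMonoidMorphism.Build P k (at2 a b) (at2_monoid a b).

Lemma at2X a b : at2 a b 'X_0 = a. Proof. exact: mevalXU. Qed.
Lemma at2Y a b : at2 a b 'X_1 = b. Proof. exact: mevalXU. Qed.
Lemma at2Z a b c f : at2 a b (c *: f) = c * at2 a b f. Proof. exact: mevalZ. Qed.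

Lemma at2_sub (h : 'M[k]_2) a b f :
  at2 a b (linsub h f) = at2 (h 0 0 * a + h 1 0 * b) (h 0 1 * a + h 1 1 * b) f.
Proof.
rewrite /at2 /linsub comp_mpoly_meval; apply: meval_eq => -[[|[|//]] hi];
  by rewrite !(tnth_nth 0) /= mevalD !mevalZ !mevalXU.
Qed.

Lemma subX (h : 'M[k]_2) : linsub h 'X_0 = h 0 0 *: 'X_0 + h 1 0 *: 'X_1.
Proof. by rewrite /linsub comp_mpolyXU. Qed.
Lemma subY (h : 'M[k]_2) : linsub h 'X_1 = h 0 1 *: 'X_0 + h 1 1 *: 'X_1.
Proof. by rewrite /linsub comp_mpolyXU. Qed.

Lemma mpolyX2 m : 'X_[m] = 'X_0 ^+ (m 0) * 'X_1 ^+ (m 1) :> P.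
Proof.
rewrite mpolyXE_id !big_ord_recl big_ord0 mulr1.
by congr ('X_ _ ^+ m _ * 'X_ _ ^+ m _); apply/val_inj.
Qed.

Lemma mdeg2 (m : 'X_{1..2}) : mdeg m = (m 0%R + m 1%R)%N.
Proof.
rewrite mdegE !big_ord_recl big_ord0 addn0.
by congr (m _ + m _)%N; apply/val_inj.
Qed.

Lemma dhomogXY i j : ('X_0 ^+ i * 'X_1 ^+ j : P) \is (i + j).-homog.
Proof.
by apply: dhomogM; rewrite -[X in X.-homog for _]mul1n; apply: dhomogMn;
  rewrite dhomogX /= mdeg1.
Qed.

Lemma tv_dhomog n d e f g : f \is d.-homog -> g \is e.-homog ->
  tv n f g \is (d - n + (e - n)).-homog.
Proof.
elim: n d e f g => [|n IH] d e f g hf hg /=; first by rewrite !subn0 dhomogM.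
rewrite !subnS !predn_sub; apply: rpredB; apply: IH; exact: mderiv_dhomog.
Qed.

Lemma at2_homog d f c a b : f \is d.-homog -> at2 (c * a) (c * b) f = c ^+ d * at2 a b f.
Proof.
move=> hf; rewrite [f]mpolyE !raddf_sum /= mulr_sumr !big_seq; apply: eq_bigr => m hm.
rewrite !at2Z mpolyX2 !rmorphM !rmorphXn /= !at2X !at2Y.
by have /= <- := dhomog_mf hf hm; rewrite mdeg2 !exprMn exprD; ring.
Qed.

(** Divisibility of forms is studied on their dehomogenizations [f (X, 1)], where
roots are available. The point at infinity [(1, 0)] is seen as a drop of degree. *)
Definition dehom f : {poly k} := mmap (@polyC k) (tnth [tuple 'X; 1]) f.
Fact dehom_zmod : zmod_morphism dehom.
Proof. exact: mmapB. Qed.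
Fact dehom_monoid : monoid_morphism dehom.
Proof. by split; [exact: rmorph1 | exact: (rmorphM (mmap (@polyC k) _))]. Qed.
HB.instance Definition _ := GRing.isZmodMorphism.Build P {poly k} dehom dehom_zmod.
HB.instance Definition _ := GRing.isMonoidMorphism.Build P {poly k} dehom dehom_monoid.
Lemma dehomX : dehom 'X_0 = 'X. Proof. by rewrite /dehom mmapX mmap1U. Qed.
Lemma dehomY : dehom 'X_1 = 1. Proof. by rewrite /dehom mmapX mmap1U. Qed.
Lemma dehomZ c f : dehom (c *: f) = c *: dehom f.
Proof. by rewrite /dehom mmapZ mul_polyC. Qed.

Definition homog_of d p : P := \sum_(i < d.+1) p`_i *: ('X_0 ^+ i * 'X_1 ^+ (d - i)).

Lemma homog_of_dhomog d p : homog_of d p \is d.-homog.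
Proof.
apply: rpred_sum => i _; rewrite rpredZ //.
by have := dhomogXY i (d - i); rewrite subnKC // -ltnS.
Qed.

Lemma dehom_homog_of d p : (size p <= d.+1)%N -> dehom (homog_of d p) = p.
Proof.
move=> sp; have pE : p = \poly_(i < d.+1) p`_i.
  apply/polyP => i; rewrite coef_poly; case: ltnP => // di.
  by rewrite nth_default // (leq_trans sp).
rewrite raddf_sum /= [RHS]pE poly_def; apply: eq_bigr => i _.
by rewrite dehomZ rmorphM !rmorphXn /= dehomX dehomY expr1n mulr1.
Qed.

Lemma homog_ofK d f : f \is d.-homog -> homog_of d (dehom f) = f /\ (size (dehom f) <= d.+1)%N.
Proof.
move=> hf; suff [q sq qE] : exists2 q : {poly k}, (size q <= d.+1)%N & f = homog_of d q.
  by rewrite qE dehom_homog_of.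
exists (\sum_(m <- msupp f) f@_m *: 'X^(m 0)).
  rewrite big_seq; elim/big_ind: _ => [|a b sa sb|m hm]; first by rewrite size_poly0.
    by apply: leq_trans (size_polyD _ _) _; rewrite geq_max sa.
  apply: leq_trans (size_scale_leq _ _) _; rewrite size_polyXn ltnS.
  by have /= <- := dhomog_mf hf hm; rewrite mdeg2 leq_addr.
rewrite /homog_of; under eq_bigr do rewrite coef_sum scaler_suml.
rewrite exchange_big {1}[f]mpolyE /= !big_seq; apply: eq_bigr => m hm.
have /= md := dhomog_mf hf hm; rewrite mdeg2 in md.
have m0d : (m 0%R < d.+1)%N by rewrite ltnS -md leq_addr.
rewrite (bigD1 (Ordinal m0d)) //= big1 ?addr0 => [|i].
  by rewrite coefZ coefXn eqxx mulr1 mpolyX2 -md addKn.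
by rewrite -val_eqE /= => ni; rewrite coefZ coefXn (negPf ni) mulr0 scale0r.
Qed.

Lemma dehom_inj d f g : f \is d.-homog -> g \is d.-homog -> dehom f = dehom g -> f = g.
Proof. by move=> /homog_ofK[fE _] /homog_ofK[gE _] e; rewrite -fE e gE. Qed.

Lemma at2_homog_of d p a b :
  at2 a b (homog_of d p) = \sum_(i < d.+1) p`_i * (a ^+ i * b ^+ (d - i)).
Proof.
rewrite raddf_sum; apply: eq_bigr => i _.
by rewrite /= at2Z rmorphM !rmorphXn /= at2X at2Y.
Qed.

Lemma at2_dehom d f a b : f \is d.-homog ->
  at2 a b f = \sum_(i < d.+1) (dehom f)`_i * (a ^+ i * b ^+ (d - i)).
Proof. by move=> /homog_ofK[fE _]; rewrite -{1}fE at2_homog_of. Qed.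

Lemma at2_10 d f : f \is d.-homog -> at2 1 0 f = (dehom f)`_d.
Proof.
move=> hf; rewrite (at2_dehom _ _ hf) big_ord_recr /= subnn !expr1n mul1r expr0 mulr1.
rewrite big1 ?add0r // => i _; rewrite expr0n subn_eq0 leqNgt ltn_ord mulr0.
by rewrite mulr0.
Qed.

Lemma at2_1 d f a : f \is d.-homog -> at2 a 1 f = (dehom f).[a].
Proof.
move=> hf; rewrite (at2_dehom _ _ hf) (horner_coef_wide _ (homog_ofK hf).2).
by apply: eq_bigr => i _; rewrite expr1n mulr1.
Qed.

Lemma root_dehom d f a b : f \is d.-homog -> b != 0 -> at2 a b f = 0 -> root (dehom f) (a / b).
Proof.
move=> hf b0 fab; apply/rootP; rewrite -(at2_1 _ hf).
apply: (mulfI (expf_neq0 d b0)); rewrite mulr0 -(at2_homog _ _ _ hf) mulr1.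
by rewrite mulrCA divff // mulr1.
Qed.

(** For [F] vanishing at [(1, 0)] the quotient of the dehomogenizations has degree
at most [d - e], which is what makes it dehomogenize a form of that degree. The
hypothesis on the size of [dehom f] says that [(1, 0)] is a simple zero of [f]. *)
Lemma form_div d e f F : f \is e.-homog -> size (dehom f) = e -> (0 < e)%N ->
  F \is d.-homog -> at2 1 0 F = 0 -> dehom f %| dehom F ->
  F = 0 \/ exists F', [/\ (e <= d)%N, F' \is (d - e).-homog & F = f * F'].
Proof.
move=> hf sf e0 hF F0 fF; have [->|Fn0] := eqVneq F 0; [by left | right].
have dF0 : dehom F != 0.
  by apply: contraNneq Fn0 => d0; have [<- _] := homog_ofK hF; rewrite d0 /homog_of big1 // => i _; rewrite coef0 scale0r.
have sF : (size (dehom F) <= d)%N.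
  have [_ sF] := homog_ofK hF; rewrite leqNgt; apply: contra_neqN dF0 => lt.
  have sE : size (dehom F) = d.+1 by apply/eqP; rewrite eqn_leq sF.
  by apply/eqP; rewrite -lead_coef_eq0 lead_coefE sE /= -(at2_10 hF) F0.
have qE := divpK fF; set q := dehom F %/ dehom f in qE.
have f0 : dehom f != 0 by rewrite -size_poly_gt0 sf.
have q0 : q != 0 by apply: contraNneq dF0 => q0; rewrite -qE q0 mul0r.
have := size_mul q0 f0; rewrite qE sf => sqE.
have sq0 : (0 < size q)%N by rewrite size_poly_gt0.
move: sF; rewrite sqE -(prednK sq0) addSn /= => sqd.
have ed : (e <= d)%N by exact: leq_trans (leq_addl _ _) sqd.
exists (homog_of (d - e) q); split=> //; first exact: homog_of_dhomog.
apply: (dehom_inj hF); first by have := dhomogM hf (homog_of_dhomog (d - e) q); rewrite subnKC.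
rewrite rmorphM /= dehom_homog_of; first by rewrite mulrC qE.
by rewrite -(prednK sq0) ltnS leq_subRL // addnC.
Qed.

(** * Klein's induction *)

(** Klein's description of the forms invariant under a polyhedral group, from the
form [f] of degree [e] vanishing once at each point of the orbit of [(1, 0)].
The Hessian [H] and the Jacobian [T] of [f] and [H] are nonzero at [(1, 0)]; they
have degrees [2 (e - 2)] and [3 (e - 2)]. *)
Section Klein.
Variables (S : set (SL2 k)) (Q : P -> Prop).
Hypothesis char0 : [pchar k] =i pred0.
Hypothesis Qtv : tv_closed Q.
Hypothesis Qfix : forall f, Q f -> fixed_form S f.

Lemma fixed_cancel f F : f != 0 -> fixed_form S f -> fixed_form S (f * F) -> fixed_form S F.
Proof.
by move=> f0 ff fF h hS; apply: (mulfI f0); rewrite -{1}(ff h hS) -(rmorphM (linsub (val h))); exact: fF.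
Qed.

Lemma fixedB f g : fixed_form S f -> fixed_form S g -> fixed_form S (f - g).
Proof. by move=> ff fg h hS; rewrite raddfB /= ff ?fg. Qed.

Lemma Q_C a : Q a%:MP. Proof. by have [] := Qtv. Qed.
Lemma Q_D f g : Q f -> Q g -> Q (f + g). Proof. by have [_ + _ _] := Qtv; apply. Qed.
Lemma Q_M f g : Q f -> Q g -> Q (f * g). Proof. by have [_ _ + _] := Qtv; apply. Qed.
Lemma Q_Z a f : Q f -> Q (a *: f).
Proof. by move=> Qf; rewrite -mul_mpolyC; apply: Q_M => //; apply: Q_C. Qed.
Lemma Q_X f n : Q f -> Q (f ^+ n).
Proof.
move=> Qf; elim: n => [|n IH]; first by rewrite expr0 -mpolyC1; apply: Q_C.
by rewrite exprS; apply: Q_M.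
Qed.
Lemma Q_0 : Q 0. Proof. by rewrite -mpolyC0; apply: Q_C. Qed.
Lemma Q_sum I (r : seq I) (A : pred I) (F : I -> P) :
  (forall i, A i -> Q (F i)) -> Q (\sum_(i <- r | A i) F i).
Proof. by move=> QF; apply: big_ind => //; [exact: Q_0 | exact: Q_D]. Qed.
Lemma Q_tv n d e f g : f \is d.-homog -> g \is e.-homog -> Q f -> Q g -> Q (tv n f g).
Proof. by have [_ _ _ +] := Qtv; apply. Qed.

Variables (e : nat) (f : P).
Hypothesis e3 : (3 < e)%N.
Hypothesis hf : f \is e.-homog.
Hypothesis Qf : Q f.
Hypothesis f0 : at2 1 0 f = 0.
Hypothesis f1 : at2 1 0 f^`M(1) != 0.

Lemma at2_dx d g : g \is d.-homog -> at2 1 0 g^`M(0) = d%:R * at2 1 0 g.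
Proof.
move=> /dhomog_eul /(congr1 (at2 1 0)).
by rewrite rmorphD !rmorphM /= at2X at2Y mul1r mul0r addr0 at2Z.
Qed.

(** At a zero of [f] the Hessian is minus the square of the only surviving mixed
derivative, up to a positive factor. *)
Lemma hess_neq0 : at2 1 0 (tv 2 f f) != 0.
Proof.
have fx := mderiv_dhomog 0 hf; have fy := mderiv_dhomog 1 hf.
rewrite /= !rmorphB !rmorphM /= (at2_dx fx) (at2_dx hf) f0 !mulr0 !mul0r.
rewrite (mderiv_comm 0 1) (at2_dx fy) sub0r subr0 -opprD oppr_eq0 -mulr2n.
rewrite -[_ *+ 2]mulr_natr !mulf_neq0 // (char0_natr_neq0 char0) //.
all: by rewrite ?ltn_predRL // (ltn_trans _ e3).
Qed.

Lemma jac_neq0 : at2 1 0 (tv 1 f (tv 2 f f)) != 0.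
Proof.
have hH := tv_dhomog 2 hf hf; move: (tv 2 f f) hH hess_neq0 => H hH H0.
rewrite /= rmorphB !rmorphM /= (at2_dx hf) f0 mulr0 mul0r sub0r oppr_eq0.
rewrite mulf_neq0 // (at2_dx hH) mulf_neq0 // (char0_natr_neq0 char0) //.
by rewrite addn_gt0 subn_gt0 (ltn_trans _ e3).
Qed.

Hypothesis fdiv : forall d F, F \is d.-homog -> fixed_form S F -> at2 1 0 F = 0 ->
  F = 0 \/ exists F', [/\ (e <= d)%N, F' \is (d - e).-homog & F = f * F'].
Hypothesis fdeg : forall d F, F \is d.-homog -> fixed_form S F -> at2 1 0 F != 0 ->
  exists2 q, d = ((e - 2) * q)%N & q != 1%N.

(** A form nonvanishing at [(1, 0)] has degree [(e - 2) q] with [q <> 1], that is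
[q = 2 a + 3 b], so a multiple of [H^a T^b] has the same value at [(1, 0)]. The
difference vanishes on the orbit of [(1, 0)] and is divisible by [f]; the quotient
is invariant, of smaller degree. *)
Lemma klein_induction d F : F \is d.-homog -> fixed_form S F -> Q F.
Proof.
elim/ltn_ind: d F => d IH F hF fF.
have fn0 : f != 0 by apply: contraNneq f1 => ->; rewrite linear0 raddf0.
have [F0|F0] := eqVneq (at2 1 0 F) 0.
  case: (fdiv hF fF F0) => [->|[F' [ed hF' FE]]]; first exact: Q_0.
  rewrite FE; apply: Q_M => //; apply: (IH _ _ F' hF').
    by rewrite ltn_subrL (leq_ltn_trans _ e3) // (leq_trans _ ed) // (leq_ltn_trans _ e3).
  by apply: (@fixed_cancel f); [ | exact: Qfix | rewrite -FE].
have [q dE q1] := fdeg hF fF F0.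
pose H := tv 2 f f; pose T := tv 1 f H.
have hH : H \is ((e - 2) * 2).-homog by rewrite muln2 -addnn; exact: tv_dhomog.
have hT : T \is ((e - 2) * 3).-homog.
  have -> : ((e - 2) * 3 = (e - 1) + ((e - 2) * 2 - 1))%N by lia.
  exact: tv_dhomog.
have QH : Q H by apply: (Q_tv _ hf hf).
have QT : Q T by apply: (Q_tv _ hf hH).
(* 2 and 3 generate all natural numbers but 1. *)
have [a [b qE]] : exists a b, q = (2 * a + 3 * b)%N.
  have qo := odd_double_half q; case: (odd q) qo q1 => qo q1.
    by exists (q./2 - 1)%N, 1%N; lia.
  by exists q./2, 0%N; lia.
pose G := H ^+ a * T ^+ b.
have hG : G \is d.-homog.
  by rewrite dE qE mulnDr !mulnA; apply: dhomogM; apply: dhomogMn.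
have G0 : at2 1 0 G != 0.
  by rewrite rmorphM !rmorphXn mulf_neq0 // expf_neq0 //; [exact: hess_neq0 | exact: jac_neq0].
have QG : Q G by apply: Q_M; apply: Q_X.
pose c := at2 1 0 F / at2 1 0 G.
have hFG : F - c *: G \is d.-homog by rewrite rpredB // rpredZ.
have QcG : Q (c *: G) by exact: Q_Z.
have fFG : fixed_form S (F - c *: G) by apply: fixedB => //; exact: Qfix.
have FG0 : at2 1 0 (F - c *: G) = 0 by rewrite rmorphB /= at2Z divfK // subrr.
rewrite -[F](subrK (c *: G)); apply: Q_D => //.
case: (fdiv hFG fFG FG0) => [->|[F' [ed hF' FE]]]; first exact: Q_0.
rewrite FE; apply: Q_M => //; apply: (IH _ _ F' hF').
  by rewrite ltn_subrL (leq_ltn_trans _ e3) // (leq_trans _ ed) // (leq_ltn_trans _ e3).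
by apply: (@fixed_cancel f); [ | exact: Qfix | rewrite -FE].
Qed.
End Klein.
End Forms.

(** * The binary tetrahedral group *)
Section Groups.
Variable k : fieldType.
Hypothesis char0 : [pchar k] =i pred0.
Local Notation P := {mpoly k[2]}.
Local Notation X := ('X_0 : P).
Local Notation Y := ('X_1 : P).
Implicit Types (f g F : P) (p q : {poly k}).

Lemma invariantsU (S T : set (SL2 k)) :
  invariants (S `|` T) = invariants S `&` invariants T.
Proof.
apply/seteqP; split=> [b bST|b [bS bT] h [hS|hT]]; last 2 first.
- exact: bS.
- exact: bT.
by split=> h hS; apply: bST; [left | right].
Qed.

Lemma fixed_SL2_of (T : set 'M[k]_2) f :
  (forall M, T M -> linsub M f = f) -> fixed_form (SL2_of T) f.
Proof. by move=> Tf h; apply: Tf. Qed.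

Lemma fixed_at (T : set 'M[k]_2) f M : fixed_form (SL2_of T) f -> T M -> \det M = 1 ->
  forall a b, at2 (M 0 0 * a + M 1 0 * b) (M 0 1 * a + M 1 1 * b) f = at2 a b f.
Proof.
move=> ff TM /eqP dM a b; rewrite -at2_sub; congr at2.
exact: (ff (SL2Sub dM) TM).
Qed.

Lemma at2_dY g : at2 1 0 (Y * g)^`M(1) = at2 1 0 g.
Proof.
rewrite mderivM mderivXU mul1r rmorphD rmorphM /= at2Y mul0r addr0 //.
Qed.

Lemma root_dehom1 d F r b : F \is d.-homog -> b != 0 -> at2 (r * b) b F = 0 ->
  root (dehom F) r.
Proof. by move=> hF b0 /(root_dehom hF b0); rewrite mulfK. Qed.

Lemma prim_neq0 n (c : k) : n.-primitive_root c -> c != 0.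
Proof.
move=> cn; apply/eqP => c0; have /eqP := prim_expr_order cn.
by rewrite c0 expr0n; have := prim_order_gt0 cn; case: n {cn} => //= n _; rewrite eq_sym oner_eq0.
Qed.

Section Tetrahedral.
Variable i : k.
Hypothesis ii : i ^+ 2 = -1.

(** Its zeros [0, infinity, 1, -1, i, -i] are the vertices of an octahedron. *)
Definition v3 : P := X * Y * (X ^+ 4 - Y ^+ 4).
Definition S_BT : set 'M[k]_2 := [set quat_i i; quat_j k; quat_k i; sigma i ^+ 2].

Lemma invariants_BT : invariants (BT24 i) = invariants (SL2_of S_BT).
Proof. by rewrite /BT24 invariants_gen invariantsU /BD8 invariants_gen -invariantsU. Qed.

Lemma two_neq0 : 2%:R != 0 :> k. Proof. exact: (char0_natr_neq0 char0). Qed.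
Local Notation H := (2%:R^-1 : k).

Lemma sigma2E : sigma i ^+ 2 =
  mx2 ((i - 1) * H) ((1 + i) * H) ((i - 1) * H) (- ((1 + i) * H)).
Proof.
have sE : sigma i = mx2 (H * (1 + i)) (H * (1 + i)) (H * (-1 + i)) (H * (1 - i)).
  rewrite /sigma [LHS]mx2E !mxE /= !(mulr0n, mulr1n, addr0, add0r).
  by congr mx2; ring.
have hh : H * H * 2 = H by rewrite -mulrA mulVf ?mulr1 // two_neq0.
rewrite expr2 -[LHS]/(sigma i *m sigma i) sE mul_mx2; congr mx2.
- transitivity (H * H * 2 * (i - 1)); first by ring: ii.
  by rewrite hh mulrC.
- transitivity (H * H * 2 * (1 + i)); first by ring: ii.
  by rewrite hh mulrC.
- transitivity (H * H * 2 * (i - 1)); first by ring: ii.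
  by rewrite hh mulrC.
- transitivity (- (H * H * 2 * (1 + i))); first by ring: ii.
  by rewrite hh mulrC.
Qed.

Lemma two_half : 2 * H = 1. Proof. by rewrite divff // two_neq0. Qed.

Lemma det_sigma2 : \det (sigma i ^+ 2) = 1.
Proof.
rewrite sigma2E det_mx2; transitivity ((2 * H) ^+ 2); first by ring: ii.
by rewrite two_half expr1n.
Qed.

Section FixedBT.
Variables (d : nat) (F : P).
Hypothesis hF : F \is d.-homog.
Hypothesis fF : fixed_form (SL2_of S_BT) F.

Lemma bt_i a b : at2 (i * a) (- i * b) F = at2 a b F.
Proof.
have [di _ _] := det_quat ii; have T : S_BT (quat_i i) by left; left; left.
by have := fixed_at fF T di a b; rewrite !mxE /= !mul0r addr0 add0r.
Qed.
Lemma bt_j a b : at2 (- b) a F = at2 a b F.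
Proof.
have [_ dj _] := det_quat ii; have T : S_BT (quat_j k) by left; left; right.
by have := fixed_at fF T dj a b; rewrite !mxE /= !mul0r addr0 add0r mulN1r mul1r.
Qed.
Lemma bt_s a b : at2 ((i - 1) * (a + b)) ((1 + i) * (a - b)) F = 2 ^+ d * at2 a b F.
Proof.
have T : S_BT (sigma i ^+ 2) by right.
have := fixed_at fF T det_sigma2 a b; rewrite sigma2E !mxE /= => <-.
rewrite -(at2_homog _ _ _ hF); congr (at2 _ _ _).
  by rewrite -[LHS]mul1r -[X in X * _ = _]two_half; ring.
by rewrite -[LHS]mul1r -[X in X * _ = _]two_half; ring.
Qed.

(** Transport of the zero [(1, 0)] along its orbit: [(0, 1)] by the quaternion [j],
and the other four by applying sigma^2 once or twice to these. *)
Lemma bt_roots : at2 1 0 F = 0 ->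
  [/\ root (dehom F) 0, root (dehom F) 1, root (dehom F) (-1), root (dehom F) i & root (dehom F) (- i)].
Proof.
move=> F0; have F01 : at2 0 1 F = 0 by rewrite -{1}oppr0 bt_j.
have i1 : 1 + i != 0.
  apply: contraNneq two_neq0 => i1; suff -> : 2%:R = (1 + i) * (1 - i) by rewrite i1 mul0r.
  by ring: ii.
have F1 : at2 (i * (1 + i)) (1 + i) F = 0.
  have := bt_s 1 0; rewrite F0 mulr0 => <-; congr at2; ring: ii.
have F2 : at2 (- i * - (1 + i)) (- (1 + i)) F = 0.
  have := bt_s 0 1; rewrite F01 mulr0 => <-; congr at2; ring: ii.
have r1 := root_dehom1 hF i1 F1.
have r2 : root (dehom F) (- i) by apply: (root_dehom1 hF _ F2); rewrite oppr_eq0.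
have two_neq0 := two_neq0.
have F3 : at2 (1 * (- 2)) (- 2) F = 0.
  have /rootP := r1; rewrite -(at2_1 _ hF) => e; have := bt_s i 1; rewrite e mulr0 => <-.
  congr at2; ring: ii.
have F4 : at2 (- 1 * (-2 * i)) (- 2 * i) F = 0.
  have /rootP := r2; rewrite -(at2_1 _ hF) => e; have := bt_s (- i) 1; rewrite e mulr0 => <-.
  congr at2; ring: ii.
have i0 : i != 0.
  by apply: contraNneq (oner_neq0 k) => i0; rewrite -[1]opprK -ii i0 expr0n oppr0.
split=> //.
- by apply/rootP; rewrite -(at2_1 _ hF).
- by apply: (root_dehom1 hF _ F3); rewrite oppr_eq0.
- by apply: (root_dehom1 hF _ F4); rewrite mulf_neq0 // oppr_eq0.
Qed.
End FixedBT.

Lemma v3_homog : v3 \is 6.-homog.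
Proof.
apply: (@dhomogM _ _ _ 2 _ 4); first by have := dhomogXY k 1 1; rewrite !expr1.
apply: rpredB; first by have := dhomogXY k 4 0; rewrite expr0 mulr1.
by have := dhomogXY k 0 4; rewrite expr0 mul1r.
Qed.
Lemma dehom_v3 : dehom v3 = 'X ^+ 5 - 'X.
Proof. by rewrite /v3 !(rmorphXn, rmorphM, rmorphB) /= dehomX dehomY expr1n mulr1 mulrBr mulr1 -exprS. Qed.
Lemma size_dehom_v3 : size (dehom v3) = 6.
Proof. by rewrite dehom_v3 size_polyDl ?size_polyN ?size_polyXn ?size_polyX. Qed.
Lemma v3_10 : at2 1 0 v3 = 0.
Proof. by rewrite /v3 !(rmorphXn, rmorphM, rmorphB) /= at2X at2Y mulr0 mul0r. Qed.
Lemma v3_d1 : at2 1 0 v3^`M(1) = 1.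
Proof.
rewrite /v3 [X * Y]mulrC -mulrA at2_dY !(rmorphXn, rmorphM, rmorphB) /= at2X at2Y.
by rewrite expr1n expr0n subr0 mulr1.
Qed.

Lemma v3_fixed : fixed_form (SL2_of S_BT) v3.
Proof.
have IIC : (i%:MP : P) ^+ 2 = -1 by rewrite -rmorphXn ii rmorphN1.
apply: fixed_SL2_of => M TM.
rewrite /v3 !(rmorphXn, rmorphM, rmorphB) /= subX subY -!mul_mpolyC.
case: TM => [[[|]|]|] ->; rewrite ?sigma2E !mxE /= ?rmorph0 ?rmorphN ?rmorphM ?rmorphB ?rmorphD ?rmorph1 /=.
- move: (i%:MP) IIC X Y => I II x y; ring: II.
- by move: X Y => x y; ring.
- move: (i%:MP) IIC X Y => I II x y; ring: II.
have HH : 2 * (H%:MP : P) = 1 by rewrite -(rmorph_nat (@mpolyC 2 k)) -mpolyCM two_half.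
move: (i%:MP) IIC X Y (H%:MP) HH => I II x y h hh.
transitivity ((2 * h) ^+ 6 * (x * y * (x ^+ 4 - y ^+ 4))); first by ring: II.
by rewrite hh expr1n mul1r.
Qed.

Lemma v3_divides d F : F \is d.-homog -> fixed_form (SL2_of S_BT) F -> at2 1 0 F = 0 ->
  F = 0 \/ exists F', [/\ (6 <= d)%N, F' \is (d - 6).-homog & F = v3 * F'].
Proof.
move=> hF fF F0; apply: (form_div v3_homog size_dehom_v3) => //.
have [r0 r1 rm1 ri rmi] := bt_roots hF fF F0.
have i0 : i != 0.
  by apply: contraNneq (oner_neq0 k) => i0; rewrite -[1]opprK -ii i0 expr0n oppr0.
have two_neq0 := two_neq0.
have -> : dehom v3 = \prod_(r <- [:: 0; 1; -1; i; -i]) ('X - r%:P).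
  rewrite dehom_v3 !big_cons big_nil !rmorphN rmorph1 rmorph0 /=.
  have: (i%:P : {poly k}) ^+ 2 = -1 by rewrite -rmorphXn ii rmorphN1.
  by move: (i%:P) 'X => I x II; ring: II.
apply: uniq_roots_dvdp; first by rewrite /= r0 r1 rm1 ri rmi.
rewrite uniq_rootsE /= !inE !negb_or ![0 == _]eq_sym oner_eq0 !oppr_eq0 oner_eq0 i0 /=.
have n1 (a b : k) : 2%:R = (a - b) * (a + b) -> a != b.
  by move=> ab; apply: contraNneq two_neq0 => eab; rewrite ab eab subrr mul0r.
have n2 (a : k) : a != 0 -> a != - a.
  move=> a0; apply: contraNneq two_neq0 => e.
  have /eqP : 2%:R * a = 0 by rewrite mulr_natl mulr2n {2}e subrr.
  by rewrite mulf_eq0 (negPf a0) orbF.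
rewrite n2 ?oner_neq0 // n2 //=; last exact: oner_neq0.
by rewrite !andbT; apply/andP; split; apply/andP; split; apply: n1; ring: ii.
Qed.

Lemma i_prim : 4.-primitive_root i.
Proof.
apply/andP; split=> //; apply/forallP => -[[|[|[|[|//]]]] hi] /=; rewrite unity_rootE /=.
- rewrite expr1 (_ : (1 == 4)%N = false) // eqbF_neg; apply/eqP => i1; move: ii; rewrite i1 expr1n => e.
  by have := two_neq0; rewrite -[2%:R]/(1 + 1) {2}e subrr eqxx.
- rewrite ii (_ : (2 == 4)%N = false) // eqbF_neg; apply/eqP => e.
  by have := two_neq0; rewrite -[2%:R]/(1 + 1) -{2}e subrr eqxx.
- rewrite exprS ii (_ : (3 == 4)%N = false) // eqbF_neg; apply/eqP => e.
  have i1 : i = -1 by rewrite -e mulrN1 opprK.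
  move: ii; rewrite i1 sqrrN expr1n => e'.
  by have := two_neq0; rewrite -[2%:R]/(1 + 1) {2}e' subrr eqxx.
by rewrite (_ : i ^+ 4 = 1) ?eqxx //; ring: ii.
Qed.

(** The quaternion [i] acts on the value at [(1, 0)] by [i^d], so 4 divides [d]. An
invariant of degree 4 vanishes there. *)
Lemma bt_degree d F : F \is d.-homog -> fixed_form (SL2_of S_BT) F -> at2 1 0 F != 0 ->
  exists2 q, d = ((6 - 2) * q)%N & q != 1%N.
Proof.
move=> hF fF F0; have d4 : (4 %| d)%N.
  rewrite (prim_order_dvd i_prim); apply/eqP/(mulIf F0); rewrite mul1r.
  by rewrite -(at2_homog _ _ _ hF) mulr0 -[in RHS](bt_i fF) mulr0.
exists (d %/ 4)%N; first by rewrite mulnC divnK.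
apply: contraNneq F0 => q1; have dE : d = 4%N by rewrite -(divnK d4) q1.
move: hF fF; rewrite {d4 q1}dE => hF fF.
pose p j := (dehom F)`_j.
have FE a b : at2 a b F = p 0%N * b ^+ 4 + p 1%N * a * b ^+ 3 + p 2%N * a ^+ 2 * b ^+ 2
   + p 3%N * a ^+ 3 * b + p 4%N * a ^+ 4.
  rewrite (at2_dehom _ _ hF) !big_ord_recr big_ord0 /= /p; ring.
(* The relations of invariance at a few points are linear in the five coefficients
   of F; this combination of them leaves only a multiple of F(1, 0). *)
have : 192%:R * at2 1 0 F =
  2 * ((2 ^+ 4 * at2 1 0 F - at2 ((i - 1) * (1 + 0)) ((1 + i) * (1 - 0)) F)
     + (2 ^+ 4 * at2 0 1 F - at2 ((i - 1) * (0 + 1)) ((1 + i) * (0 - 1)) F))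
  + (2 ^+ 4 * at2 1 1 F - at2 ((i - 1) * (1 + 1)) ((1 + i) * (1 - 1)) F)
  + 64%:R * (at2 1 0 F - at2 (- 0) 1 F)
  - 8%:R * (at2 1 1 F - at2 (i * 1) (- i * 1) F).
  by rewrite !FE; ring: ii.
rewrite !(bt_s hF fF) (bt_i fF) (bt_j fF) !subrr !mulr0 !addr0 subr0 mulr0 => /eqP.
by rewrite mulf_eq0 (negPf (char0_natr_neq0 char0 _)) //= => /eqP.
Qed.

Lemma invariants_binary_tetrahedral : invariants (BT24 i) = subalgebra_gen (hat v3).
Proof.
rewrite invariants_BT -(bigcup_set1 (@hat k) v3); apply: invariants_generated_by_forms => //.
  move=> f ->; split; last exact: v3_fixed.
  by exists 6; exact: v3_homog.
move=> Q Qtv Qv3 Qfix d F.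
apply: (klein_induction char0 Qtv Qfix (isT : 3 < 6)%N v3_homog) => //.
- exact: Qv3.
- exact: v3_10.
- by rewrite v3_d1 oner_neq0.
- exact: v3_divides.
- exact: bt_degree.
Qed.

(** * The binary octahedral group *)
Variable z : k.
Hypothesis z8 : 8.-primitive_root z.
(** Its zeros are the vertices of a cube. *)
Definition v1 : P := X ^+ 8 + 14 * X ^+ 4 * Y ^+ 4 + Y ^+ 8.
Definition S_BO : set 'M[k]_2 := S_BT `|` [set psi z].

Lemma invariants_BO : invariants (BO48 i z) = invariants (SL2_of S_BO).
Proof. by rewrite /BO48 invariants_gen invariantsU invariants_BT -invariantsU. Qed.

Lemma mderiv_exp f n j : (f ^+ n.+1)^`M(j) = n.+1%:R * f^`M(j) * f ^+ n.
Proof.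
elim: n => [|n IH]; first by rewrite expr1 expr0 mul1r mulr1.
rewrite exprS mderivM IH -[n.+2%:R]natr1 exprS.
by clear IH; move: f (f^`M(j)) (f ^+ n) (n.+1%:R) => a b c e; ring.
Qed.
Lemma mderiv_natr n j : (n%:R : P)^`M(j) = 0.
Proof. by rewrite mderivMn -mpolyC1 mderivC mul0rn. Qed.

Lemma mderivX0 n : (X ^+ n.+1)^`M(0) = n.+1%:R * X ^+ n.
Proof. by rewrite mderiv_exp mderivXU mulr1. Qed.
Lemma mderivX1 n : (X ^+ n)^`M(1) = 0.
Proof. by case: n => [|n]; [rewrite expr0 (mderiv_natr 1) | rewrite mderiv_exp mderivXU mulr0 mul0r]. Qed.
Lemma mderivY1 n : (Y ^+ n.+1)^`M(1) = n.+1%:R * Y ^+ n.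
Proof. by rewrite mderiv_exp mderivXU mulr1. Qed.
Lemma mderivY0 n : (Y ^+ n)^`M(0) = 0.
Proof. by case: n => [|n]; [rewrite expr0 (mderiv_natr 1) | rewrite mderiv_exp mderivXU mulr0 mul0r]. Qed.
Lemma mderiv_nM n f j : (n%:R * f)^`M(j) = n%:R * f^`M(j).
Proof. by rewrite mderivM mderiv_natr mul0r add0r. Qed.

Lemma v1x : v1^`M(0) = 8%:R * X ^+ 7 + 56%:R * (X ^+ 3 * Y ^+ 4).
Proof.
rewrite /v1 mderivD mderivD -mulrA (mderiv_nM 14) mderivM !mderivX0 !mderivY0.
by rewrite mulr0 !addr0; move: X Y => x y; ring.
Qed.
Lemma v1y : v1^`M(1) = 56%:R * (X ^+ 4 * Y ^+ 3) + 8%:R * Y ^+ 7.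
Proof.
rewrite /v1 mderivD mderivD -mulrA (mderiv_nM 14) mderivM !mderivX1 !mderivY1.
by rewrite mul0r !add0r; move: X Y => x y; ring.
Qed.
Lemma v1xx : v1^`M(0)^`M(0) = 56%:R * X ^+ 6 + 168%:R * (X ^+ 2 * Y ^+ 4).
Proof.
rewrite v1x mderivD !mderiv_nM mderivM !mderivX0 !mderivY0.
by rewrite mulr0 !addr0; move: X Y => x y; ring.
Qed.
Lemma v1xy : v1^`M(0)^`M(1) = 224%:R * (X ^+ 3 * Y ^+ 3).
Proof.
rewrite v1x mderivD !mderiv_nM mderivM !mderivX1 !mderivY1.
by rewrite mulr0 mul0r !add0r; move: X Y => x y; ring.
Qed.
Lemma v1yy : v1^`M(1)^`M(1) = 168%:R * (X ^+ 4 * Y ^+ 2) + 56%:R * Y ^+ 6.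
Proof.
rewrite v1y mderivD !mderiv_nM mderivM !mderivX1 !mderivY1.
by rewrite mul0r !add0r; move: X Y => x y; ring.
Qed.

(** The Hessian of the cube form is a multiple of the square of the octahedron
form. So [v3 ^+ 2], and then its Jacobian with [v1], that is [v3 * t_BO] up to a
factor, are produced by transvectants of [v1]. *)
Lemma tv_v1 : tv 2 v1 v1 = 192%:R * (98%:R * v3 ^+ 2).
Proof.
rewrite /= (mderiv_comm 1 0) v1xx v1xy v1yy /v3.
by move: X Y => x y; ring.
Qed.

(** The form of degree 12 whose zeros are the edge midpoints of the cube. *)
Definition t_BO : P := tv 1 v1 v3.

Lemma tv1_v3sq : tv 1 v1 (v3 ^+ 2) = 2%:R * (v3 * t_BO).
Proof.
rewrite /t_BO /= !mderiv_exp expr1.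
by move: (v1^`M(0)) (v1^`M(1)) (v3^`M(0)) (v3^`M(1)) (v3) => *; ring.
Qed.

Lemma v1_homog : v1 \is 8.-homog.
Proof.
rewrite /v1 -mulrA -[14]/(14%:R) mulr_natl.
apply: rpredD; last by have := dhomogXY k 0 8; rewrite expr0 mul1r.
apply: rpredD; first by have := dhomogXY k 8 0; rewrite expr0 mulr1.
by apply: rpredMn; exact: (dhomogXY k 4 4).
Qed.

Lemma v1_10 : at2 1 0 v1 = 1.
Proof.
rewrite /v1 -[14]/(14%:R) !(rmorphXn, rmorph_nat, rmorphD, rmorphM) /= at2X at2Y !expr0n !expr1n /=.
by rewrite mulr0 !addr0.
Qed.

Lemma t_homog : t_BO \is 12.-homog.
Proof. exact: (tv_dhomog 1 v1_homog v3_homog). Qed.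

Lemma t_10 : at2 1 0 t_BO = 8%:R.
Proof.
rewrite /t_BO /= rmorphB !rmorphM /= (at2_dx v1_homog) v1_10 v3_d1.
by rewrite (at2_dx v3_homog) v3_10 !mulr0 subr0 !mulr1.
Qed.

Lemma zeta8_neq0 : z != 0. Proof. exact: prim_neq0 z8. Qed.

Lemma zeta8_pow4 : z ^+ 4 = -1.
Proof.
have /eqP : (z ^+ 4 - 1) * (z ^+ 4 + 1) = 0.
  by rewrite -subr_sqr expr1n -exprM (prim_expr_order z8) subrr.
rewrite mulf_eq0 subr_eq0 -(prim_order_dvd z8) /= addr_eq0 => /eqP //.
Qed.

Lemma v1_fixed : fixed_form (SL2_of S_BO) v1.
Proof.
have II : (i%:MP : P) ^+ 2 = -1 by rewrite -rmorphXn ii rmorphN1.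
have Z4 : (z%:MP : P) ^+ 4 = -1 by rewrite -rmorphXn zeta8_pow4 rmorphN1.
have W4 : (z^-1%:MP : P) ^+ 4 = -1 by rewrite -rmorphXn exprVn zeta8_pow4 invrN1 rmorphN1.
apply: fixed_SL2_of => M TM.
rewrite /v1 -[14]/(14%:R) !(rmorphXn, rmorph_nat, rmorphD, rmorphM) /= subX subY -!mul_mpolyC.
case: TM => [[[[|]|]|]|] ->; rewrite ?sigma2E !mxE /= ?rmorph0 ?rmorphN ?rmorphM ?rmorphB ?rmorphD ?rmorph1 /=.
- move: (i%:MP) II X Y => I II x y; ring: II.
- by move: X Y => x y; ring.
- move: (i%:MP) II X Y => I II x y; ring: II.
- have HH : 2 * (H%:MP : P) = 1 by rewrite -(rmorph_nat (@mpolyC 2 k)) -mpolyCM two_half.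
  move: (i%:MP) II X Y (H%:MP) HH => I II x y h hh.
  transitivity ((2 * h) ^+ 8 * (x ^+ 8 + 14%:R * x ^+ 4 * y ^+ 4 + y ^+ 8)); first by ring: II.
  by rewrite hh expr1n mul1r.
by move: (z%:MP) (z^-1%:MP) Z4 W4 X Y => Z W Z4 W4 x y; ring: Z4 W4.
Qed.

Lemma v3_psi : linsub (psi z) v3 = - v3.
Proof.
have ZW : (z%:MP : P) * z^-1%:MP = 1 by rewrite -mpolyCM divff ?zeta8_neq0.
have Z4 : (z%:MP : P) ^+ 4 = -1 by rewrite -rmorphXn zeta8_pow4 rmorphN1.
have W4 : (z^-1%:MP : P) ^+ 4 = -1 by rewrite -rmorphXn exprVn zeta8_pow4 invrN1 rmorphN1.
rewrite /v3 !(rmorphXn, rmorphB, rmorphM) /= subX subY -!mul_mpolyC !mxE /= rmorph0.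
move: (z%:MP) (z^-1%:MP) ZW Z4 W4 X Y => Z W ZW Z4 W4 x y.
transitivity (Z * W * (x * y * (Z ^+ 4 * x ^+ 4 - W ^+ 4 * y ^+ 4))); first by ring.
by rewrite ZW Z4 W4; ring.
Qed.

Lemma fixed_BO f : fixed_form (SL2_of S_BO) f <->
  fixed_form (SL2_of S_BT) f /\ linsub (psi z) f = f.
Proof.
split=> [ff|[ff fp] h [hS|->] //]; last exact: ff.
split=> [h hS|]; first by apply: ff; left.
have /eqP dM := det_psi zeta8_neq0; exact: (ff (SL2Sub dM) (or_intror erefl)).
Qed.

Lemma at2_psi a b f : at2 a b (linsub (psi z) f) = at2 (z * a) (z^-1 * b) f.
Proof. by rewrite at2_sub !mxE /= !mul0r addr0 add0r. Qed.

Lemma v3_neq0 : v3 != 0.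
Proof. by apply: contraNneq (oner_neq0 k) => v0; rewrite -v3_d1 v0 linear0 raddf0. Qed.

Section OctahedralForms.
Variable Q : P -> Prop.
Hypothesis Qtv : tv_closed Q.
Hypothesis Qfix : forall f, Q f -> fixed_form (SL2_of S_BO) f.
Hypothesis Qv1 : Q v1.

Lemma Q_unscale n f : (0 < n)%N -> Q (n%:R * f) -> Q f.
Proof.
move=> n0 Qf; have n0' := char0_natr_neq0 char0 n0.
rewrite -[f]scale1r -(mulVf n0') -scalerA; apply: Q_Z => //.
by rewrite -mul_mpolyC rmorph_nat.
Qed.

Lemma Q_v3sq : Q (v3 ^+ 2).
Proof.
apply: (@Q_unscale 98) => //; apply: (@Q_unscale 192) => //.
by rewrite -tv_v1; apply: (Q_tv Qtv _ v1_homog v1_homog).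
Qed.

Lemma Q_v3t : Q (v3 * t_BO).
Proof.
apply: (@Q_unscale 2) => //; rewrite -tv1_v3sq.
apply: (Q_tv Qtv _ v1_homog _ Qv1 Q_v3sq); exact: (dhomogMn 2 v3_homog).
Qed.

(** [v3 * t_BO] is invariant because transvectants of invariants are; cancelling
[v3] gives the behaviour of [t_BO], here and in the next lemma. *)
Lemma t_fixed : fixed_form (SL2_of S_BT) t_BO.
Proof.
have [vt _] := (fixed_BO _).1 (Qfix Q_v3t).
exact: (fixed_cancel v3_neq0 v3_fixed vt).
Qed.

Lemma t_psi : linsub (psi z) t_BO = - t_BO.
Proof.
have [_] := (fixed_BO _).1 (Qfix Q_v3t); rewrite rmorphM /= v3_psi => e.
by apply: (mulfI v3_neq0); rewrite mulrN -e mulNr opprK.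
Qed.

(** The binary octahedral group contains the tetrahedral one with index 2, and
[psi_8] changes the sign of [v3] and [t_BO]. A multiple of a power of [v1] corrects
the value of [F] at [(1, 0)], leaving [v3 * G1] with [G1] tetrahedral and
anti-invariant; a multiple of [t_BO * v1 ^+ a] corrects the value of [G1], leaving
[v3 ^+ 2] times an octahedral form. *)
Lemma octahedral_forms d F : F \is d.-homog -> fixed_form (SL2_of S_BO) F -> Q F.
Proof.
elim/ltn_ind: d F => d IH F hF fF.
have main G : G \is d.-homog -> fixed_form (SL2_of S_BO) G -> at2 1 0 G = 0 -> Q G.
  move=> hG fG G0; have [btG psG] := (fixed_BO _).1 fG.
  case: (v3_divides hG btG G0) => [->|[G1 [d6 hG1 GE]]]; first exact: Q_0.
  have bt1 : fixed_form (SL2_of S_BT) G1.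
    by apply: (fixed_cancel v3_neq0 v3_fixed); rewrite -GE.
  have ps1 : linsub (psi z) G1 = - G1.
    apply: (mulfI v3_neq0); rewrite mulrN -GE -psG GE rmorphM /= v3_psi.
    by rewrite mulNr opprK.
  have sub_case c (K : P) : K \is (d - 6).-homog -> fixed_form (SL2_of S_BT) K ->
      linsub (psi z) K = - K -> Q (v3 * K) -> at2 1 0 (G1 - c *: K) = 0 -> Q G.
    move=> hK btK psK QK GK0.
    have hGK : G1 - c *: K \is (d - 6).-homog by rewrite rpredB // rpredZ.
    have btGK : fixed_form (SL2_of S_BT) (G1 - c *: K).
      by apply: fixedB => // h hS; rewrite subZ btK.
    have -> : G = v3 * (G1 - c *: K) + c *: (v3 * K).
      by rewrite GE mulrBr scalerAr subrK.
    apply: Q_D => //; last exact: Q_Z.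
    case: (v3_divides hGK btGK GK0) => [->|[G2 [d12 hG2 G2E]]]; first by rewrite mulr0; exact: Q_0.
    rewrite G2E mulrA; apply: Q_M => //; first exact: Q_v3sq.
    apply: (IH _ _ G2 hG2); first by lia.
    apply/fixed_BO; split.
      by apply: (fixed_cancel v3_neq0 v3_fixed); rewrite -G2E.
    apply: (mulfI v3_neq0); apply: oppr_inj; rewrite -G2E -mulNr -v3_psi -rmorphM -G2E.
    by rewrite raddfB /= subZ ps1 psK scalerN opprB opprK addrC.
  have [G10|G10] := eqVneq (at2 1 0 G1) 0.
    apply: (sub_case 0 0).
    - exact: rpred0.
    - by move=> h hS; rewrite raddf0.
    - by rewrite raddf0 oppr0.
    - by rewrite mulr0; exact: Q_0.
    - by rewrite scaler0 subr0.
  have [q dq q1] := bt_degree hG1 bt1 G10.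
  have zd : z ^+ (d - 6) = -1.
    have := at2_psi 1 0 G1; rewrite ps1 rmorphN /= mulr0 => e.
    by apply: (mulIf G10); rewrite -(at2_homog _ _ _ hG1) mulr0 -e mulN1r.
  (* The sign of psi_8 forces the degree 4 q of G1 to be 4 modulo 8, and q <> 1. *)
  have qo : odd q.
    rewrite -[odd q]negbK; apply/negP => qe.
    have : z ^+ (d - 6) = 1.
      rewrite dq -[(6 - 2)%N]/4%N exprM zeta8_pow4 -signr_odd (negPf qe) expr0 //.
    rewrite zd => e; have := two_neq0; rewrite -[2%:R]/(1 + 1) -{1}e addNr eqxx //.
  pose a := (q - 3)./2; have qE : q = (3 + 2 * a)%N.
    have := odd_double_half (q - 3); rewrite -/a; move: qo q1.
    have := odd_double_half q; case: (odd q) => //; lia.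
  have v1a : at2 1 0 (t_BO * v1 ^+ a) = 8%:R.
    by rewrite rmorphM rmorphXn /= t_10 v1_10 expr1n mulr1.
  have [btv1 psv1] := (fixed_BO _).1 v1_fixed.
  apply: (sub_case (at2 1 0 G1 / 8%:R) (t_BO * v1 ^+ a)).
  - have -> : (d - 6 = 12 + 8 * a)%N by rewrite dq qE; lia.
    by apply: dhomogM; [exact: t_homog | apply: dhomogMn v1_homog].
  - by move=> h hS; rewrite rmorphM rmorphXn /= t_fixed // btv1.
  - by rewrite rmorphM rmorphXn /= t_psi psv1 mulNr.
  - by rewrite mulrA; apply: Q_M => //; [exact: Q_v3t | apply: Q_X].
  - by rewrite rmorphB /= at2Z v1a divfK ?subrr // char0_natr_neq0.
have [F0|F0] := eqVneq (at2 1 0 F) 0; first exact: main.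
have d8 : (8 %| d)%N.
  rewrite (prim_order_dvd z8); apply/eqP/(mulIf F0); rewrite mul1r.
  by rewrite -(at2_homog _ _ _ hF) mulr0 -[in RHS]((fixed_BO _).1 fF).2 at2_psi !mulr0.
have QG : Q (at2 1 0 F *: v1 ^+ (d %/ 8)) by apply: Q_Z => //; apply: Q_X.
rewrite -[F](subrK (at2 1 0 F *: v1 ^+ (d %/ 8))); apply: Q_D => //.
apply: main.
- rewrite rpredB // rpredZ //; have := dhomogMn (d %/ 8) v1_homog.
  by rewrite mulnC divnK.
- by apply: fixedB => //; exact: Qfix.
- by rewrite rmorphB /= at2Z rmorphXn /= v1_10 expr1n mulr1 subrr.
Qed.
End OctahedralForms.

Lemma invariants_binary_octahedral : invariants (BO48 i z) = subalgebra_gen (hat v1).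
Proof.
rewrite invariants_BO -(bigcup_set1 (@hat k) v1); apply: invariants_generated_by_forms => //.
  by move=> f ->; split; [exists 8; exact: v1_homog | exact: v1_fixed].
by move=> Q Qtv Qv1 Qfix d F; apply: octahedral_forms => //; apply: Qv1.
Qed.
End Tetrahedral.
End Groups.

(** * The binary icosahedral group *)
Section Psi.
Variable k : fieldType.
Local Notation P := {mpoly k[2]}.
Implicit Types (f F : P).

(** [psi z] multiplies the monomial [x^j y^(d-j)] by [z^(2 j - d)], so an invariant
form only has monomials on which this weight is 1. *)
Lemma dehom_psi z d F : F \is d.-homog -> linsub (psi z) F = F ->
  forall j, (j <= d)%N -> (dehom F)`_j = (dehom F)`_j * (z ^+ j * z^-1 ^+ (d - j)).
Proof.
move=> hF ps j jd.
have FE : F = homog_of d (\poly_(i < d.+1) ((dehom F)`_i * (z ^+ i * z^-1 ^+ (d - i)))).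
  have [FE _] := homog_ofK hF; rewrite -[LHS]ps -{1}FE {1}/homog_of raddf_sum /=.
  apply: eq_bigr => i _; rewrite subZ rmorphM !rmorphXn /= subX subY !mxE /=.
  rewrite !scale0r addr0 add0r !exprZn -scalerAl -scalerAr !scalerA.
  by rewrite coef_poly ltn_ord -mulrA.
by rewrite {1}FE dehom_homog_of ?size_poly // coef_poly ltnS jd.
Qed.

Lemma dvdp_Xn_sub n z c (p : {poly k}) : n.-primitive_root z -> c != 0 ->
  (forall m, root p (c * z ^+ m)) -> 'X^n - (c ^+ n)%:P %| p.
Proof.
move=> zn c0 rp; have n0 := prim_order_gt0 zn.
pose rs := [seq c * z ^+ m | m <- iota 0 n].
have urs : uniq_roots rs.
  rewrite uniq_rootsE map_inj_in_uniq ?iota_uniq // => a b.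
  rewrite !mem_iota !add0n => /= an bn /(mulfI c0) /eqP.
  by rewrite (eq_prim_root_expr zn) !modn_small // => /eqP.
suff <- : \prod_(r <- rs) ('X - r%:P) = 'X^n - (c ^+ n)%:P.
  by apply: uniq_roots_dvdp => //; apply/allP => r /mapP[m _ ->]; apply: rp.
have mon : 'X^n - (c ^+ n)%:P \is monic by exact: monicXnsubC.
apply/eqP; rewrite -eqp_monic ?monic_prod_XsubC //.
rewrite -dvdp_size_eqp; last first.
  apply: uniq_roots_dvdp => //; apply/allP => r /mapP[m _ ->].
  rewrite /root !hornerE exprMn -exprM mulnC exprM (prim_expr_order zn).
  by rewrite expr1n mulr1 subrr.
by rewrite size_prod_XsubC size_map size_iota size_XnsubC.
Qed.
End Psi.

Lemma rmorph_icosa_cofactor (R R' : comNzRingType) (f : {rmorphism R -> R'})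
    (x y : R) :
  f (x ^+ 10 + 11%:R * x ^+ 5 * y ^+ 5 - y ^+ 10) =
  f x ^+ 10 + 11%:R * f x ^+ 5 * f y ^+ 5 - f y ^+ 10.
Proof.
by rewrite !(rmorphXn, rmorph_nat, rmorphM, rmorphB, rmorphD).
Qed.

Section Icosahedral.
Variable k : fieldType.
Hypothesis char0 : [pchar k] =i pred0.
Local Notation P := {mpoly k[2]}.
Local Notation X := ('X_0 : P).
Local Notation Y := ('X_1 : P).
Implicit Types (f F : P).
Variables (z s : k).
Hypothesis z5 : 5.-primitive_root z.
Hypothesis s5 : s ^+ 2 = 5%:R.

(** Its zeros are the vertices of an icosahedron. *)
Definition w1 : P := X * Y * (X ^+ 10 + 11 * X ^+ 5 * Y ^+ 5 - Y ^+ 10).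
Definition S_BI : set 'M[k]_2 := [set psi z; kappa z s; quat_j k].

(** The matrix [kappa] is [1/s * (p, q; q, -p)]. *)
Let p : k := z ^+ 4 - z.
Let q : k := z ^+ 2 - z ^+ 3.

Lemma zeta5_pow4 : z ^+ 4 = -1 - z - z ^+ 2 - z ^+ 3.
Proof.
have z1 : z - 1 != 0 by rewrite subr_eq0 -(expr1 z) -(prim_order_dvd z5).
apply: (mulfI z1); have z5e := prim_expr_order z5; ring: z5e.
Qed.
Lemma kappa_q2 : q ^+ 2 = p ^+ 2 + p * q.
Proof. by rewrite /p /q; ring: zeta5_pow4. Qed.
Lemma kappa_sum_sq : p ^+ 2 + q ^+ 2 = - 5%:R.
Proof. by rewrite /p /q; ring: zeta5_pow4. Qed.
Lemma kappa_prod_sq : p ^+ 2 * q ^+ 2 = 5%:R.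
Proof. by rewrite /p /q; ring: zeta5_pow4. Qed.
Lemma five_neq0 : 5%:R != 0 :> k. Proof. exact: (char0_natr_neq0 char0). Qed.
Lemma p_neq0 : p != 0.
Proof. by apply: contraNneq five_neq0 => p_neq0; rewrite -kappa_prod_sq p_neq0 expr0n mul0r. Qed.
Lemma q_neq0 : q != 0.
Proof. by apply: contraNneq five_neq0 => q_neq0; rewrite -kappa_prod_sq q_neq0 expr0n mulr0. Qed.
Lemma s_neq0 : s != 0.
Proof. by apply: contraNneq five_neq0 => s_neq0; rewrite -s5 s_neq0 expr0n. Qed.
Lemma zeta5_neq0 : z != 0. Proof. exact: prim_neq0 z5. Qed.

Lemma kappaE : kappa z s = mx2 (s^-1 * p) (s^-1 * q) (s^-1 * q) (s^-1 * - p).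
Proof. by rewrite [LHS]mx2E !mxE /= /p opprB. Qed.

Section FixedBI.
Variables (d : nat) (F : P).
Hypothesis hF : F \is d.-homog.
Hypothesis fF : fixed_form (SL2_of S_BI) F.

Lemma bi_psi a b : at2 (z * a) (z^-1 * b) F = at2 a b F.
Proof.
have T : S_BI (psi z) by left; left.
by have := fixed_at fF T (det_psi zeta5_neq0) a b; rewrite !mxE /= !mul0r addr0 add0r.
Qed.
Lemma bi_psin n a b : at2 (z ^+ n * a) (z^-1 ^+ n * b) F = at2 a b F.
Proof.
elim: n a b => [|n IH] a b; first by rewrite !expr0 !mul1r.
by rewrite !exprSr -!mulrA IH bi_psi.
Qed.
Lemma bi_j a b : at2 (- b) a F = at2 a b F.
Proof.
have dj : \det (quat_j k) = 1 by rewrite det_mx2 mul0r sub0r mul1r opprK.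
have T : S_BI (quat_j k) by right.
by have := fixed_at fF T dj a b; rewrite !mxE /= !mul0r addr0 add0r mulN1r mul1r.
Qed.
Lemma bi_k a b : at2 (p * a + q * b) (q * a - p * b) F = s ^+ d * at2 a b F.
Proof.
have T : S_BI (kappa z s) by left; right.
have := fixed_at fF T (det_kappa z5 s5 five_neq0) a b; rewrite kappaE !mxE /= => <-.
rewrite -(at2_homog _ _ _ hF); congr (at2 _ _ _).
  by rewrite mulrDr !mulrA mulfV ?s_neq0 // !mul1r.
by rewrite mulrDr !mulrA mulfV ?s_neq0 // !mul1r mulNr.
Qed.

(** The orbit of [(1, 0)] consists of the points 0 and infinity and of two orbits of
five points under [psi_5], the first of which comes from the column [(p, q)] of
[kappa] and the second from the first by the quaternion [j]. *)
Lemma bi_roots : at2 1 0 F = 0 -> [/\ root (dehom F) 0,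
  forall m, root (dehom F) (p / q * z ^+ m) & forall m, root (dehom F) (- q / p * z ^+ m)].
Proof.
move=> F0; have F01 : at2 0 1 F = 0 by rewrite -{1}oppr0 bi_j.
have Fpq : at2 p q F = 0.
  by have := bi_k 1 0; rewrite F0 !mulr0 !mulr1 addr0 subr0.
have Fqp : at2 (- q) p F = 0 by rewrite bi_j.
(* The ratio of psi_5^l is zeta^(2 l), and l = 3 m gives zeta^(6 m) = zeta^m. *)
have zm m : z ^+ m = z ^+ (3 * m) / z^-1 ^+ (3 * m).
  rewrite exprVn invrK -exprD; apply/eqP; rewrite (eq_prim_root_expr z5).
  by apply/eqP; lia.
have zi m : z^-1 ^+ m != 0 by rewrite expf_neq0 // invr_neq0 // zeta5_neq0.
split=> [|m|m].
- by apply/rootP; rewrite -(at2_1 _ hF).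
- have -> : p / q * z ^+ m = (z ^+ (3 * m) * p) / (z^-1 ^+ (3 * m) * q).
    by rewrite [in LHS]zm mulf_div [p * _]mulrC [q * _]mulrC.
  by apply: (root_dehom hF); rewrite ?mulf_neq0 ?q_neq0 // bi_psin.
have -> : - q / p * z ^+ m = (z ^+ (3 * m) * - q) / (z^-1 ^+ (3 * m) * p).
  by rewrite [in LHS]zm mulf_div [- q * _]mulrC [p * _]mulrC.
by apply: (root_dehom hF); rewrite ?mulf_neq0 ?p_neq0 // bi_psin.
Qed.
End FixedBI.

Lemma rmorph_w1 (R : comNzRingType) (f : {rmorphism P -> R}) : f w1 =
  f X * f Y * (f X ^+ 10 + 11%:R * f X ^+ 5 * f Y ^+ 5 - f Y ^+ 10).
Proof. by rewrite -rmorph_icosa_cofactor -!rmorphM. Qed.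

Lemma w1_homog : w1 \is 12.-homog.
Proof.
rewrite /w1 -[11]/(11%:R) -[11%:R * _ * _]mulrA mulr_natl.
apply: (@dhomogM _ _ _ 2 _ 10); first by have := dhomogXY k 1 1; rewrite !expr1.
apply: rpredB; last by have := dhomogXY k 0 10; rewrite expr0 mul1r.
apply: rpredD; first by have := dhomogXY k 10 0; rewrite expr0 mulr1.
by apply: rpredMn; exact: (dhomogXY k 5 5).
Qed.
Lemma pq_sum : (p / q) ^+ 5 + (- q / p) ^+ 5 = - 11%:R.
Proof.
have e : p ^+ 10 - q ^+ 10 = - 11%:R * (p ^+ 5 * q ^+ 5) by ring: kappa_q2.
have pq0 : p ^+ 5 * q ^+ 5 != 0 by rewrite mulf_neq0 // expf_neq0 ?p_neq0 ?q_neq0.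
apply: (mulIf pq0); rewrite -e !exprMn !exprVn mulrDl.
rewrite -[_ / q ^+ 5 * _]mulrA [(q ^+ 5)^-1 * _]mulrCA mulVf ?expf_neq0 ?q_neq0 // mulr1.
rewrite -[_ / p ^+ 5 * _]mulrA mulKf ?expf_neq0 ?p_neq0 //; ring.
Qed.
Lemma pq_prod : (p / q) ^+ 5 * (- q / p) ^+ 5 = -1.
Proof.
rewrite -exprMn (_ : p / q * (- q / p) = -1); first by rewrite -signr_odd expr1.
by rewrite mulNr mulrN mulf_div [q * p]mulrC divff ?mulf_neq0 ?p_neq0 ?q_neq0.
Qed.

(** The fifth powers of [p / q] and [- q / p] are the two roots of [T^2 + 11 T - 1],
which is where the coefficient 11 comes from. *)
Lemma dehom_w1 : dehom w1 =
  'X * (('X^5 - ((p / q) ^+ 5)%:P) * ('X^5 - ((- q / p) ^+ 5)%:P)).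
Proof.
rewrite rmorph_w1 /= dehomX dehomY.
have /(congr1 polyC) := pq_sum; have /(congr1 polyC) := pq_prod.
rewrite polyCM polyCD !polyCN polyC1 (rmorph_nat (@polyC k)).
move: (_%:P) (_%:P) 'X => a b x ab a_b.
transitivity (x * (x ^+ 10 - (b + a) * x ^+ 5 + b * a)); last by ring.
by rewrite ab a_b; ring.
Qed.
Lemma size_dehom_w1 : size (dehom w1) = 12.
Proof.
have n0 c : 'X^5 - c%:P != 0 :> {poly k} by exact: monic_neq0 (monicXnsubC _ _).
by rewrite dehom_w1 mulrC size_mulX ?mulf_neq0 // size_mul // !size_XnsubC.
Qed.
Lemma w1_10 : at2 1 0 w1 = 0.
Proof. by rewrite rmorph_w1 /= at2X at2Y mulr0 mul0r. Qed.
Lemma w1_d1 : at2 1 0 w1^`M(1) = 1.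
Proof.
rewrite /w1 [X * Y]mulrC -[Y * X * _]mulrA at2_dY rmorphM rmorph_icosa_cofactor.
by rewrite /= at2X at2Y !expr1n !expr0n mulr0 addr0 subr0 mulr1.
Qed.

(** Over an arbitrary ring, so that the identity is a polynomial one in which
[b ^+ 2 = a ^+ 2 + a * b] is the only relation. *)
Lemma kappa_w1 (R : comPzRingType) (a b x y : R) : b ^+ 2 = a ^+ 2 + a * b ->
  (a * x + b * y) * (b * x - a * y) * ((a * x + b * y) ^+ 10 +
     11%:R * (a * x + b * y) ^+ 5 * (b * x - a * y) ^+ 5 - (b * x - a * y) ^+ 10) =
  (a ^+ 2 + b ^+ 2) ^+ 6 *
  (x * y * (x ^+ 10 + 11%:R * x ^+ 5 * y ^+ 5 - y ^+ 10)).
Proof. by move=> ab; ring: ab. Qed.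

Lemma w1_fixed : fixed_form (SL2_of S_BI) w1.
Proof.
apply: fixed_SL2_of => M TM; rewrite rmorph_w1 /w1 -[11]/(11%:R) /= subX subY -!mul_mpolyC.
case: TM => [[|]|] ->; rewrite ?kappaE !mxE /= ?rmorph0 ?rmorph1 ?rmorphN1.
- have ZW : (z%:MP : P) * z^-1%:MP = 1 by rewrite -mpolyCM divff ?zeta5_neq0.
  have Z5 : (z%:MP : P) ^+ 5 = 1 by rewrite -rmorphXn (prim_expr_order z5) rmorph1.
  have W5 : (z^-1%:MP : P) ^+ 5 = 1.
    by rewrite -rmorphXn exprVn (prim_expr_order z5) invr1 rmorph1.
  move: (z%:MP) (z^-1%:MP) ZW Z5 W5 X Y => Z W ZW Z5 W5 x y.
  transitivity (Z * W * (x * y * ((Z ^+ 5) ^+ 2 * x ^+ 10 +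
     11%:R * Z ^+ 5 * W ^+ 5 * x ^+ 5 * y ^+ 5 - (W ^+ 5) ^+ 2 * y ^+ 10))); first by ring.
  by rewrite ZW Z5 W5; ring.
- have SPQ : (s^-1%:MP : P) ^+ 12 * ((p%:MP) ^+ 2 + (q%:MP) ^+ 2) ^+ 6 = 1.
    rewrite -!rmorphXn -rmorphD -rmorphXn -rmorphM /= kappa_sum_sq -mpolyC1; congr _%:MP.
    by rewrite exprVn (exprM s 2 6) s5 exprNn -signr_odd expr0 mul1r mulVf // expf_neq0 // five_neq0.
  have Q2 : (q%:MP : P) ^+ 2 = p%:MP ^+ 2 + p%:MP * q%:MP.
    by rewrite -!rmorphXn -rmorphM -rmorphD /= kappa_q2.
  rewrite !mpolyCM mpolyCN.
  move: (s^-1%:MP) (p%:MP) (q%:MP) SPQ Q2 X Y => S a b Sab Q2 x y.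
  have e := kappa_w1 x y Q2.
  rewrite -[RHS]mul1r -[X in _ = X * _]Sab -[X in _ = X]mulrA -e; ring.
by move: X Y => x y; ring.
Qed.

Lemma w1_divides d F : F \is d.-homog -> fixed_form (SL2_of S_BI) F -> at2 1 0 F = 0 ->
  F = 0 \/ exists F', [/\ (12 <= d)%N, F' \is (d - 12).-homog & F = w1 * F'].
Proof.
move=> hF fF F0; apply: (form_div w1_homog size_dehom_w1) => //.
have [r0 r1 r2] := bi_roots hF fF F0.
have c0 : p / q != 0 by rewrite mulf_neq0 ?invr_neq0 ?p_neq0 ?q_neq0.
have c'0 : - q / p != 0 by rewrite mulf_neq0 ?invr_neq0 ?oppr_eq0 ?p_neq0 ?q_neq0.
have d0 : 'X %| dehom F by rewrite -['X]subr0 -polyC0 dvdp_XsubCl.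
have d1 := dvdp_Xn_sub z5 c0 r1; have d2 := dvdp_Xn_sub z5 c'0 r2.
have cX c : c != 0 -> coprimep 'X ('X^5 - (c ^+ 5)%:P).
  move=> cn0; rewrite coprimep_sym coprimepX.
  by rewrite rootE !hornerE expr0n sub0r oppr_eq0 expf_neq0.
rewrite dehom_w1 Gauss_dvdp ?d0 ?Gauss_dvdp ?d1 ?d2 //; last first.
  by rewrite coprimepMr !cX.
set a := (p / q) ^+ 5; set b := (- q / p) ^+ 5.
have ab : b - a != 0.
  apply: contraNneq (char0_natr_neq0 char0 (isT : 0 < 125)%N) => ba.
  have e := pq_sum; have f := pq_prod; rewrite -/a -/b in e f.
  have eb : b = a by apply/eqP; rewrite -subr_eq0 ba.
  have -> : 125%:R = (a + b) ^+ 2 - 4%:R * (a * b) by rewrite e f; ring.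
  by rewrite eb; apply/eqP; ring.
have := coprimep_comp_poly 'X^5 (coprimep_XsubC2 ab).
by rewrite !comp_polyB !comp_polyX !comp_polyC.
Qed.

(** [psi_5] and the central element [-1] force 10 to divide [d]. In degree 10 only
the coefficients of [y^10, x^5 y^5, x^10] survive; comparing the values at the
points [(p, q)] and [(- q, p)], which both come from [(1, 0)], gives
[2 * 5^5 F(1, 0) = 2 (p^10 + q^10) F(1, 0)], where [p^10 + q^10 = - 625]. *)
Lemma bi_degree d F : F \is d.-homog -> fixed_form (SL2_of S_BI) F -> at2 1 0 F != 0 ->
  exists2 q, d = ((12 - 2) * q)%N & q != 1%N.
Proof.
move=> hF fF F0.
have d5 : (5 %| d)%N.
  rewrite (prim_order_dvd z5); apply/eqP/(mulIf F0); rewrite mul1r.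
  by rewrite -(at2_homog _ _ _ hF) mulr0 -[in RHS](bi_psi fF) mulr0.
have d2 : (2 %| d)%N.
  rewrite dvdn2; apply/negP => od.
  have em : at2 (-1) 0 F = at2 1 0 F by rewrite (bi_j fF 0 1) -{1}oppr0 (bi_j fF 1 0).
  have := at2_homog (-1) 1 0 hF; rewrite mulr1 mulr0 em -signr_odd od expr1 mulN1r.
  move=> /eqP; rewrite -addr_eq0 -mulr2n -mulr_natr mulf_eq0 (negPf F0) /=.
  by rewrite (negPf (char0_natr_neq0 char0 _)).
have d10 : (10 %| d)%N by rewrite -[10%N]/(5 * 2)%N Gauss_dvd ?d5.
exists (d %/ 10)%N; first by rewrite mulnC divnK.
apply: contraNneq F0 => q1; have dE : d = 10%N by rewrite -(divnK d10) q1.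
move: hF fF; rewrite {d5 d2 d10 q1}dE => hF fF {d}.
have pF : linsub (psi z) F = F.
  have /eqP dM := det_psi zeta5_neq0.
  by apply: (fF (SL2Sub dM)); left; left.
pose c j := (dehom F)`_j.
have c0 j : (j <= 10)%N -> ~~ (5 %| j)%N -> c j = 0.
  move=> j10 j5; apply/eqP; have /eqP := dehom_psi hF pF j10.
  rewrite -/(c j) -subr_eq0 -{1}[c j]mulr1 -mulrBr mulf_eq0 => /orP[//|].
  rewrite subr_eq0 exprVn eq_sym => /eqP e; case/negP: j5.
  have e2 : z ^+ j = z ^+ (10 - j).
    have zn : z ^+ (10 - j) != 0 by rewrite expf_neq0 // zeta5_neq0.
    by rewrite -[LHS](divfK zn) e mul1r.
  move/eqP: e2; rewrite (eq_prim_root_expr z5) => /eqP; lia.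
have FE a b : at2 a b F = c 0%N * b ^+ 10 + c 5%N * (a ^+ 5 * b ^+ 5) + c 10%N * a ^+ 10.
  rewrite (at2_dehom _ _ hF) !big_ord_recr big_ord0 /= -!/(c _).
  rewrite (c0 1%N) // (c0 2%N) // (c0 3%N) // (c0 4%N) // (c0 6%N) // (c0 7%N) //.
  rewrite (c0 8%N) // (c0 9%N) //; ring.
have s10 : s ^+ 10 = 5%:R ^+ 5 by rewrite (exprM s 2 5) s5.
have e1 : at2 p q F = 5%:R ^+ 5 * at2 1 0 F.
  by rewrite -s10 -(bi_k hF fF 1 0) !mulr1 !mulr0 addr0 subr0.
have e2 : at2 (- q) p F = 5%:R ^+ 5 * at2 1 0 F by rewrite (bi_j fF) e1.
have e3 : at2 0 1 F = at2 1 0 F by rewrite -{1}oppr0 (bi_j fF).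
have pq10 : p ^+ 10 + q ^+ 10 = - 625%:R.
  transitivity ((p ^+ 2 + q ^+ 2) ^+ 5 - 5%:R * (p ^+ 2 * q ^+ 2) * (p ^+ 2 + q ^+ 2) ^+ 3
    + 5%:R * (p ^+ 2 * q ^+ 2) ^+ 2 * (p ^+ 2 + q ^+ 2)).
    by move: p q => u v; ring.
  by rewrite kappa_sum_sq kappa_prod_sq; ring.
have : 2%:R * (5%:R ^+ 5 * at2 1 0 F) = at2 p q F + at2 (- q) p F.
  by rewrite e1 e2; ring.
have -> : at2 p q F + at2 (- q) p F = (at2 1 0 F + at2 0 1 F) * (p ^+ 10 + q ^+ 10).
  by rewrite !FE; move: p q (c 0%N) (c 5%N) (c 10%N) => *; ring.
rewrite e3 pq10 => e; have : 7500%:R * at2 1 0 F = 0.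
  transitivity (2%:R * (5%:R ^+ 5 * at2 1 0 F) - (at2 1 0 F + at2 1 0 F) * - 625%:R).
    by move: (at2 1 0 F) => t; ring.
  by rewrite e subrr.
by move/eqP; rewrite mulf_eq0 (negPf (char0_natr_neq0 char0 _)) //= => /eqP.
Qed.

Lemma invariants_BI : invariants (BI120 z s) = invariants (SL2_of S_BI).
Proof. exact: invariants_gen. Qed.

Lemma invariants_binary_icosahedral : invariants (BI120 z s) = subalgebra_gen (hat w1).
Proof.
rewrite invariants_BI -(bigcup_set1 (@hat k) w1); apply: invariants_generated_by_forms => //.
  by move=> f ->; split; [exists 12; exact: w1_homog | exact: w1_fixed].
move=> Q Qtv Qw1 Qfix d F.
apply: (klein_induction char0 Qtv Qfix (isT : 3 < 12)%N w1_homog) => //.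
- exact: Qw1.
- exact: w1_10.
- by rewrite w1_d1 oner_neq0.
- exact: w1_divides.
- exact: bi_degree.
Qed.
End Icosahedral.

(** * The closed formula for transvectants *)
Section TransvectantFormula.
Variable k : fieldType.
Local Notation P := {mpoly k[2]}.
Local Notation X := ('X_0 : P).
Local Notation Y := ('X_1 : P).
Implicit Types (f g F : P).

Definition dxy a b f : P := iter a (mderiv 0) (iter b (mderiv 1) f).

Arguments dxy : simpl never.

Lemma dxySx a b f : dxy a.+1 b f = dxy a b f^`M(0).
Proof.
rewrite /dxy iterSr; congr iter.
by elim: b => //= b <-; rewrite mderiv_comm.
Qed.
Lemma dxySy a b f : dxy a b.+1 f = dxy a b f^`M(1).
Proof. by rewrite /dxy iterSr. Qed.
Lemma dxyD a b f g : dxy a b (f + g) = dxy a b f + dxy a b g.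
Proof.
have iD n i (u v : P) : iter n (mderiv i) (u + v) = iter n (mderiv i) u + iter n (mderiv i) v.
  by elim: n => //= n ->; rewrite mderivD.
by rewrite /dxy !iD.
Qed.

Lemma dxyXY a b i j : dxy a b (X ^+ i * Y ^+ j) =
  (i ^_ a * j ^_ b)%:R *: (X ^+ (i - a) * Y ^+ (j - b)).
Proof.
have dX n : (X ^+ n)^`M(0) = n%:R * X ^+ n.-1.
  by case: n => [|n]; [rewrite expr0 (mderiv_natr _ 1) mul0r | rewrite mderivX0].
have dY n : (Y ^+ n)^`M(1) = n%:R * Y ^+ n.-1.
  by case: n => [|n]; [rewrite expr0 (mderiv_natr _ 1) mul0r | rewrite mderivY1].
have itY n : iter n (mderiv 1) (X ^+ i * Y ^+ j) = (j ^_ n)%:R * (X ^+ i * Y ^+ (j - n)).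
  elim: n => [|n IH]; first by rewrite ffactn0 subn0 mul1r.
  rewrite iterS IH mderiv_nM mderivM mderivX1 mul0r add0r dY.
  by rewrite subnS ffactnSr natrM; ring.
rewrite /dxy itY; elim: a => [|a IH].
  by rewrite ffactn0 mul1n subn0 -mul_mpolyC rmorph_nat.
rewrite iterS IH mderivZ mderivM mderivY0 mulr0 addr0 dX -!mul_mpolyC !rmorph_nat.
by rewrite subnS ffactnSr !natrM; ring.
Qed.

(** Pascal's rule turns the recursive definition into an alternating sum. *)
Lemma tv_sum p f g : tv p f g =
  \sum_(j < p.+1) ((-1) ^+ j * 'C(p, j)%:R) * (dxy (p - j) j f * dxy j (p - j) g).
Proof.
elim: p f g => [|p IH] f g.
  by rewrite big_ord_recl big_ord0 addr0 expr0 bin0 !mul1r.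
rewrite /= !IH; pose T j := dxy (p.+1 - j) j f * dxy j (p.+1 - j) g.
pose s j : P := (-1) ^+ j * 'C(p, j)%:R.
transitivity (\sum_(j < p.+1) s j * T j - \sum_(j < p.+1) s j * T j.+1).
  congr (_ - _); apply: eq_bigr => j _; rewrite -/(s j); congr (_ * _).
    by rewrite /T -dxySx -dxySy subSn // -ltnS.
  by rewrite /T -dxySx -dxySy subSS.
rewrite [RHS]big_ord_recl [X in X - _]big_ord_recl /= -addrA; congr (_ + _).
  by rewrite /s !expr0 !bin0.
rewrite [in X in _ - X]big_ord_recr [RHS]big_ord_recr /= opprD addrA -sumrB.
congr (_ + _).
  apply: eq_bigr => j _; rewrite -/(T j.+1) -mulrBl; congr (_ * _).
  by rewrite /s /bump /= add1n binS natrD exprS mulN1r !mulNr mulrDr opprD.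
by rewrite /s /bump /= add1n !binn exprS !mulr1 mulN1r mulNr.
Qed.
End TransvectantFormula.
Arguments dxy : simpl never.

(** * Cyclic groups *)
Section Cyclic.
Variable k : fieldType.
Hypothesis char0 : [pchar k] =i pred0.
Local Notation P := {mpoly k[2]}.
Local Notation X := ('X_0 : P).
Local Notation Y := ('X_1 : P).
Implicit Types (f g F : P).

Lemma dhomogX0 n : X ^+ n \is n.-homog.
Proof. by have := dhomogXY k n 0; rewrite expr0 mulr1 addn0. Qed.
Lemma dhomogX1 n : Y ^+ n \is n.-homog.
Proof. by have := dhomogXY k 0 n; rewrite expr0 mul1r. Qed.

Lemma fixed_psi_expand n z d F : n.-primitive_root z -> F \is d.-homog ->
  linsub (psi z) F = F ->
  F = \sum_(j < d.+1 | (j == d - j %[mod n])%N) (dehom F)`_j *: (X ^+ j * Y ^+ (d - j)).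
Proof.
move=> zn hF ps; have [FE _] := homog_ofK hF; rewrite -[LHS]FE [RHS]big_mkcond.
apply: eq_bigr => j _; case: eqP => // nj.
have jd : (j <= d)%N by rewrite -ltnS.
suff -> : (dehom F)`_j = 0 by rewrite scale0r.
apply/eqP; have /eqP := dehom_psi hF ps jd.
rewrite -subr_eq0 -{1}[_`_j]mulr1 -mulrBr mulf_eq0 => /orP[//|].
rewrite subr_eq0 exprVn eq_sym => /eqP e; case: nj.
have zd : z ^+ (d - j) != 0 by rewrite expf_neq0 // (prim_neq0 zn).
apply/eqP; rewrite -(eq_prim_root_expr zn); apply/eqP.
by rewrite -[LHS](divfK zd) e mul1r.
Qed.

(** In low degree the weight [z^(2 j - 2 m)] is 1 only for [j = m], so the coefficient
is read off at [(1, 1)]. *)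
Lemma fixed_psi_mid n z m F : n.-primitive_root z -> F \is (2 * m).-homog ->
  (2 * m < n)%N -> linsub (psi z) F = F -> F = at2 1 1 F *: (X ^+ m * Y ^+ m).
Proof.
move=> zn hF mn /(fixed_psi_expand zn hF) FE.
have {}FE : F = (dehom F)`_m *: (X ^+ m * Y ^+ m).
  have md : (m < (2 * m).+1)%N by rewrite ltnS leq_pmull.
  rewrite {1}FE (bigD1 (Ordinal md)) /=; last by rewrite mul2n -addnn addnK.
  rewrite big1 ?addr0 => [|j /andP[/eqP e]]; first by rewrite mul2n -addnn addnK.
  rewrite -val_eqE /= => jm; have jd := ltn_ord j; rewrite ltnS in jd.
  move: e; rewrite !modn_small; [lia|lia|lia].
by rewrite {2}FE at2Z rmorphM !rmorphXn /= at2X at2Y !expr1n !mulr1.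
Qed.

Section QLemmas.
Variable Q : P -> Prop.
Hypothesis Qtv : tv_closed Q.

(** The weight condition says that each monomial of an invariant form is a power of
[x y] times a power of [x^n] or of [y^n]. *)
Lemma cyclic_forms n z d F : n.-primitive_root z -> Q (X * Y) -> Q (X ^+ n) -> Q (Y ^+ n) ->
  F \is d.-homog -> linsub (psi z) F = F -> Q F.
Proof.
move=> zn Qxy Qx Qy hF ps; rewrite (fixed_psi_expand zn hF ps).
apply: Q_sum => // j /eqP e; apply: Q_Z => //.
have jd : (j <= d)%N by rewrite -ltnS.
case: (leqP j (d - j)) => jj.
  have /dvdnP[q qE] : (n %| d - j - j)%N by rewrite -eqn_mod_dvd // e.
  rewrite -(subnK jj) qE exprD mulrCA -exprMn mulnC exprM.
  by apply: Q_M => //; apply: (Q_X Qtv).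
have {}jj := ltnW jj.
have /dvdnP[q qE] : (n %| j - (d - j))%N by rewrite -eqn_mod_dvd // e.
rewrite -{1}(subnK jj) qE exprD -mulrA -exprMn mulnC exprM.
by apply: Q_M => //; apply: (Q_X Qtv).
Qed.

(** The Jacobian of [x^n + y^n] and [x y] is [n (x^n - y^n)]. *)
Lemma split_powers n : Q (X ^+ n.+1 + Y ^+ n.+1) -> Q (X * Y) ->
  Q (X ^+ n.+1) /\ Q (Y ^+ n.+1).
Proof.
move=> Qr Qxy.
have hr : X ^+ n.+1 + Y ^+ n.+1 \is n.+1.-homog by rewrite rpredD ?dhomogX0 ?dhomogX1.
have hxy : X * Y \is 2.-homog by exact: (dhomogXY k 1 1).
have := Q_tv Qtv 1 hr hxy Qr Qxy; rewrite /= !mderivD mderivX0 mderivY0 mderivX1 mderivY1.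
rewrite !mderivM !mderivXU /= addr0 add0r !(mulr0, mul0r, mulr1, mul1r, addr0, add0r).
have -> : n.+1%:R * X ^+ n * X - n.+1%:R * Y ^+ n * Y = n.+1%:R * (X ^+ n.+1 - Y ^+ n.+1).
  by rewrite -!mulrA -mulrBr -!exprSr.
move/(Q_unscale char0 Qtv (ltn0Sn n)) => Qd.
split; apply: (Q_unscale char0 Qtv (isT : 0 < 2)%N).
  have -> : 2%:R * X ^+ n.+1 = X ^+ n.+1 + Y ^+ n.+1 + (X ^+ n.+1 - Y ^+ n.+1).
    by rewrite [RHS]addrACA subrr addr0 mulr_natl mulr2n.
  exact: Q_D.
have -> : 2%:R * Y ^+ n.+1 = X ^+ n.+1 + Y ^+ n.+1 + (-1) *: (X ^+ n.+1 - Y ^+ n.+1).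
  by rewrite scaleN1r opprB [RHS]addrC [RHS]addrA subrK mulr_natl mulr2n.
by apply: Q_D => //; apply: Q_Z.
Qed.

(** Mixed derivatives of [x^n + y^n] vanish, so only the two extreme terms of the
alternating sum remain; for even [p] they are equal and do not cancel. *)
Lemma tv_XnYn n p : (0 < p <= n)%N -> ~~ odd p ->
  tv p (X ^+ n + Y ^+ n) (X ^+ n + Y ^+ n) =
  (2 * (n ^_ p * n ^_ p))%:R *: (X ^+ (n - p) * Y ^+ (n - p)).
Proof.
case: p => [|p] // pn ep; rewrite tv_sum.
have E a b : dxy a b (X ^+ n + Y ^+ n) =
    (n ^_ a * 0 ^_ b)%:R *: (X ^+ (n - a)) + (0 ^_ a * n ^_ b)%:R *: (Y ^+ (n - b)).
  rewrite dxyD -[X ^+ n]mulr1 -[Y ^+ n]mul1r -{1}(expr0 Y) -(expr0 X) !dxyXY.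
  by rewrite !sub0n !expr0 mulr1 mul1r.
rewrite big_ord_recl big_ord_recr /= big1 ?add0r => [|j _]; last first.
  have j0 : (p - j == 0)%N = false by rewrite subn_eq0 leqNgt ltn_ord.
  rewrite /bump /= add1n subSS !E !ffact0n j0 /=.
  by rewrite muln0 mul0n !scale0r addr0 mul0r mulr0.
rewrite /bump /= add1n subn0 subnn !E !ffactn0 !ffact0n /= bin0 binn.
rewrite -[(-1) ^+ p.+1]signr_odd (negPf ep) !expr0 !mul1r !mul0n !muln0 !muln1 !mul1n !scale0r addr0 add0r.
rewrite -!scalerAl -!scalerAr !scalerA -natrM [Y ^+ _ * _]mulrC -scalerDl.
by rewrite -natrD addnn -mul2n.
Qed.

Lemma Q_mid n p : (0 < p <= n)%N -> ~~ odd p -> Q (X ^+ n + Y ^+ n) ->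
  Q (X ^+ (n - p) * Y ^+ (n - p)).
Proof.
move=> pn ep Qr; have /andP[_ pn'] := pn.
have hr : X ^+ n + Y ^+ n \is n.-homog by rewrite rpredD ?dhomogX0 ?dhomogX1.
have := Q_tv Qtv p hr hr Qr Qr; rewrite tv_XnYn // -mul_mpolyC rmorph_nat.
by apply: Q_unscale => //; rewrite !muln_gt0 ffact_gt0 pn'.
Qed.
End QLemmas.

Lemma fixed_Zn z f : z != 0 -> fixed_form (SL2_of [set psi z]) f <-> linsub (psi z) f = f.
Proof.
move=> z0; split=> [ff|fp]; last by apply: fixed_SL2_of => M ->.
by have /eqP dM := det_psi z0; apply: (ff (SL2Sub dM)).
Qed.

Lemma sub_psi z i j : z != 0 -> z ^+ i = z ^+ j -> linsub (psi z) (X ^+ i * Y ^+ j) = X ^+ i * Y ^+ j.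
Proof.
move=> z0 zij; rewrite rmorphM !rmorphXn /= subX subY !mxE /= !scale0r addr0 add0r.
by rewrite !exprZn zij -scalerAl -scalerAr scalerA -exprMn mulfV // expr1n scale1r.
Qed.

Section Cyclic_n.
Variables (n : nat) (z : k).
Hypothesis zn : n.-primitive_root z.
Let z0 : z != 0. Proof. exact: prim_neq0 zn. Qed.
Let zn1 : z ^+ n = 1. Proof. exact: prim_expr_order zn. Qed.

Lemma xnyn_fixed : fixed_form (SL2_of [set psi z]) (X ^+ n + Y ^+ n).
Proof.
apply/fixed_Zn => //; rewrite rmorphD /=.
have := @sub_psi z n 0 z0; have := @sub_psi z 0 n z0; rewrite !expr0 mul1r mulr1.
by rewrite zn1 => -> // ->.
Qed.
Lemma xy_fixed : fixed_form (SL2_of [set psi z]) (X * Y).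
Proof. by apply/fixed_Zn => //; have := @sub_psi z 1 1 z0 erefl; rewrite !expr1. Qed.

Lemma invariants_cyclic : (2 <= n)%N -> invariants (Zgroup z) =
  subalgebra_gen (hat (X ^+ n + Y ^+ n) `|` hat (X * Y)).
Proof.
move=> n2; rewrite /Zgroup invariants_gen.
rewrite -(bigcup_set1 (@hat k) (X ^+ n + Y ^+ n)) -(bigcup_set1 (@hat k) (X * Y)) -bigcup_setU.
apply: invariants_generated_by_forms => //.
  move=> f [|] ->; split.
  - by exists n; rewrite rpredD ?dhomogX0 ?dhomogX1.
  - exact: xnyn_fixed.
  - by exists 2; exact: (dhomogXY k 1 1).
  - exact: xy_fixed.
move=> Q Qtv QG Qfix d F hF /(fixed_Zn _ z0) ps.
have Qr : Q (X ^+ n + Y ^+ n) by apply: QG; left.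
have Qxy : Q (X * Y) by apply: QG; right.
case: (n) zn n2 Qr => // n' zn' _ /(split_powers Qtv)/(_ Qxy)[Qx Qy].
exact: (cyclic_forms Qtv zn' Qxy Qx Qy hF ps).
Qed.

Lemma invariants_cyclic_odd : odd n -> (3 <= n)%N -> invariants (Zgroup z) =
  subalgebra_gen (hat (X ^+ n + Y ^+ n)).
Proof.
move=> on n3; rewrite /Zgroup invariants_gen.
rewrite -(bigcup_set1 (@hat k) (X ^+ n + Y ^+ n)).
apply: invariants_generated_by_forms => //.
  move=> f ->; split; last exact: xnyn_fixed.
  by exists n; rewrite rpredD ?dhomogX0 ?dhomogX1.
move=> Q Qtv QG Qfix d F hF /(fixed_Zn _ z0) ps.
have Qr : Q (X ^+ n + Y ^+ n) by apply: QG.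
(* n - 1 is even, and the transvectant of this order has degree 2. *)
have Qxy : Q (X * Y).
  have := @Q_mid Q Qtv n n.-1; rewrite (_ : n - n.-1 = 1)%N; last by lia.
  by rewrite !expr1; apply => //; move: on; lia.
case: (n) zn n3 Qr => // n' zn' _ /(split_powers Qtv)/(_ Qxy)[Qx Qy].
exact: (cyclic_forms Qtv zn' Qxy Qx Qy hF ps).
Qed.
End Cyclic_n.

(** * Binary dihedral groups *)
Section BD.
Variables (n : nat) (z : k).
Hypothesis n2 : (2 <= n)%N.
Let N := (2 * n)%N.
Hypothesis zn : N.-primitive_root z.
Let z0 : z != 0. Proof. exact: prim_neq0 zn. Qed.
Definition S_BD : set 'M[k]_2 := [set psi z; quat_j k].

Lemma fixed_BD f : fixed_form (SL2_of S_BD) f <->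
  linsub (psi z) f = f /\ linsub (quat_j k) f = f.
Proof.
have dj : \det (quat_j k) = 1 by rewrite det_mx2 mul0r sub0r mul1r opprK.
split=> [ff|[fp fj]]; last by apply: fixed_SL2_of => M [|] ->.
have /eqP dM := det_psi z0; move/eqP: dj => dM'.
by split; [apply: (ff (SL2Sub dM)); left | apply: (ff (SL2Sub dM')); right].
Qed.

Lemma sub_j i j : linsub (quat_j k) (X ^+ i * Y ^+ j) = (-1) ^+ i *: (X ^+ j * Y ^+ i).
Proof.
rewrite rmorphM !rmorphXn /= subX subY !mxE /= !scale0r scaleN1r scale1r addr0 add0r.
by rewrite [in LHS]exprNn -mulrA [Y ^+ i * _]mulrC -mul_mpolyC rmorphXn rmorphN1.
Qed.

Section QBD.
Variable Q : P -> Prop.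
Hypothesis Qtv : tv_closed Q.
Hypothesis Qr : Q (X ^+ N + Y ^+ N).

(** The transvectant of order [N - 2] of the generator with itself has degree 4. *)
Lemma Q_x2y2 : Q (X ^+ 2 * Y ^+ 2).
Proof.
have := @Q_mid Q Qtv N (N - 2); rewrite (_ : N - (N - 2) = 2)%N; last by rewrite /N; lia.
by apply; rewrite // /N; [lia | rewrite oddB ?odd_mul //; lia].
Qed.
(** Up to a factor, the Jacobian of [x^N + y^N] and [x^2 y^2]. *)
Lemma Q_xyd : Q (X * Y * (X ^+ N - Y ^+ N)).
Proof.
have hr : X ^+ N + Y ^+ N \is N.-homog by rewrite rpredD ?dhomogX0 ?dhomogX1.
have := Q_tv Qtv 1 hr (dhomogXY k 2 2) Qr Q_x2y2.
have [m NE] : exists m, N = m.+1 by exists N.-1; rewrite prednK // /N; lia.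
rewrite NE /= !mderivD !mderivM mderivX0 mderivY0 mderivX1 mderivY1 !mderivXU /=.
set e := _ - _; have -> : e = m.+1%:R * (2%:R * (X * Y * (X ^+ m.+1 - Y ^+ m.+1))).
  rewrite /e !exprS; move: (X ^+ m) (Y ^+ m) X Y (m.+1%:R) => *; ring.
by move=> /(Q_unscale char0 Qtv (ltn0Sn m)); apply: Q_unscale.
Qed.
Lemma Q_xyN : Q ((X * Y) ^+ N).
Proof. by rewrite /N exprM [(X * Y) ^+ 2]exprMn; apply: (Q_X Qtv); exact: Q_x2y2. Qed.

(** Newton's recursion for the power sums of [x^N] and [y^N], whose product is a power
of [x^2 y^2]; the recursion for their differences is the same. *)
Lemma Q_powsum q : Q (X ^+ (N * q) + Y ^+ (N * q)).
Proof.
suff [] : Q (X ^+ (N * q) + Y ^+ (N * q)) /\ Q (X ^+ (N * q.+1) + Y ^+ (N * q.+1)) by [].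
elim: q => [|q [IH1 IH2]]; first by rewrite muln0 muln1 !expr0 -mpolyC1 -mpolyCD; split; [apply: Q_C|].
split=> //; have -> : X ^+ (N * q.+2) + Y ^+ (N * q.+2) =
  (X ^+ N + Y ^+ N) * (X ^+ (N * q.+1) + Y ^+ (N * q.+1))
   + (-1) *: ((X * Y) ^+ N * (X ^+ (N * q) + Y ^+ (N * q))).
  rewrite scaleN1r !(exprM _ N) [(X * Y) ^+ N]exprMn.
  move: (X ^+ N) (Y ^+ N) => u v; rewrite !exprS.
  by move: (u ^+ q) (v ^+ q) => *; ring.
by apply: Q_D => //; [apply: Q_M | apply: Q_Z => //; apply: Q_M => //; exact: Q_xyN].
Qed.
Lemma Q_powdiff q : Q (X * Y * (X ^+ (N * q) - Y ^+ (N * q))).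
Proof.
suff [] : Q (X * Y * (X ^+ (N * q) - Y ^+ (N * q))) /\ Q (X * Y * (X ^+ (N * q.+1) - Y ^+ (N * q.+1))) by [].
elim: q => [|q [IH1 IH2]].
  by rewrite muln0 muln1 !expr0 subrr mulr0; split; [apply: Q_0|exact: Q_xyd].
split=> //; have -> : X * Y * (X ^+ (N * q.+2) - Y ^+ (N * q.+2)) =
  (X ^+ N + Y ^+ N) * (X * Y * (X ^+ (N * q.+1) - Y ^+ (N * q.+1)))
   + (-1) *: ((X * Y) ^+ N * (X * Y * (X ^+ (N * q) - Y ^+ (N * q)))).
  rewrite scaleN1r !(exprM _ N) [(X * Y) ^+ N]exprMn.
  move: (X ^+ N) (Y ^+ N) X Y => u v x y; rewrite !exprS.
  by move: (u ^+ q) (v ^+ q) => *; ring.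
by apply: Q_D => //; [apply: Q_M | apply: Q_Z => //; apply: Q_M => //; exact: Q_xyN].
Qed.
Lemma Q_bdmono l q : Q ((X * Y) ^+ l * (X ^+ (N * q) + (-1) ^+ l *: Y ^+ (N * q))).
Proof.
have Qh : Q ((X * Y) ^+ (l./2).*2).
  by rewrite -mul2n exprM [(X * Y) ^+ 2]exprMn; apply: (Q_X Qtv); exact: Q_x2y2.
rewrite -{1}(odd_double_half l) exprD -signr_odd; case: (odd l).
  rewrite expr1 expr1 scaleN1r [X * Y * _]mulrC -mulrA; apply: Q_M => //; exact: Q_powdiff.
by rewrite expr0 expr0 mul1r scale1r; apply: Q_M => //; exact: Q_powsum.
Qed.

(** Twice an invariant form is the sum of its image under the quaternion [j] and of
itself, which groups its monomials into [x^j y^(d-j) + (-1)^j x^(d-j) y^j]. *)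
Lemma dihedral_forms d F : F \is d.-homog -> linsub (psi z) F = F -> linsub (quat_j k) F = F -> Q F.
Proof.
move=> hF ps pj; apply: (Q_unscale char0 Qtv (isT : 0 < 2)%N).
have FE := fixed_psi_expand zn hF ps.
have -> : 2%:R * F = \sum_(j < d.+1 | (j == d - j %[mod N])%N)
    (dehom F)`_j *: (X ^+ j * Y ^+ (d - j) + (-1) ^+ j *: (X ^+ (d - j) * Y ^+ j)).
  rewrite mulr_natl mulr2n -{2}pj {1 2}FE raddf_sum -big_split /=.
  by apply: eq_bigr => j _; rewrite subZ sub_j scalerDr.
apply: Q_sum => // j /eqP e; apply: Q_Z => //.
have jd : (j <= d)%N by rewrite -ltnS.
case: (leqP j (d - j)) => jj.
  have /dvdnP[q qE] : (N %| d - j - j)%N by rewrite -eqn_mod_dvd // e.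
  have := Q_Z Qtv ((-1) ^+ j) (Q_bdmono j q); congr Q.
  have dj : (d - j = N * q + j)%N by rewrite [RHS]addnC mulnC -qE subnKC.
  rewrite dj !exprD exprMn -!mul_mpolyC.
  have : ((-1) ^+ j)%:MP * ((-1) ^+ j)%:MP = 1 :> P.
    by rewrite -mpolyCM -exprMn mulrNN mulr1 expr1n mpolyC1.
  move: (((-1) ^+ j)%:MP) (X ^+ j) (Y ^+ j) (X ^+ (N * q)) (Y ^+ (N * q)).
  by move=> t x y u v tt; ring: tt.
have {}jj := ltnW jj.
have /dvdnP[q qE] : (N %| j - (d - j))%N by rewrite -eqn_mod_dvd // e.
have := Q_bdmono (d - j) q; congr Q.
have -> : (-1) ^+ j = (-1) ^+ (d - j) :> k.
  rewrite -signr_odd -[in RHS]signr_odd; congr ((-1) ^+ nat_of_bool _).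
  by rewrite -[in LHS](subnK jj) qE oddD !oddM andbF.
have dj : (j = N * q + (d - j) :> nat)%N by rewrite mulnC -qE subnK.
have jE (t : P) : t ^+ j = t ^+ (N * q) * t ^+ (d - j) by rewrite -exprD -dj.
rewrite (jE X) (jE Y) exprMn -!mul_mpolyC.
move: (((-1) ^+ _)%:MP) (X ^+ (d - j)) (Y ^+ (d - j)) (X ^+ (N * q)) (Y ^+ (N * q)).
by move=> t x y u v; ring.
Qed.
End QBD.

Lemma invariants_binary_dihedral : invariants (BDgroup z) = subalgebra_gen (hat (X ^+ N + Y ^+ N)).
Proof.
rewrite /BDgroup invariants_gen -(bigcup_set1 (@hat k) (X ^+ N + Y ^+ N)).
apply: invariants_generated_by_forms => //.
  move=> f ->; split; first by exists N; rewrite rpredD ?dhomogX0 ?dhomogX1.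
  apply/fixed_BD; split; first by apply/(fixed_Zn _ z0); exact: xnyn_fixed.
  rewrite rmorphD /=; have := sub_j N 0; have := sub_j 0 N.
  rewrite -[(-1) ^+ N]signr_odd oddM /= !expr0 !scale1r !mul1r !mulr1 => -> ->.
  exact: addrC.
move=> Q Qtv QG Qfix d F hF /fixed_BD[ps pj].
by apply: (dihedral_forms Qtv _ hF ps pj); apply: QG.
Qed.
End BD.
End Cyclic.

(** * Cyclic groups of order 2n with n odd *)

(** The transvectants of order [2 n - 2] of [f_even] with itself and with [(x y)^(n-1)]
are invariants of degree 4 and 2, hence multiples of [x^2 y^2] and [x y]; the point
is that these multiples are not zero, and it is checked at [(1, 1)]. *)
Section EvenCyclic.
Variable k : fieldType.
Hypothesis char0 : [pchar k] =i pred0.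
Local Notation P := {mpoly k[2]}.
Local Notation X := ('X_0 : P).
Local Notation Y := ('X_1 : P).
Variables (n : nat) (z : k).
Hypothesis on : odd n.
Hypothesis n3 : (3 <= n)%N.
Hypothesis zn : (2 * n).-primitive_root z.
Local Notation N := (2 * n)%N.
Local Notation p := (2 * n - 2)%N.
Definition f_even : P := X ^+ N + (X * Y) ^+ n + Y ^+ N.
Let z0 : z != 0. Proof. exact: prim_neq0 zn. Qed.

Lemma f_even_homog : f_even \is N.-homog.
Proof.
rewrite /f_even !rpredD ?dhomogX0 ?dhomogX1 // exprMn.
by have := dhomogXY k n n; rewrite addnn mul2n.
Qed.

Lemma f_even_psi : linsub (psi z) f_even = f_even.
Proof.
rewrite /f_even exprMn !raddfD /= (sub_psi (i := n) (j := n)) //.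
have := @sub_psi k z N 0 z0; have := @sub_psi k z 0 N z0; rewrite !expr0 mul1r mulr1.
by rewrite (prim_expr_order zn) => -> // ->.
Qed.

(** The value at [(1, 1)] of the derivative of [f_even] of order [a] in [x] and [b] in
[y], as a natural number. *)
Definition dxy_f_even a b := (N ^_ a * 0 ^_ b + n ^_ a * n ^_ b + 0 ^_ a * N ^_ b)%N.

Lemma at2_11_dxyXY a b i j :
  at2 1 1 (dxy a b (X ^+ i * Y ^+ j)) = (i ^_ a * j ^_ b)%:R.
Proof. by rewrite dxyXY at2Z (rmorphM (at2 1 1)) /= !rmorphXn /= at2X at2Y !expr1n !mulr1. Qed.

Lemma at2_11_dxy_f a b : at2 1 1 (dxy a b f_even) = (dxy_f_even a b)%:R.
Proof.
rewrite /f_even exprMn !dxyD !rmorphD /= -!at2_11_dxyXY.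
by rewrite !expr0 mulr1 mul1r.
Qed.

Lemma at2_11_tv q (f g : P) : at2 1 1 (tv q f g) = \sum_(j < q.+1)
  (-1) ^+ j * ('C(q, j)%:R * (at2 1 1 (dxy (q - j) j f) * at2 1 1 (dxy j (q - j) g))).
Proof.
rewrite tv_sum raddf_sum; apply: eq_bigr => j _ /=.
by rewrite !(rmorphM (at2 1 1)) (rmorphXn (at2 1 1)) (rmorphN1 (at2 1 1)) (rmorph_nat (at2 1 1)) !mulrA.
Qed.

(** Separating the signs lets the comparison take place among natural numbers. *)
Lemma alt_sum M (g : nat -> nat) : \sum_(j < M) (-1) ^+ j * (g j)%:R =
  (\sum_(j < M | ~~ odd j) g j)%N%:R - (\sum_(j < M | odd j) g j)%N%:R :> k.
Proof.
rewrite (bigID (fun j : 'I_M => odd j)) /= addrC !natr_sum -sumrN; congr (_ + _).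
  by apply: eq_bigr => j /negPf oj; rewrite -signr_odd oj expr0 mul1r.
by apply: eq_bigr => j oj; rewrite -signr_odd oj expr1 mulN1r.
Qed.

Lemma phi_sym a b : dxy_f_even a b = dxy_f_even b a.
Proof. by rewrite /dxy_f_even; lia. Qed.

Lemma phi_pos a b : (0 < a)%N -> (0 < b)%N -> dxy_f_even a b = (n ^_ a * n ^_ b)%N.
Proof.
by move=> a0 b0; rewrite /dxy_f_even !ffact0n !eqn0Ngt a0 b0 muln0 mul0n addn0.
Qed.

(** For [0 < j < p] the mixed derivatives only see the middle monomial [(x y)^n], so
the term of index [j] vanishes unless [n - 2 <= j <= n]. The odd terms contribute
[2 'C(p, n) h^2]; the even term [n - 1] alone contributes [4 'C(p, n - 1) h^2], which
is larger because [n - 1] is the middle of [p = 2 n - 2]. *)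
Lemma tv_ff_neq0 : at2 1 1 (tv p f_even f_even) != 0.
Proof.
rewrite at2_11_tv; pose g j := ('C(p, j) * (dxy_f_even (p - j) j * dxy_f_even j (p - j)))%N.
under eq_bigr do rewrite !at2_11_dxy_f -!natrM.
rewrite (alt_sum _ g).
pose h := (n`! * n ^_ (n - 2))%N.
have h2 : (2 * n ^_ (n - 2) = n`!)%N 
  by have := ffact_fact (leq_subr 2 n); rewrite subKn ?(ltnW n3) // mulnC.
have h0 : (0 < h)%N by rewrite muln_gt0 fact_gt0 ffact_gt0 leq_subr.
have gn : g n = ('C(p, n) * (h * h))%N.
  rewrite /g (phi_sym (p - n)) !phi_pos; [|lia|lia].
  by rewrite (_ : p - n = n - 2)%N ?ffactnn //; lia.
have gn2 : g (n - 2)%N = ('C(p, n) * (h * h))%N.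
  rewrite /g !phi_pos; [|lia|lia|lia|lia].
  rewrite (_ : p - (n - 2) = n)%N; last lia.
  rewrite ffactnn -(@bin_sub p n); last lia.
  rewrite (_ : p - n = n - 2)%N; last lia.
  by rewrite [(n ^_ _ * _)%N]mulnC.
have gn1 : g (n - 1)%N = ('C(p, n - 1) * (4 * (h * h)))%N.
  rewrite /g !phi_pos; [|lia|lia|lia|lia].
  rewrite (_ : p - (n - 1) = n - 1)%N; last lia.
  have -> : (n ^_ (n - 1) = n`!)%N.
    by have := ffact_fact (leq_subr 1 n); rewrite subKn ?muln1 //; lia.
  have hh : (2 * h = n`! * n`!)%N by rewrite /h mulnCA h2.
  by congr (_ * _)%N; rewrite -[4%N]/(2 * 2)%N mulnACA hh.
have cle : ('C(p, n) <= 'C(p, n - 1))%N.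
  have n1 : (n - 1).+1 = n by lia.
  have := mul_bin_left p (n - 1); rewrite n1 => e.
  rewrite -(leq_pmul2l (m := n)); last lia.
  by rewrite e leq_mul2r; apply/orP; right; lia.
have odd_le : (\sum_(j < p.+1 | odd j) g j = g n + g (n - 2))%N.
  have ln : (n < p.+1)%N by lia.
  have ln2 : (n - 2 < p.+1)%N by lia.
  rewrite (bigD1 (Ordinal ln)) //= (bigD1 (Ordinal ln2)) /=; last first.
    by rewrite oddB ?on //=; [rewrite -val_eqE /=; lia | lia].
  rewrite big1 ?addn0 // => j /andP[/andP[oj jn] jn2].
  move: jn jn2; rewrite -!val_eqE /= => jn jn2.
  have jp := ltn_ord j.
  have [jl|jg] := leqP j n; last first.
    rewrite /g (phi_sym (p - j)); case: (posnP (p - j)%N) => [pj|pj].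
      have : j = p :> nat by lia.
      by move: oj => /[swap] ->; rewrite oddB ?oddM //; lia.
    have j0 : (0 < j)%N by lia.
    by rewrite !phi_pos // (ffact_small jg) !mul0n muln0.
  have pj : (n < p - j)%N.
    have nj1 : j != (n - 1)%N :> nat.
      by apply: contraTneq oj => ->; rewrite oddB ?on //; lia.
    by lia.
  have j0 : (0 < j)%N by case: (nat_of_ord j) oj.
  have pj0 : (0 < p - j)%N by lia.
  by rewrite /g !phi_pos // (ffact_small pj) !mul0n muln0.
have even_ge : (g (n - 1) <= \sum_(j < p.+1 | ~~ odd j) g j)%N.
  have ln1 : (n - 1 < p.+1)%N by lia.
  rewrite (bigD1 (Ordinal ln1)) /=; first exact: leq_addr.
  by rewrite oddB ?on //; lia.
have lt : (\sum_(j < p.+1 | odd j) g j < \sum_(j < p.+1 | ~~ odd j) g j)%N.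
  apply: leq_trans even_ge; rewrite odd_le gn gn2 gn1 -mulnDl.
  have hh : (0 < h * h)%N by rewrite muln_gt0 h0.
  have c0 : (0 < 'C(p, n - 1))%N by rewrite bin_gt0; lia.
  rewrite [X in (_ < X)%N]mulnA ltn_pmul2r //; lia.
by rewrite -natrB ?(ltnW lt) // char0_natr_neq0 // subn_gt0.
Qed.

Lemma tv_fg_neq0 : at2 1 1 (tv p f_even ((X * Y) ^+ (n - 1))) != 0.
Proof.
have ln1 : (n - 1 < p.+1)%N by lia.
have ep : (p - (n - 1) = n - 1)%N by lia.
rewrite at2_11_tv (bigD1 (Ordinal ln1)) //= big1 ?addr0 => [|j].
  rewrite exprMn at2_11_dxyXY at2_11_dxy_f ep phi_pos; [|lia|lia].
  rewrite mulf_neq0 ?expf_neq0 ?oppr_eq0 ?oner_neq0 // -!natrM char0_natr_neq0 //.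
  by rewrite !muln_gt0 bin_gt0 !ffact_gt0 leqnn; lia.
rewrite -val_eqE /= => jn; rewrite exprMn at2_11_dxyXY.
have jp := ltn_ord j.
have [jl|jg] := leqP j (n - 1); last by rewrite (ffact_small jg) mul0n !mulr0.
have pj : (n - 1 < p - j)%N by lia.
by rewrite (ffact_small pj) muln0 !mulr0.
Qed.

Lemma invariants_cyclic_double_odd : invariants (Zgroup z) = subalgebra_gen (hat f_even).
Proof.
rewrite /Zgroup invariants_gen -(bigcup_set1 (@hat k) f_even).
apply: invariants_generated_by_forms => //.
  move=> f ->; split; first by exists N; exact: f_even_homog.
  by apply/fixed_Zn => //; exact: f_even_psi.
move=> Q Qtv QG Qfix d F hF /(fixed_Zn _ z0) ps.
have Qf : Q f_even by apply: QG.
have hf := f_even_homog.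
have unscale (c : k) (G : P) : c != 0 -> Q (c *: G) -> Q G.
  move=> c0 /(Q_Z Qtv c^-1); by rewrite scalerA mulVf // scale1r.
have mid m G : G \is (2 * m).-homog -> (2 * m < N)%N -> Q G -> at2 1 1 G != 0 ->
    Q (X ^+ m * Y ^+ m).
  move=> hG mN QG1 G0; apply: (unscale _ _ G0).
  by rewrite -(fixed_psi_mid zn hG mN) //; apply/fixed_Zn => //; apply: Qfix.
have Q2 : Q (X ^+ 2 * Y ^+ 2).
  apply: (mid 2 (tv p f_even f_even)) tv_ff_neq0.
  - by have := tv_dhomog p hf hf; rewrite (_ : N - p + (N - p) = 2 * 2)%N //; lia.
  - lia.
  - exact: (Q_tv Qtv p hf hf Qf Qf).
have hxy : (X * Y) ^+ (n - 1) \is (2 * n - 2).-homog.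
  rewrite exprMn; have := dhomogXY k (n - 1) (n - 1).
  by rewrite (_ : n - 1 + (n - 1) = p)%N //; lia.
have Qxyn : Q ((X * Y) ^+ (n - 1)).
  have -> : (n - 1 = 2 * (n - 1)./2)%N.
    by rewrite mul2n even_halfK // oddB ?on //; lia.
  by rewrite exprM [(X * Y) ^+ 2]exprMn; apply: (Q_X Qtv).
have Qxy : Q (X * Y).
  rewrite -[X]expr1 -[Y]expr1; apply: (mid 1%N (tv p f_even ((X * Y) ^+ (n - 1)))) tv_fg_neq0.
  - by have := tv_dhomog p hf hxy; rewrite (_ : N - p + (p - p) = 2 * 1)%N //; lia.
  - lia.
  - exact: (Q_tv Qtv p hf hxy Qf Qxyn).
have Qr : Q (X ^+ N + Y ^+ N).
  have -> : X ^+ N + Y ^+ N = f_even + (-1) *: (X * Y) ^+ n.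
    by rewrite /f_even scaleN1r addrAC addrK.
  by apply: (Q_D Qtv) => //; apply: (Q_Z Qtv); apply: (Q_X Qtv).
have N0 : N = N.-1.+1 by lia.
rewrite N0 in Qr; have [Qx Qy] := split_powers char0 Qtv Qr Qxy; rewrite -N0 in Qx Qy.
exact: (cyclic_forms Qtv zn Qxy Qx Qy hF ps).
Qed.
End EvenCyclic.

(** * Factorial domains *)
Section Divisibility.
Variable D : comNzRingType.
Implicit Types (a b c p q u v : D) (s t : seq D).

Definition dvd a b := exists c, b = a * c.
Definition prime_elt p := [/\ p <> 0, ~ is_unit p &
  forall a b, dvd p (a * b) -> dvd p a \/ dvd p b].
Definition primes_seq s := {in s, forall p, prime_elt p}.
(** The number [n] of prime factors is recorded to serve as a measure. *)
Definition fact a n := exists u s, [/\ is_unit u, primes_seq s, size s = n & a = u * \prod_(p <- s) p].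
Definition domain := forall a b, a * b = 0 -> a = 0 \/ b = 0.
(** Existence of prime factorizations; uniqueness follows. *)
Definition factorial := domain /\ forall a, a <> 0 -> exists n, fact a n.

Lemma unit1 : is_unit (1 : D). Proof. by exists 1; rewrite mulr1. Qed.
Lemma unitM u v : is_unit u -> is_unit v -> is_unit (u * v).
Proof. by move=> [u' e] [v' e']; exists (u' * v'); rewrite mulrACA e e' mulr1. Qed.
Lemma unit_dvd a u : is_unit u -> dvd a u -> is_unit a.
Proof. by move=> [v uv] [c e]; exists (c * v); rewrite mulrA -e. Qed.
Lemma dvd_refl a : dvd a a. Proof. by exists 1; rewrite mulr1. Qed.
Lemma dvd_mulr a b c : dvd a b -> dvd a (b * c).
Proof. by move=> [d ->]; exists (d * c); rewrite mulrA. Qed.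
Lemma dvd_mull a b c : dvd a c -> dvd a (b * c).
Proof. by rewrite mulrC; apply: dvd_mulr. Qed.
Lemma dvd_trans a b c : dvd a b -> dvd b c -> dvd a c.
Proof. by move=> [d ->] [e ->]; exists (d * e); rewrite mulrA. Qed.
Lemma dvdD a b c : dvd a b -> dvd a c -> dvd a (b + c).
Proof. by move=> [d ->] [e ->]; exists (d + e); rewrite mulrDr. Qed.

Lemma primes_cons p s : primes_seq (p :: s) <-> prime_elt p /\ primes_seq s.
Proof.
split=> [ps|[pp ps] q]; last by rewrite inE => /predU1P[->|/ps].
by split=> [|q qs]; apply: ps; rewrite inE ?eqxx ?qs ?orbT.
Qed.

Lemma prime_dvd_prod p s : prime_elt p -> dvd p (\prod_(q <- s) q) ->
  exists2 q, q \in s & dvd p q.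
Proof.
move=> [_ pu pp]; elim: s => [|q s IH].
  by rewrite big_nil => /(unit_dvd unit1).
rewrite big_cons => /pp[pq|/IH[r rs pr]]; first by exists q; rewrite ?inE ?eqxx.
by exists r; rewrite ?inE ?rs ?orbT.
Qed.

Lemma fact_mul a b m n : fact a m -> fact b n -> fact (a * b) (m + n).
Proof.
move=> [u [s [uu ps ss ->]]] [v [t [uv pt st ->]]]; exists (u * v), (s ++ t); split.
- exact: unitM.
- by move=> p; rewrite mem_cat => /orP[/ps|/pt].
- by rewrite size_cat ss st.
- by rewrite big_cat mulrACA.
Qed.
Lemma fact_unit u : is_unit u -> fact u 0.
Proof. by move=> uu; exists u, [::]; rewrite big_nil mulr1. Qed.
Lemma fact_prime p : prime_elt p -> fact p 1.
Proof.
move=> pp; exists 1, [:: p]; rewrite big_seq1 mul1r; split=> //; first exact: unit1.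
by move=> q; rewrite inE => /eqP ->.
Qed.
Lemma fact0_unit a : fact a 0 -> is_unit a.
Proof. by move=> [u [s [uu _ /size0nil -> ->]]]; rewrite big_nil mulr1. Qed.

Hypothesis dom : domain.

Lemma dom_cancel a b c : a <> 0 -> a * b = a * c -> b = c.
Proof.
move=> a0 e; have : a * (b - c) = 0 by rewrite mulrBr e subrr.
by case/dom => // /eqP; rewrite subr_eq0 => /eqP.
Qed.

Lemma prime_associate p q : prime_elt p -> prime_elt q -> dvd p q -> associate p q.
Proof.
move=> [p0 pu pp] [q0 qu qp] [w e].
have [|[r pE]|[r wE]] := qp p w; first by rewrite -e; exact: dvd_refl.
- exists w; last by rewrite mulrC.
  exists r; apply: (dom_cancel q0).
  by rewrite [w * r]mulrC mulrA -pE -e mulr1.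
- case: pu; exists r; apply: (dom_cancel q0).
  by rewrite mulrCA -wE -e mulr1.
Qed.

(** The unit [u] collects the units by which matched primes differ. *)
Lemma prime_factorization_unique u s t : is_unit u -> primes_seq s -> primes_seq t ->
  \prod_(p <- s) p = u * \prod_(p <- t) p ->
  exists2 t', perm_eq t' t &
    size s = size t' /\ forall j, (j < size s)%N -> associate s`_j t'`_j.
Proof.
elim: s u t => [|p s IH] u t uu ps pt.
  rewrite big_nil; case: t pt => [_ _|q t /primes_cons[[_ qu _] _]]; first by exists [::].
  rewrite big_cons mulrCA => e; case: qu.
  by exists (u * \prod_(p <- t) p).
move/primes_cons: ps => [pp ps]; rewrite big_cons => e.
have [p0 pu ppr] := pp.
have [pdu|pdt] : dvd p u \/ dvd p (\prod_(q <- t) q).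
- by apply: ppr; rewrite -e; apply: dvd_mulr; exact: dvd_refl.
- by case: pu; apply: unit_dvd pdu.
have [q qt pq] := prime_dvd_prod pp pdt.
have [w wu qE] := prime_associate pp (pt q qt) pq.
have tp := perm_to_rem qt.
have [||||t' t't [st at']] := IH (u * w) (rem q t).
- exact: unitM.
- exact: ps.
- by move=> r /mem_rem; apply: pt.
- apply: (dom_cancel p0); rewrite e (perm_big _ tp) big_cons /= {1}qE.
  by move: (\prod_(_ <- _) _) => M; ring.
exists (q :: t'); first by rewrite (perm_trans _ (_ : perm_eq (q :: rem q t) t)) ?perm_cons // perm_sym.
split=> [/=|[_|j]]; first by rewrite st.
  by exists w.
by rewrite /= ltnS; apply: at'.
Qed.

Lemma fact_uniq a m n : fact a m -> fact a n -> m = n.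
Proof.
move=> [u [s [[u' uu'] ps ss ->]]] [v [t [uv pt st e]]].
have [||t' t't [sst _]] := @prime_factorization_unique (u' * v) s t _ ps pt.
- by apply: unitM => //; exists u; rewrite mulrC.
- by rewrite -mulrA -e mulrA [u' * u]mulrC uu' mul1r.
by rewrite -ss sst (perm_size t't).
Qed.

Lemma prime_prod_neq0 s : primes_seq s -> \prod_(p <- s) p <> 0.
Proof.
elim: s => [|p s IH]; first by rewrite big_nil => _ /eqP; rewrite oner_eq0.
by move=> /primes_cons[[p0 _ _] /IH s0]; rewrite big_cons => /dom[].
Qed.

Lemma cancel_primes s q a c : primes_seq s -> {in s, forall p, ~ dvd p q} ->
  \prod_(p <- s) p * a = q * c -> dvd q a.
Proof.
elim: s c => [|p s IH] c ps sq; first by rewrite big_nil mul1r => ->; exists c.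
move/primes_cons: ps => [pp ps]; rewrite big_cons => e.
have [p0 _ ppr] := pp; have pnq : ~ dvd p q by apply: sq; rewrite inE eqxx.
have [//|[d cE]] : dvd p q \/ dvd p c.
  by apply: ppr; rewrite -e -mulrA; apply: dvd_mulr; exact: dvd_refl.
apply: (IH d ps) => [r rs|]; first by apply: sq; rewrite inE rs orbT.
by apply: (dom_cancel p0); rewrite mulrA e cE mulrCA.
Qed.

(** The greatest common divisor [g], with coprimality of the cofactors in the form of
Gauss's lemma; [g] collects the primes of [a] that can be taken out of [b]. *)
Lemma fact_coprime a b n : fact a n -> exists g a' b',
  [/\ a = g * a', b = g * b' & forall c, dvd a' (b' * c) -> dvd a' c].
Proof.
move=> [u [s [uu ps ss ->]]]; elim: s b {n ss} ps => [|p s IH] b ps.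
  exists 1, u, b; rewrite big_nil mulr1 !mul1r; split=> // c _.
  by have [v uv] := uu; exists (v * c); rewrite mulrA uv mul1r.
move/primes_cons: ps => [pp ps]; rewrite big_cons mulrCA; have [p0 pu ppr] := pp.
have [[b1 bE]|pb] := pselect (dvd p b).
  have [g [a' [b' [eA eB cop]]]] := IH b1 ps.
  by exists (p * g), a', b'; rewrite eA bE eB !mulrA.
have [g [a' [b' [eA eB cop]]]] := IH b ps.
exists g, (p * a'), b'; split=> //; first by rewrite eA mulrCA.
move=> c pc; have [c' cE] : dvd a' c.
  by apply: cop; apply: dvd_trans pc; exists p; rewrite mulrC.
have a'0 : a' <> 0.
  move=> a0; have := prime_prod_neq0 ps; rewrite a0 mulr0 in eA.
  have [v uv] := uu; case; apply: (dom_cancel (a := u)); last by rewrite eA mulr0.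
  by move=> u0; move: uv; rewrite u0 mul0r => /esym/eqP; rewrite oner_eq0.
have [//|[d dE]] : dvd p b' \/ dvd p c'; last first.
- by exists d; rewrite cE dE; ring.
- by move=> pb'; case: pb; rewrite eB; apply: dvd_mull.
apply: ppr; have [d dE] := pc; exists d; apply: (dom_cancel a'0).
by rewrite cE in dE; move: dE; rewrite mulrCA => ->; ring.
Qed.
End Divisibility.

(** * Nagata's criterion *)

(** [D'] plays the role of a localization of [D] at the primes in [S], but [i] need not
invert them: it is enough that denominators can be cleared. This form covers both
R[X] inside K[X] and the coordinate ring of SL2 inside a polynomial ring. *)
Section Nagata.
Variables (D D' : comNzRingType) (i : {rmorphism D -> D'}) (S : D -> Prop).
Implicit Types (a b c p q s t : D).
Hypothesis i_inj : injective i.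
Hypothesis facD' : factorial D'.
Hypothesis primeS : forall p, S p -> prime_elt p.

Definition Sprod a := exists2 s : seq D, {in s, forall p, S p} & a = \prod_(p <- s) p.
Definition Sfree a := forall p, S p -> ~ dvd p a.

Hypothesis clear_denominators : forall d' : D', exists s d, Sprod s /\ i s * d' = i d.
Hypothesis strip : forall d, d <> 0 -> exists s d0, [/\ Sprod s, d = s * d0 & Sfree d0].

Let domD' : domain D' := facD'.1.
Lemma nagata_domain : domain D.
Proof.
move=> a b ab; have /domD' : i a * i b = 0 by rewrite -rmorphM ab rmorph0.
by case=> e; [left | right]; apply: i_inj; rewrite e rmorph0.
Qed.
Let domD := nagata_domain.

Lemma Sprod1 : Sprod 1. Proof. by exists [::]; rewrite ?big_nil. Qed.
Lemma SprodM a b : Sprod a -> Sprod b -> Sprod (a * b).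
Proof.
move=> [s Ss ->] [t St ->]; exists (s ++ t); last by rewrite big_cat.
by move=> p; rewrite mem_cat => /orP[/Ss|/St].
Qed.
Lemma Sprod_fact a : Sprod a -> exists n, fact a n.
Proof.
move=> [s Ss ->]; exists (size s), 1, s; rewrite mul1r; split=> //; first exact: unit1.
by move=> p /Ss /primeS.
Qed.
Lemma Sprod_neq0 a : Sprod a -> a <> 0.
Proof. by move=> [s Ss ->]; apply: (prime_prod_neq0 domD) => p /Ss /primeS. Qed.

Lemma Sfree_cancel s q a c : Sprod s -> Sfree q -> s * a = q * c -> dvd q a.
Proof.
move=> [l Sl ->] Sq; apply: (cancel_primes domD) => p /Sl; first exact: primeS.
exact: Sq.
Qed.

(** The elements of [D'] that become units once [S] is inverted. *)
Definition Sdiv (e : D') := exists2 s, Sprod s & dvd e (i s).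
Lemma SdivM e f : Sdiv e -> Sdiv f -> Sdiv (e * f).
Proof.
move=> [s Ss [e' sE]] [t St [f' tE]]; exists (s * t); first exact: SprodM.
by exists (e' * f'); rewrite rmorphM sE tE mulrACA.
Qed.

Lemma Sfree_dvd_of_loc q a (e c' : D') : Sdiv e -> Sfree q -> e * i a = i q * c' -> dvd q a.
Proof.
move=> [s Ss [f sE]] Sq ea; have [t [d [St tE]]] := clear_denominators (f * c').
apply: (@Sfree_cancel (t * s) q a d) => //; first exact: SprodM.
apply: i_inj; rewrite !rmorphM -tE sE; transitivity (i t * f * (e * i a)); first by ring.
by rewrite ea; ring.
Qed.

(** A prime of [D'] that does not become a unit gives a prime of [D]: the part of its
numerator that is free of factors in [S]. *)
Lemma prime_lift (p' : D') : prime_elt p' -> ~ Sdiv p' ->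
  exists q (t' : D'), [/\ prime_elt q, Sfree q, Sdiv t' & i q = p' * t'].
Proof.
move=> pp nS; have [p0 pu ppr] := pp.
have [s [d [Ss sE]]] := clear_denominators p'.
have is0 t : Sprod t -> i t <> 0.
  by move=> /Sprod_neq0 t0 it0; apply: t0; apply: i_inj; rewrite it0 rmorph0.
have d0 : d <> 0.
  by move=> d0; move: sE; rewrite d0 rmorph0 => /domD'[/(is0 _ Ss)|/p0].
have [s1 [q [Ss1 dE Sq]]] := strip d0.
have [//|[t' qE]] : dvd p' (i s1) \/ dvd p' (i q).
- by apply: ppr; rewrite -rmorphM -dE -sE; apply: dvd_mull; exact: dvd_refl.
- by move=> ps1; case: nS; exists s1.
have t'E : i s = i s1 * t'.
  apply: (dom_cancel domD' p0); rewrite mulrC sE dE rmorphM qE; ring.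
have St' : Sdiv t' by exists s => //; exists (i s1); rewrite t'E mulrC.
exists q, t'; split=> //; split.
- by move=> q0; apply: d0; rewrite dE q0 mulr0.
- move=> [v qv]; apply: pu; exists (t' * i v).
  by rewrite mulrA -qE -rmorphM qv rmorph1.
move=> a b [c abE].
have main (e : D) (e' : D') : i e = p' * e' -> dvd q e.
  move=> eE; apply: (@Sfree_dvd_of_loc q e t' e') => //.
  by rewrite eE qE; ring.
have [[e' eE]|[e' eE]] : dvd p' (i a) \/ dvd p' (i b).
- by apply: ppr; rewrite -rmorphM abE rmorphM qE -mulrA; apply: dvd_mulr; exact: dvd_refl.
- by left; apply: main eE.
- by right; apply: main eE.
Qed.

(** By induction on the primes of [i d] in [D']: each of them is invertible up to
[S], or lifts to a prime of [D] dividing [d]. *)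
Lemma nagata_Sfree (l : seq D') (e f : D') d : primes_seq l -> Sdiv e -> Sdiv f ->
  Sfree d -> e * i d = f * \prod_(p <- l) p -> exists n, fact d n.
Proof.
elim: l e f d => [|p' l IH] e f d pl Se Sf Sd.
  rewrite big_nil mulr1 => ed; exists 0%N; apply: fact_unit.
  have [s Ss [f' sE]] := Sf; have [t [c [St cE]]] := clear_denominators (e * f').
  have [|u uE] := @Sfree_cancel (t * s) d 1 c (SprodM St Ss) Sd.
    apply: i_inj; rewrite mulr1 !rmorphM -cE sE -ed; ring.
  by exists u; rewrite -uE.
move/primes_cons: pl => [pp pl]; rewrite big_cons => ed.
have [Sp|nSp] := pselect (Sdiv p').
  by apply: (IH e (f * p')) => //; [exact: SdivM | rewrite ed mulrA].
have [q [t' [pq Sq St' qE]]] := prime_lift pp nSp.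
have [c dE] : dvd q d.
  apply: (@Sfree_dvd_of_loc q d (e * t') (f * \prod_(p <- l) p)) => //; first exact: SdivM.
  by rewrite mulrAC ed qE; ring.
have [p0 _ _] := pp.
have [||n fn] := IH (e * t') f c pl (SdivM Se St') Sf.
- by move=> p Sp pc; apply: (Sd p) => //; rewrite dE; apply: dvd_mull.
- apply: (dom_cancel domD' p0); rewrite [RHS]mulrCA -ed dE rmorphM qE; ring.
by exists (1 + n)%N; rewrite dE; apply: fact_mul => //; apply: fact_prime.
Qed.

Theorem nagata : factorial D.
Proof.
split=> [|a a0]; first exact: domD.
have [s [d [Ss aE Sd]]] := strip a0; have [m fs] := Sprod_fact Ss.
suff [n fd] : exists n, fact d n by exists (m + n)%N; rewrite aE; apply: fact_mul.
have d0 : i d <> 0.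
  by move=> id0; apply: a0; rewrite aE (_ : d = 0) ?mulr0 //; apply: i_inj; rewrite id0 rmorph0.
have [n [u [l [[v uv] pl _ dE]]]] := facD'.2 _ d0.
apply: (@nagata_Sfree l 1 u d) => //; last by rewrite mul1r.
- by exists 1; [exact: Sprod1 | exists 1; rewrite rmorph1 mulr1].
- by exists 1; [exact: Sprod1 | exists v; rewrite rmorph1 uv].
Qed.
End Nagata.

Section FieldPoly.
Variable F : fieldType.

Lemma dvdp_dvd (p q : {poly F}) : p %| q <-> dvd p q.
Proof.
split=> [/dvdpP[c ->]|[c ->]]; first by exists c; rewrite mulrC.
exact: dvdp_mulr.
Qed.

Lemma poly_unit_size (p : {poly F}) : is_unit p <-> size p = 1%N.
Proof.
split=> [[q pq]|/eqP/size_poly1P[c c0 ->]].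
  have p0 : p != 0 by apply: contra_eq_neq pq => ->; rewrite mul0r eq_sym oner_eq0.
  have q0 : q != 0 by apply: contra_eq_neq pq => ->; rewrite mulr0 eq_sym oner_eq0.
  have := size_mul p0 q0; rewrite pq size_poly1.
  by move: p0 q0; rewrite -!size_poly_gt0; case: (size p) => [//|[|m]]; case: (size q) => // n; rewrite addSn addnS.
by exists c^-1%:P; rewrite -polyCM divff.
Qed.

Lemma irreducible_poly_prime (p : {poly F}) : irreducible_poly p -> prime_elt p.
Proof.
move=> irr; have p0 := irredp_neq0 irr; split.
- by apply/eqP.
- by move=> /poly_unit_size p1; have [] := irr; rewrite p1.
move=> a b /dvdp_dvd pab; have [pa|pa] := boolP (p %| a); [left; exact/dvdp_dvd|right].
apply/dvdp_dvd; rewrite -(Gauss_dvdpr _ (_ : coprimep p a)) //.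
rewrite /coprimep; apply: contraNT pa => g1.
by have /eqp_dvdl <- := irr.2 _ g1 (dvdp_gcdl p a); exact: dvdp_gcdr.
Qed.

Lemma field_poly_factorial : factorial {poly F}.
Proof.
split=> [a b /eqP|p]; first by rewrite mulf_eq0 => /orP[]/eqP; [left|right].
have [n] := ubnP (size p); elim: n p => // n IH p; rewrite ltnS => pn /eqP p0.
have [s1|s1] := eqVneq (size p) 1%N.
  by exists 0%N; apply: fact_unit; apply/poly_unit_size.
have sp : (1 < size p)%N by rewrite ltn_neqAle eq_sym s1 size_poly_gt0.
have [irr|nirr] := pselect (irreducible_poly p).
  by exists 1%N; apply: fact_prime; exact: irreducible_poly_prime.
have [q [q1 qp nq]] : exists q : {poly F}, [/\ size q != 1%N, q %| p & ~~ (q %= p)].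
  apply: contra_notP nirr => nex; split=> // q q1 qp.
  by apply/negP => /negP nq; apply: nex; exists q.
have q0 : q != 0 by apply: contraNneq p0 => q0; rewrite q0 dvd0p in qp.
have pE := divpK qp; set r := p %/ q in pE.
have r0 : r != 0 by apply: contraNneq p0 => r0; rewrite -pE r0 mul0r.
have sE := size_mul r0 q0; rewrite pE in sE.
have sq : (size q < size p)%N by rewrite ltn_neqAle dvdp_leq // andbT dvdp_size_eqp.
have sq1 : (1 < size q)%N by rewrite ltn_neqAle eq_sym q1 size_poly_gt0.
have sr : (size r < size p)%N.
  by rewrite sE; case: (size q) sq1 => [|[|m]] // _; rewrite !addnS ltnS leq_addr.
have [m fr] := IH r (leq_trans sr pn) (elimN eqP r0).
have [m' fq] := IH q (leq_trans sq pn) (elimN eqP q0).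
by exists (m + m')%N; rewrite -pE; apply: fact_mul.
Qed.
End FieldPoly.

(** * Gauss's lemma *)
Section Gauss.
Local Open Scope quotient_scope.
Variable R : idomainType.
Hypothesis facR : factorial R.
Local Notation K := {fraction R}.
Implicit Types (f g : {poly R}).

Lemma fracP (c : K) : exists a b : R, b != 0 /\ tofrac b * c = tofrac a.
Proof.
elim/quotW: c => r; exists (\n_r), (\d_r); split; first exact: denom_ratioP.
unlock FracField.tofrac; rewrite -[LHS]FracField.pi_mul.
apply/eqmodP; rewrite /= FracField.equivfE /FracField.mulf.
rewrite !numden_Ratio ?mulf_neq0 ?oner_neq0 ?denom_ratioP //.
by rewrite !mulr1 !mul1r mulrC.
Qed.

Lemma facR_neq0 (a : R) : a != 0 -> exists n, fact a n.
Proof. by move=> /eqP a0; apply: facR.2. Qed.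

Definition Sconst (f : {poly R}) := exists2 p, prime_elt p & f = p%:P.

Lemma dvd_polyC (p : R) f : dvd p%:P f <-> forall j, dvd p f`_j.
Proof.
split=> [[g ->] j|pf]; first by exists g`_j; rewrite coefCM.
exists (\poly_(j < size f) projT1 (cid (pf j))).
apply/polyP => j; rewrite coefCM coef_poly; case: ltnP => jf.
  by case: (cid (pf j)) => /= c ->.
by rewrite mulr0 nth_default.
Qed.

(** If [a] and [b] are the first indices where [p] does not divide the coefficients of
[f] and [g], then the coefficient of index [a + b] of the product has exactly one
term that [p] does not divide. *)
Lemma polyC_prime (p : R) : prime_elt p -> prime_elt p%:P.
Proof.
move=> [p0 pu pp]; split.
- by move/eqP; rewrite polyC_eq0 => /eqP.
- by move=> [g /(congr1 (fun f : {poly R} => f`_0))]; rewrite coefCM coef1 => e; apply: pu; exists g`_0.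
move=> f g /dvd_polyC pfg; apply: contrapT => /not_orP[nf ng].
have low h : ~ dvd p%:P h -> exists2 j, ~ dvd p h`_j & forall l, (l < j)%N -> dvd p h`_l.
  move=> nh; have ex : exists j, `[< ~ dvd p h`_j >].
    by apply: contra_notP nh => nex; apply/dvd_polyC => j; apply: contrapT => nj; apply: nex; exists j; apply/asboolP.
  exists (ex_minn ex); first by case: ex_minnP => j /asboolP.
  move=> l; case: ex_minnP => j _ jmin lj; apply: contrapT => /asboolP/jmin.
  by rewrite leqNgt lj.
have [a na la] := low f nf; have [b nb lb] := low g ng.
have := pfg (a + b)%N; rewrite coefM.
have ab : (a < (a + b).+1)%N by rewrite ltnS leq_addr.
rewrite (bigD1 (Ordinal ab)) //= addKn => -[c cE].
have [||] // := pp f`_a g`_b.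
have -> : f`_a * g`_b = p * c - \sum_(j < (a + b).+1 | j != Ordinal ab) f`_j * g`_(a + b - j).
  by rewrite -cE addrK.
apply: dvdD; first by exists c.
rewrite -mulN1r; apply: dvd_mull; apply: big_ind => [||j].
- by exists 0; rewrite mulr0.
- by move=> u v; apply: dvdD.
rewrite -val_eqE /= => ja; have [jl|jg] := ltnP j a; first by apply: dvd_mulr; apply: la.
apply: dvd_mull; apply: lb; rewrite ltn_subLR; last by rewrite -ltnS.
by rewrite ltn_add2r ltn_neqAle eq_sym ja.
Qed.

Local Notation i := (map_poly (@tofrac R)).

Lemma Sprod_polyC (s : seq R) : primes_seq s -> Sprod Sconst (\prod_(p <- s) p)%:P.
Proof.
move=> ps; exists [seq p%:P | p <- s].
  by move=> f /mapP[p /ps pp ->]; exists p.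
by rewrite big_map rmorph_prod.
Qed.

Lemma poly_clear_denominators (f : {poly K}) : exists s d, Sprod Sconst s /\ i s * f = i d.
Proof.
elim/poly_ind: f => [|f c [s [d [Ss sE]]]].
  by exists 1, 0; split; [exact: Sprod1 | rewrite mulr0 rmorph0].
have [a [b [b0 bE]]] := fracP c.
have [n [u [l [[v uv] pl _ lE]]]] := facR_neq0 b0.
have lc : tofrac (\prod_(p <- l) p) * c = tofrac (v * a).
  by rewrite [RHS]rmorphM /= -bE mulrA -rmorphM {1}lE mulrA [v * u]mulrC uv mul1r.
exists (s * (\prod_(p <- l) p)%:P), (d * (\prod_(p <- l) p)%:P * 'X + s * (v * a)%:P).
split; first by apply: SprodM => //; exact: Sprod_polyC.
rewrite (rmorphD i) !(rmorphM i) /= map_polyX !map_polyC /= -lc polyCM -sE.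
by move: (i s) (tofrac _)%:P c%:P 'X f {sE} => a1 a2 a3 a4 a5; ring.
Qed.

Lemma poly_strip (f : {poly R}) : f <> 0 -> exists s d0,
  [/\ Sprod Sconst s, f = s * d0 & Sfree Sconst d0].
Proof.
move=> /eqP f0; have [n fn] : exists n, fact (lead_coef f) n.
  by apply: facR_neq0; rewrite lead_coef_eq0.
elim/ltn_ind: n f f0 fn => n IH f f0 fn.
have [Sf|nSf] := pselect (Sfree Sconst f).
  by exists 1, f; rewrite mul1r; split => //; exact: Sprod1.
have [p [pp [g fE]]] : exists p, prime_elt p /\ dvd p%:P f.
  apply: contra_notP nSf => nex _ [p pp ->] pf; apply: nex; by exists p.
have g0 : g != 0 by apply: contraNneq f0 => g0; rewrite fE g0 mulr0.
have [m gm] : exists m, fact (lead_coef g) m by apply: facR_neq0; rewrite lead_coef_eq0.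
have mn : (m < n)%N.
  rewrite (fact_uniq facR.1 fn (_ : fact _ (1 + m))) // fE lead_coefM lead_coefC.
  by apply: fact_mul => //; exact: fact_prime.
have [s [d [Ss gE Sd]]] := IH m mn g g0 gm.
exists (p%:P * s), d; split=> //; last by rewrite fE gE mulrA.
apply: SprodM => //; exists [:: p%:P]; last by rewrite big_seq1.
by move=> q; rewrite inE => /eqP ->; exists p.
Qed.

Lemma tofrac_injective : injective (@tofrac R).
Proof. by move=> a b /eqP; rewrite tofrac_eq => /eqP. Qed.

(** Nagata's criterion for R[X] inside K[X], with [S] the primes of R; the content is
split off by induction on the number of primes of the leading coefficient. *)
Theorem poly_factorial : factorial {poly R}.
Proof.
apply: (@nagata _ _ i Sconst) => //.
- exact: map_inj_poly tofrac_injective (rmorph0 _).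
- exact: field_poly_factorial.
- by move=> _ [p /polyC_prime pp ->].
- exact: poly_clear_denominators.
- exact: poly_strip.
Qed.
End Gauss.

(** * The coordinate ring of SL2 is factorial *)
Section SL2Factorial.
Variables (k : fieldType) (B : comAlgType k) (x y z w : B).
Hypothesis det : x * w - y * z = 1.
Hypothesis gen_ind : forall Q : B -> Prop, (forall a, Q a%:A) ->
  (forall b c, Q b -> Q c -> Q (b + c)) -> (forall b c, Q b -> Q c -> Q (b * c)) ->
  Q x -> Q y -> Q z -> Q w -> forall b, Q b.
Hypothesis eval : forall (C : comNzRingType) (phi : {rmorphism k -> C}) (a b c d : C),
  a * d - b * c = 1 -> exists f : {rmorphism B -> C},
  [/\ forall t, f t%:A = phi t, f x = a, f y = b, f z = c & f w = d].
Hypothesis z_reg : forall b, z * b = 0 -> b = 0.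
Local Notation P2 := {mpoly k[2]}.
Local Notation P3 := {mpoly k[3]}.

Lemma xw : x * w = 1 + y * z. Proof. by rewrite -det subrK. Qed.

Hypothesis triangular : exists f : {rmorphism B -> {fraction P2}},
  (forall q, f (eval_at [tuple x; y] q) = tofrac q) /\ f z = 0.

(** The quotient by [z] is the ring of functions on upper triangular matrices, a
domain: [z] generates the kernel of the evaluation at the generic one, because
every function is, up to a power of [x], a polynomial in [x] and [y] modulo [z]. *)
Lemma z_prime : prime_elt z.
Proof.
have [f [fe fz]] := triangular.
pose e : {rmorphism P2 -> B} := eval_at [tuple x; y].
have eX : e 'X_0 = x by rewrite /e /= eval_atX (tnth_nth 0).
have eY : e 'X_1 = y by rewrite /e /= eval_atX (tnth_nth 0).
have form b : exists N q c, x ^+ N * b = e q + z * c.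
  elim/gen_ind: b => [a|b b' [N [q [c E]]] [M [r [d E']]]|b b' [N [q [c E]]] [M [r [d E']]]||||].
  - by exists 0%N, a%:MP, 0; rewrite /e /= eval_atC mulr0 addr0 mul1r.
  - exists (N + M)%N, ('X_0 ^+ M * q + 'X_0 ^+ N * r), (x ^+ M * c + x ^+ N * d).
    rewrite (rmorphD e) !(rmorphM e) !(rmorphXn e) /= eX exprD.
    transitivity (x ^+ M * (x ^+ N * b) + x ^+ N * (x ^+ M * b')); first by ring.
    by rewrite E E'; ring.
  - exists (N + M)%N, (q * r), (e q * d + c * e r + c * z * d).
    rewrite (rmorphM e) /= exprD; transitivity (x ^+ N * b * (x ^+ M * b')); first by ring.
    by rewrite E E'; ring.
  - by exists 0%N, 'X_0, 0; rewrite eX mulr0 addr0 mul1r.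
  - by exists 0%N, 'X_1, 0; rewrite eY mulr0 addr0 mul1r.
  - by exists 0%N, 0, 1; rewrite (rmorph0 e) mulr1 add0r mul1r.
  - by exists 1%N, 1, y; rewrite (rmorph1 e) expr1 xw [z * y]mulrC.
have ker b : f b = 0 -> dvd z b.
  move=> fb; have [N [q [c E]]] := form b.
  have q0 : q = 0.
    apply/eqP; rewrite -tofrac_eq0 -(fe : forall q, f (e q) = _); have /eqP := congr1 f E.
    by rewrite (rmorphM f) fb mulr0 (rmorphD f) (rmorphM f) fz mul0r addr0 eq_sym.
  have {E} : dvd z (x ^+ N * b) by exists c; rewrite E q0 (rmorph0 e) add0r.
  elim: N => [|N IH]; first by rewrite mul1r.
  rewrite exprS -mulrA => -[d dE]; apply: IH; exists (w * d - y * (x ^+ N * b)).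
  move: (x ^+ N * b) dE => b' dE.
  transitivity ((x * w - y * z) * b'); first by rewrite det mul1r.
  transitivity (w * (x * b') - z * (y * b')); first by ring.
  by rewrite dE; ring.
split.
- move=> z0; have := z_reg (b := 1); rewrite z0 mul0r => /(_ erefl)/eqP.
  by rewrite oner_eq0.
- move=> [v zv]; have := congr1 f zv; rewrite (rmorphM f) fz mul0r (rmorph1 f) => /esym/eqP.
  by rewrite oner_eq0.
- move=> a b [c /(congr1 f)]; rewrite !(rmorphM f) fz mul0r => /eqP.
  by rewrite mulf_eq0 => /orP[]/eqP/ker; [left | right].
Qed.

Local Notation T := {poly {poly {poly k}}}.
Let b0 : T := 'X.
Let a0 : T := 'X%:P.
Let c0 : T := 'X%:P%:P.

Lemma poly3_ind (Q : T -> Prop) :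
  (forall f g, Q f -> Q g -> Q (f + g)) -> (forall f g, Q f -> Q g -> Q (f * g)) ->
  (forall t, Q t%:P%:P%:P) -> Q c0 -> Q a0 -> Q b0 -> forall f, Q f.
Proof.
move=> QD QM Qk Qc Qa Qb.
have Q1 (p : {poly k}) : Q p%:P%:P.
  elim/poly_ind: p => [|p t IH]; first exact: (Qk 0).
  rewrite (_ : _%:P%:P = p%:P%:P * c0 + t%:P%:P%:P).
    by apply: (QD) => //; apply: QM.
  by rewrite (polyCD (p * 'X)) (polyCM p) (polyCD (p%:P * _)) (polyCM p%:P).
have Q2 (p : {poly {poly k}}) : Q p%:P.
  elim/poly_ind: p => [|p q IH]; first exact: (Qk 0).
  rewrite (_ : _%:P = p%:P * a0 + q%:P%:P); last by rewrite (polyCD (p * 'X)) (polyCM p).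
  by apply: (QD) => //; apply: QM.
elim/poly_ind => [|p q IH]; first exact: (Qk 0).
by apply: (QD) => //; apply: QM.
Qed.

(** The image of the generic matrix is the product
[(1, a; 0, 1) (1, 0; b, 1) (1, c; 0, 1)] of elementary matrices. Conversely
[a = (x - 1) / z], [b = z] and [c = (w - 1) / z], so the two rings agree after inverting
[z]. *)
Lemma SL2_chart : exists i : {rmorphism B -> T},
  [/\ injective i, (forall t, i t%:A = t%:P%:P%:P), i z = b0, i x = 1 + a0 * b0 & i w = 1 + b0 * c0].
Proof.
have det1 : (1 + a0 * b0) * (1 + b0 * c0) - (c0 * (1 + a0 * b0) + a0) * b0 = 1 by ring.
pose cst : {rmorphism k -> T} := polyC \o (polyC \o polyC).
have [i [iA ix iy iz iw]] := eval cst det1.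
exists i; split=> //.
pose e : {rmorphism P3 -> B} := eval_at [tuple x; z; w].
have e3 : [/\ e 'X_0 = x, e 'X_1 = z & e 'X_2 = w].
  by split; rewrite /e /= eval_atX (tnth_nth 0).
case: e3 => eX eZ eW.
(* Up to a power of z every function is a polynomial in x, z and w. *)
have form b : exists N q, z ^+ N * b = e q.
  elim/gen_ind: b => [a|b b' [N [q E]] [M [r E']]|b b' [N [q E]] [M [r E']]||||].
  - by exists 0%N, a%:MP; rewrite /e /= eval_atC mul1r.
  - exists (N + M)%N, ('X_1 ^+ M * q + 'X_1 ^+ N * r).
    rewrite (rmorphD e) !(rmorphM e) !(rmorphXn e) /= eZ -E -E' exprD; ring.
  - by exists (N + M)%N, (q * r); rewrite (rmorphM e) /= -E -E' exprD; ring.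
  - by exists 0%N, 'X_0; rewrite eX mul1r.
  - exists 1%N, ('X_0 * 'X_2 - 1).
    rewrite (rmorphB e) (rmorphM e) (rmorph1 e) /= eX eW xw expr1; ring.
  - by exists 0%N, 'X_1; rewrite eZ mul1r.
  - by exists 0%N, 'X_2; rewrite eW mul1r.
pose F := {fraction P3}; pose X j : F := tofrac 'X_j.
have X1 : X 1 != 0 by rewrite tofrac_eq0 -msize_poly_eq0 msizeX.
(* m3 is the inverse of the chart, with values in k(x, z, w). *)
pose m0 : {rmorphism k -> F} := @tofrac P3 \o @mpolyC 3 k.
have cm (R : nzRingType) (m : {rmorphism R -> F}) u : commr_rmorph m u.
  by move=> r; apply: mulrC.
pose m1 : {rmorphism {poly k} -> F} := horner_morph (cm _ m0 ((X 2%R - 1) / X 1)).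
pose m2 : {rmorphism {poly {poly k}} -> F} := horner_morph (cm _ m1 ((X 0 - 1) / X 1)).
pose m3 : {rmorphism T -> F} := horner_morph (cm _ m2 (X 1)).
have mb : m3 b0 = X 1 by apply: horner_morphX.
have ma : m3 a0 = (X 0 - 1) / X 1 by rewrite /m3 /= horner_morphC; apply: horner_morphX.
have mc : m3 c0 = (X 2%R - 1) / X 1.
  by rewrite /m3 /= horner_morphC /m2 /= horner_morphC; apply: horner_morphX.
have mi q : m3 (i (e q)) = tofrac q.
  apply: (@eval_at_rmorph k B _ 3 [tuple x; z; w] (m3 \o i) (@tofrac P3)) => [t|j].
    by rewrite /= iA /= /m3 /= horner_morphC /m2 /= horner_morphC /m1 /= horner_morphC.
  have : m3 (i x) = X 0.
    by rewrite ix (rmorphD m3) (rmorphM m3) (rmorph1 m3) ma mb divfK // addrC subrK.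
  have : m3 (i z) = X 1 by rewrite iz.
  have : m3 (i w) = X 2%R.
    by rewrite iw (rmorphD m3) (rmorphM m3) (rmorph1 m3) mb mc mulrC divfK // addrC subrK.
  case: j => [[|[|[|//]]] hj] h2 h1 h0; rewrite (tnth_nth 0) /= ?h0 ?h1 ?h2;
   by congr (tofrac 'X_ _); apply/val_inj.
have ker b : i b = 0 -> b = 0.
  move=> ib; have [N [q E]] := form b.
  have q0 : q = 0.
    by apply/eqP; rewrite -tofrac_eq0 -mi -E (rmorphM i) ib mulr0 (rmorph0 m3).
  move: E; rewrite q0 (rmorph0 e); elim: N => [|N IH]; first by rewrite mul1r.
  by rewrite exprS -mulrA => /z_reg.
exact: (raddf_inj ker).
Qed.

Lemma poly3_factorial : factorial T.
Proof. by do 2 apply: poly_factorial; exact: field_poly_factorial. Qed.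

Lemma poly3_unit (u : T) : is_unit u -> exists t, u = t%:P%:P%:P.
Proof.
have cst (R : idomainType) (p : {poly R}) : is_unit p -> exists2 t, is_unit t & p = t%:P.
  move=> [q pq]; have p0 : p != 0 by apply: contra_eq_neq pq => ->; rewrite mul0r eq_sym oner_eq0.
  have q0 : q != 0 by apply: contra_eq_neq pq => ->; rewrite mulr0 eq_sym oner_eq0.
  have := size_mul p0 q0; rewrite pq size_poly1 => sE.
  have sp : (size p <= 1)%N.
    by move: p0 q0 sE; rewrite -!size_poly_gt0; case: (size p) => [//|[//|m]]; case: (size q) => // l; rewrite addSn addnS.
  have pE := size1_polyC sp; exists p`_0 => //.
  exists q`_0; have := congr1 (fun r : {poly R} => r`_0) pq.
  by rewrite [in X in X -> _]pE coefCM coef1.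
move=> /cst[u1 /cst[u2 /cst[t _ ->] ->] ->]; by exists t.
Qed.

(** Nagata's criterion for the single prime [z] and the polynomial ring of the chart.
The degree in [b], the image of [z], bounds the powers of [z] dividing an element. *)
Theorem SL2_factorial : factorial B.
Proof.
have [i [i_inj iA iz ix iw]] := SL2_chart.
have Sz n : Sprod (fun p => p = z) (z ^+ n).
  exists (nseq n z) => [p|]; first by rewrite mem_nseq => /andP[_ /eqP].
  by rewrite big_nseq -iter_mulr_1; elim: n => //= n ->; rewrite ?exprS.
apply: (@nagata _ _ i (fun p => p = z)) => //.
- exact: poly3_factorial.
- by move=> p ->; exact: z_prime.
- move=> d; suff [n [b E]] : exists n b, i (z ^+ n) * d = i b.
    by exists (z ^+ n), b.
  have addc d1 d2 : (exists n b, i (z ^+ n) * d1 = i b) -> (exists n b, i (z ^+ n) * d2 = i b) ->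
      exists n b, i (z ^+ n) * (d1 + d2) = i b.
    move=> [n [b E]] [m [b' E']]; exists (n + m)%N, (z ^+ m * b + z ^+ n * b').
    rewrite exprD (rmorphD i) !(rmorphM i) -E -E'.
    by move: (i (z ^+ n)) (i (z ^+ m)) => s t; ring.
  have mulc d1 d2 : (exists n b, i (z ^+ n) * d1 = i b) -> (exists n b, i (z ^+ n) * d2 = i b) ->
      exists n b, i (z ^+ n) * (d1 * d2) = i b.
    move=> [n [b E]] [m [b' E']]; exists (n + m)%N, (b * b').
    rewrite exprD !(rmorphM i) -E -E'.
    by move: (i (z ^+ n)) (i (z ^+ m)) => s t; ring.
  have Qb : exists n b, i (z ^+ n) * b0 = i b by exists 0%N, z; rewrite (rmorph1 i) mul1r.
  have Qa : exists n b, i (z ^+ n) * a0 = i b.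
    by exists 1%N, (x - 1); rewrite expr1 (rmorphB i) ix iz (rmorph1 i); ring.
  have Qc : exists n b, i (z ^+ n) * c0 = i b.
    by exists 1%N, (w - 1); rewrite expr1 (rmorphB i) iw iz (rmorph1 i); ring.
  have Qk t : exists n b, i (z ^+ n) * t%:P%:P%:P = i b.
    by exists 0%N, t%:A; rewrite (rmorph1 i) mul1r iA.
  exact: (poly3_ind addc mulc Qk Qc Qa Qb).
- move=> d; have [n] := ubnP (size (i d)); elim: n d => // n IH d; rewrite ltnS => dn d0.
  have [[d1 dE]|nd] := pselect (dvd z d); last first.
    by exists 1, d; rewrite mul1r; split=> // [|p ->//]; exact: (Sz 0%N).
  have d10 : d1 <> 0 by move=> e; apply: d0; rewrite dE e mulr0.
  have id10 : i d1 != 0 by apply/eqP => e; apply: d10; apply: i_inj; rewrite e (rmorph0 i).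
  have [|s [d2 [Ss E Sd]]] := IH d1 _ d10.
    by apply: leq_trans dn; rewrite dE (rmorphM i) iz /b0 mulrC size_mulX.
  exists (z * s), d2; split=> //; last by rewrite dE E mulrA.
  by apply: SprodM => //; have := Sz 1%N; rewrite expr1.
Qed.

Lemma SL2_units (u : B) : is_unit u -> exists t, u = t%:A.
Proof.
have [i [i_inj iA iz ix iw]] := SL2_chart.
move=> [v uv]; have [|t tE] := poly3_unit (u := i u).
  by exists (i v); rewrite -(rmorphM i) uv (rmorph1 i).
by exists t; apply: i_inj; rewrite iA.
Qed.
End SL2Factorial.

Section CoordinateRing.
Variable k : fieldType.
Local Notation B := (OSL2 k).
Local Notation P4 := {mpoly k[4]}.

(** If [z p] is a multiple [r] of the relation, setting [z = 0] shows that [z] divides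
[r], since the relation becomes the nonzero polynomial [x w - 1]. *)
Lemma zB_reg (b : B) : zB k * b = 0 -> b = 0.
Proof.
rewrite -{2}[b]toB_liftB -[b in X in X -> _]toB_liftB; move: (liftB b) => p {b}.
rewrite /zB -(rmorphM (@toB k)) -(rmorph0 (@toB k)) => /toB_eq[r]; rewrite subr0 => E.
pose e : {rmorphism P4 -> P4} := mmap (@mpolyC 4 k) (tnth [tuple 'X_0; 'X_1; 0; 'X_3]).
have eC t : e t%:MP = t%:MP by rewrite /e /= mmapC.
have eX j : e 'X_j = tnth [tuple 'X_0; 'X_1; 0; 'X_3] j by rewrite /e /= mmapX mmap1U.
have sub_e q : exists q', q = e q + 'X_2 * q'.
  elim/mpoly_gen_ind: q => [t|q1 q2 [s1 E1] [s2 E2]|q1 q2 [s1 E1] [s2 E2]|j].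
  - by exists 0; rewrite eC mulr0 addr0.
  - by exists (s1 + s2); rewrite (rmorphD e) {1}E1 {1}E2; ring.
  - exists (e q1 * s2 + s1 * e q2 + 'X_2 * s1 * s2).
    by rewrite (rmorphM e) {1}E1 {1}E2; ring.
  rewrite eX; case: j => [[|[|[|[|//]]]] hj]; rewrite (tnth_nth 0) /=.
  - by exists 0; rewrite mulr0 addr0; congr 'X_ _; apply/val_inj.
  - by exists 0; rewrite mulr0 addr0; congr 'X_ _; apply/val_inj.
  - by exists 1; rewrite mulr1 add0r; congr 'X_ _; apply/val_inj.
  - by exists 0; rewrite mulr0 addr0; congr 'X_ _; apply/val_inj.
have X2 : ('X_2 : P4) != 0 by rewrite -msize_poly_eq0 msizeX.
have D0 : e (det_rel k) != 0.
  rewrite /det_rel (rmorphB e) (rmorph1 e) (rmorphB e) !(rmorphM e) !eX !(tnth_nth 0) /= mulr0 subr0.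
  apply/eqP => /(congr1 (meval (fun _ => 0))).
  rewrite mevalB mevalM !mevalXU meval1 meval0 mul0r sub0r => /eqP.
  by rewrite oppr_eq0 oner_eq0.
have [r' rE] := sub_e r.
have er : e r = 0.
  apply/eqP; have /eqP := congr1 e E; rewrite !(rmorphM e) eX (tnth_nth 0) /= mul0r.
  by rewrite eq_sym mulf_eq0 (negPf D0) orbF.
apply/toB_eq; exists r'; rewrite subr0; apply: (mulfI X2).
by rewrite E {1}rE er add0r mulrA.
Qed.

Lemma OSL2_factorial : factorial B.
Proof. exact: (SL2_factorial (detB k) (@OSL2_ind k) (@OSL2_eval k) (@zB_reg) (@OSL2_triangular k)). Qed.

Lemma OSL2_units (u : B) : is_unit u -> exists t, u = t%:A.
Proof. exact: (SL2_units (detB k) (@OSL2_ind k) (@OSL2_eval k) (@zB_reg)). Qed.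
End CoordinateRing.

(** * Invariants of a factorial domain without nontrivial semi-invariants *)

(** [R] is the ring of invariants of automorphisms [sigma_ h] of the factorial domain
[D]. The hypothesis [semi] says that a nonzero element multiplied by a unit by every
automorphism is invariant. *)
Section FactorialInvariants.
Variables (D R : comNzRingType) (i : {rmorphism R -> D}).
Variables (I : Type) (H : I -> Prop) (sigma_ : I -> {rmorphism D -> D}).
Implicit Types (a b c g : D) (r : R).
Hypothesis i_inj : injective i.
Hypothesis facD : factorial D.
Hypothesis imP : forall b, (exists r, i r = b) <-> forall h, H h -> sigma_ h b = b.
Hypothesis sg_inv : forall h, H h -> exists2 h', H h' & forall b, sigma_ h (sigma_ h' b) = b.
Hypothesis semi : forall g, g <> 0 ->
  (forall h, H h -> exists2 u, is_unit u & sigma_ h g = u * g) ->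
  forall h, H h -> sigma_ h g = g.

Let domD : domain D := facD.1.
Let inv b := forall h, H h -> sigma_ h b = b.

Lemma inv_cofactor g a : g <> 0 -> inv g -> inv (g * a) -> inv a.
Proof.
move=> g0 ig iga h Hh; apply: (dom_cancel domD g0).
by rewrite -{1}(ig h Hh) -rmorphM iga.
Qed.

(** A greatest common divisor of two invariants is unique up to units, so it is a
semi-invariant. *)
Lemma gcd_semi_invariant g a b : inv (g * a) -> inv (g * b) -> g * a <> 0 ->
  (forall c, dvd a (b * c) -> dvd a c) -> inv g.
Proof.
move=> ia ib ga0 cop.
have g0 : g <> 0 by move=> g0; apply: ga0; rewrite g0 mul0r.
have a0 : a <> 0 by move=> a0; apply: ga0; rewrite a0 mulr0.
have sg_dvd h : H h -> exists e, g = sigma_ h g * e.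
  move=> Hh; have ea : sigma_ h g * sigma_ h a = g * a by rewrite -rmorphM ia.
  have eb : sigma_ h g * sigma_ h b = g * b by rewrite -rmorphM ib.
  have sg0 : sigma_ h g <> 0 by move=> e; apply: ga0; rewrite -ea e mul0r.
  have [e eE] : dvd a (sigma_ h a).
    apply: cop; exists (sigma_ h b); apply: (dom_cancel domD g0); apply: (dom_cancel domD sg0).
    transitivity (g * b * (sigma_ h g * sigma_ h a)); first by ring.
    by rewrite -eb ea; ring.
  exists e; apply: (dom_cancel domD a0).
  by rewrite [LHS]mulrC -ea eE; ring.
apply: semi => // h Hh; have [h' Hh' hh'] := sg_inv Hh.
have [e eE] := sg_dvd h Hh; have [e' e'E] := sg_dvd h' Hh'.
have e2 : sigma_ h g = sigma_ h e' * g.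
  by rewrite {1}e'E rmorphM hh' mulrC.
exists (sigma_ h e') => //; exists e; apply: (dom_cancel domD g0).
by rewrite mulr1 [RHS]eE e2; ring.
Qed.

Lemma inv_i r : inv (i r). Proof. by apply/imP; exists r. Qed.
Lemma inv_lift b : inv b -> exists r, i r = b. Proof. by move/imP. Qed.

Lemma i_unit r : is_unit (i r) -> is_unit r.
Proof.
move=> [v rv]; have r0 : i r <> 0.
  by move=> e; move: rv; rewrite e mul0r => /esym/eqP; rewrite oner_eq0.
have [|r' r'E] := @inv_lift v.
  apply: (inv_cofactor r0 (@inv_i r)); rewrite rv => h _; exact: rmorph1.
by exists r'; apply: i_inj; rewrite rmorphM r'E rmorph1.
Qed.

Lemma invariants_domain : domain R.
Proof.
move=> a b ab; have /domD : i a * i b = 0 by rewrite -rmorphM ab rmorph0.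
by case=> e; [left | right]; apply: i_inj; rewrite e rmorph0.
Qed.

Lemma i_neq0 r : r <> 0 -> i r <> 0.
Proof. by move=> r0 e; apply: r0; apply: i_inj; rewrite e rmorph0. Qed.

Lemma irreducible_neq0 r : irreducible r -> r <> 0.
Proof.
move=> [nu irr] r0; apply: nu.
by have [] := irr 0 0; rewrite ?r0 ?mulr0.
Qed.

(** The greatest common divisor in [D] of [r] and [a] is invariant, and so are the
cofactors: [r = g r'] is a factorization in [R]. If [r'] is a unit, [r] divides
[a]; if [g] is one, [r] is coprime to [a] and divides [b]. *)
Lemma irreducible_prime r : irreducible r -> prime_elt r.
Proof.
move=> irr; have r0 := irreducible_neq0 irr; split=> //; first exact: irr.1.
move=> a b [c abE].
have ir0 := i_neq0 r0; have [n fr] := facD.2 _ ir0.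
have [g [r' [a' [rE aE cop]]]] := fact_coprime domD (i a) fr.
have ig : inv g.
  apply: gcd_semi_invariant cop; first by rewrite -rE; apply: inv_i.
    by rewrite -aE; apply: inv_i.
  by rewrite -rE.
have g0 : g <> 0 by move=> g0; apply: ir0; rewrite rE g0 mul0r.
have ir' : inv r' by apply: (inv_cofactor g0 ig); rewrite -rE; apply: inv_i.
have ia' : inv a' by apply: (inv_cofactor g0 ig); rewrite -aE; apply: inv_i.
have r'0 : r' <> 0 by move=> r'0; apply: ir0; rewrite rE r'0 mulr0.
have [ga gaE] := inv_lift ig; have [ro roE] := inv_lift ir'; have [al alE] := inv_lift ia'.
have {}rE : r = ga * ro by apply: i_inj; rewrite rmorphM gaE roE.
have {}aE : a = ga * al by apply: i_inj; rewrite rmorphM gaE alE.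
have [[v gv]|[v rv]] := irr.2 _ _ rE; last first.
  by left; exists (v * al); rewrite rE aE; transitivity (ga * al * (ro * v)); [rewrite rv mulr1 | ring].
right; have [|e bE] := cop (i b).
  exists (i c); apply: (dom_cancel domD g0).
  by rewrite -gaE -roE -alE -!rmorphM mulrA -aE abE rE mulrA.
have [|ep epE] := @inv_lift e.
  by apply: (inv_cofactor r'0 ir'); rewrite -bE; apply: inv_i.
exists (v * ep); rewrite rE.
have -> : b = ro * ep by apply: i_inj; rewrite rmorphM roE epE.
by transitivity (ga * v * (ro * ep)); [rewrite gv mul1r | ring].
Qed.

(** The number of prime factors in [D] decreases strictly, since nonunits of [R] stay
nonunits in [D]. *)
Lemma irreducible_factorization r : r <> 0 -> ~ is_unit r ->
  exists2 s : seq R, {in s, forall p, irreducible p} & r = \prod_(p <- s) p.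
Proof.
move=> r0; have [n fr] := facD.2 _ (i_neq0 r0).
elim/ltn_ind: n r r0 fr => n IH r r0 fr nu.
have [irr|nirr] := pselect (irreducible r).
  by exists [:: r]; [move=> p; rewrite inE => /eqP -> | rewrite big_seq1].
have [a [b [rE [na nb]]]] : exists a b : R, r = a * b /\ ~ is_unit a /\ ~ is_unit b.
  apply: contra_notP nirr => nex; split=> // a b rE; apply: contrapT => /not_orP[na nb].
  by apply: nex; exists a, b.
have a0 : a <> 0 by move=> a0; apply: r0; rewrite rE a0 mul0r.
have b0 : b <> 0 by move=> b0; apply: r0; rewrite rE b0 mulr0.
have [m fa] := facD.2 _ (i_neq0 a0); have [l fb] := facD.2 _ (i_neq0 b0).
have nE : n = (m + l)%N.
  by apply: (fact_uniq domD fr); rewrite rE rmorphM; apply: fact_mul.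
have m0 : (0 < m)%N by case: m fa nE => // /fact0_unit/i_unit.
have l0 : (0 < l)%N by case: l fb nE => // /fact0_unit/i_unit.
have [|s si sE] := IH m _ a a0 fa na; first by rewrite nE -addn1 leq_add2l.
have [|t ti tE] := IH l _ b b0 fb nb; first by rewrite nE -add1n leq_add2r.
exists (s ++ t); last by rewrite big_cat rE sE tE.
by move=> p; rewrite mem_cat => /orP[/si|/ti].
Qed.

Theorem invariants_UFD : is_UFD R.
Proof.
split; [exact: invariants_domain | exact: irreducible_factorization |].
move=> s t si ti st; apply: (prime_factorization_unique invariants_domain (unit1 R)).
- by move=> p /si /irreducible_prime.
- by move=> p /ti /irreducible_prime.
- by rewrite mul1r.
Qed.
End FactorialInvariants.

(** * The binary icosahedral invariants are factorial *)
Section BinaryIcosahedral.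
Variable k : fieldType.
Hypothesis char0 : [pchar k] =i pred0.
Variables (z s : k).
Hypothesis z5 : 5.-primitive_root z.
Hypothesis s5 : s ^+ 2 = 5%:R.
Local Notation B := (OSL2 k).

Lemma minus_det : \det (mx2 (-1) 0 0 (-1) : 'M[k]_2) == 1.
Proof. by rewrite det_mx2 mulrNN mulr1 mul0r subr0. Qed.
Definition SL2_minus : SL2 k := SL2Sub minus_det.

Lemma SL2_det (g : SL2 k) : val g 0 1 * val g 1 0 = val g 0 0 * val g 1 1 - 1.
Proof.
by have /eqP := valP g; rewrite {1}[val g]mx2E det_mx2 => e; rewrite -[X in _ - X]e subKr.
Qed.

(** Cayley-Hamilton for the traces 0, and 1 or -1 in the next lemma. *)
Lemma SL2_sq (g : SL2 k) : val g 0 0 + val g 1 1 = 0 -> (g * g)%g = SL2_minus.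
Proof.
move=> /eqP; rewrite addr_eq0 => /eqP tr; have := SL2_det g; rewrite tr => dt.
apply/val_inj; rewrite /= [val g]mx2E mul_mx2 tr; congr mx2; ring: dt.
Qed.

Lemma SL2_cube (g : SL2 k) : (val g 0 0 + val g 1 1) ^+ 2 = 1 ->
  (g * g * g = SL2_minus \/ g * g * g = 1)%g.
Proof.
move=> /eqP; have dt := SL2_det g; rewrite sqrf_eq1.
have E : val g = mx2 (val g 0 0) (val g 0 1) (val g 1 0) (val g 1 1) by exact: mx2E.
move: (val g 0 0) (val g 0 1) (val g 1 0) (val g 1 1) E dt => a b c d E dt.
case/orP=> /eqP.
  move/(canRL (addrK _)) => aE; left; apply/val_inj; rewrite /= E !mul_mx2.
  by rewrite {}aE in dt *; congr mx2; ring: dt.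
move/(canRL (addrK _)) => aE; right; apply/val_inj; rewrite /= E !mul_mx2 [RHS]mx2E !mxE /=.
by rewrite {}aE in dt *; congr mx2; ring: dt.
Qed.

Section SemiInvariant.
Variable g : B.
Hypothesis g0 : g <> 0.
Definition weight (h : SL2 k) (c : k) := act h g = c *: g.

Lemma weight_mul h h' c c' : weight h c -> weight h' c' -> weight (h * h')%g (c * c').
Proof.
rewrite /weight act_mul => hc ->; have := act_lin h c' 0 g 0.
by rewrite !scale0r !addr0 hc scalerA mulrC.
Qed.

Lemma weight_uniq h c c' : weight h c -> weight h c' -> c = c'.
Proof.
move=> hc hc'; apply/eqP; rewrite -subr_eq0; apply/negPn/negP => d0.
apply: g0; rewrite -(scale1r g) -(mulVf d0) -scalerA scalerBl.
by rewrite -[c *: g]hc -[c' *: g]hc' subrr scaler0.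
Qed.

Lemma weight_one : weight 1%g 1.
Proof. by rewrite /weight act_one scale1r. Qed.

(** The binary icosahedral group is perfect, so a semi-invariant has trivial weights.
Let [c], [b], [a] be the weights of [psi], [kappa] and [j]. The elements [j], [kappa]
and [j kappa] have square [-1], so [a^2 = b^2 = a^2 b^2] is the weight 1 of [-1].
From [psi j psi = j] and [psi^5 = 1] follows [c = 1]. Finally [psi^2 kappa] and
[psi kappa j] have trace 1 or -1, so their cubes are central and [b^3 = (a b)^3 = 1],
whence [b = a = 1]. *)
Lemma BI_weight_trivial :
  (forall h, SL2_of (S_BI z s) h -> exists2 c, c != 0 & weight h c) ->
  forall h, SL2_of (S_BI z s) h -> act h g = g.
Proof.
move=> wt.
have zn := zeta5_neq0 z5; have dj : \det (quat_j k) = 1.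
  by rewrite det_mx2 mul0r sub0r mul1r opprK.
pose P := SL2Sub (introT eqP (det_psi zn)).
pose J := SL2Sub (introT eqP dj).
pose K := SL2Sub (introT eqP (det_kappa z5 s5 (five_neq0 char0))).
have [c c0 wP] : exists2 c, c != 0 & weight P c by apply: wt; left; left.
have [b b0 wK] : exists2 c, c != 0 & weight K c by apply: wt; left; right.
have [a a0 wJ] : exists2 c, c != 0 & weight J c by apply: wt; right.
have JJ : (J * J)%g = SL2_minus by apply: SL2_sq; rewrite /= !mxE /= addr0.
have KK : (K * K)%g = SL2_minus.
  by apply: SL2_sq; rewrite /= kappaE !mxE /= mulrN subrr.
have JK : ((J * K) * (J * K))%g = SL2_minus.
  by apply: SL2_sq; rewrite /= kappaE /quat_j mul_mx2 !mxE /=; ring.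
have PJP : (P * J * P)%g = J.
  apply/val_inj; rewrite /= /psi /quat_j !mul_mx2.
  by rewrite !(mul0r, mulr0, addr0, add0r, mulr1, mulrN1, mulNr) mulfV // mulVf.
have P5 : (P * P * P * P * P)%g = 1%g.
  apply/val_inj; rewrite /= /psi !mul_mx2 !(mul0r, mulr0, addr0, add0r) [RHS]mx2E !mxE /=.
  have e : z * z * z * z * z = 1 by rewrite -(prim_expr_order z5); ring.
  by congr mx2; rewrite // -!invfM e invr1.
have wm := weight_mul wJ wJ; rewrite JJ in wm.
have bb : b * b = a * a by have := weight_mul wK wK; rewrite KK => /weight_uniq; apply.
have ab : a * b * (a * b) = a * a.
  by have := weight_mul (weight_mul wJ wK) (weight_mul wJ wK); rewrite JK => /weight_uniq; apply.
have aa : a * a = 1.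
  apply: (mulfI (mulf_neq0 a0 a0)); rewrite mulr1 -[RHS]ab -{2}bb; ring.
have cc : c * c = 1.
  have := weight_mul (weight_mul wP wJ) wP; rewrite PJP => /weight_uniq/(_ wJ) e.
  by apply: (mulfI a0); rewrite mulr1 -{2}e; ring.
have c1 : c = 1.
  have := weight_mul (weight_mul (weight_mul (weight_mul wP wP) wP) wP) wP.
  by rewrite P5 => /weight_uniq/(_ weight_one); rewrite cc mul1r cc mul1r.
rewrite aa in wm bb.
have cube h e : weight h e -> (val h 0 0 + val h 1 1) ^+ 2 = 1 -> e * e * e = 1.
  move=> he tr; have := weight_mul (weight_mul he he) he.
  have [->|->] := SL2_cube tr => w3; first exact: (weight_uniq w3 wm).
  exact: (weight_uniq w3 weight_one).
have tr1 : (s^-1 * ((z ^+ 4 - z) * (z ^+ 2 - z ^+ 3))) ^+ 2 = 1.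
  rewrite !exprMn exprVn (kappa_prod_sq z5) s5 mulVf //; exact: (five_neq0 char0).
have z5e := prim_expr_order z5; have zVE : z^-1 = z ^+ 4.
  by apply: (mulfI zn); rewrite mulfV // -exprS.
have b1 : b = 1.
  have := @cube (P * P * K)%g _ (weight_mul (weight_mul wP wP) wK).
  rewrite c1 !mul1r bb mul1r; apply; apply: etrans tr1; congr (_ ^+ 2).
  rewrite /= kappaE /psi !mul_mx2 !mxE /= zVE; ring: z5e.
have a1 : a = 1.
  have := @cube (P * K * J)%g _ (weight_mul (weight_mul wP wK) wJ).
  rewrite c1 b1 !mul1r aa mul1r; apply; apply: etrans tr1; congr (_ ^+ 2).
  rewrite /= kappaE /psi /quat_j !mul_mx2 !mxE /= zVE; ring: z5e.
move=> h [[|]|] hE.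
- have -> : h = P by apply: val_inj.
  by rewrite /weight c1 scale1r in wP.
- have -> : h = K by apply: val_inj.
  by rewrite /weight b1 scale1r in wK.
- have -> : h = J by apply: val_inj.
  by rewrite /weight a1 scale1r in wJ.
Qed.
End SemiInvariant.

Lemma subgroup_genV (S : set (SL2 k)) h : subgroup_gen S h -> subgroup_gen S h^-1%g.
Proof. by move=> Sh G GS; case: (GS) => -[_ _ GV] _; apply: GV; exact: Sh. Qed.

(** Units of k[SL2] are scalars, so the weights of a semi-invariant lie in k. *)
Theorem binary_icosahedral_UFD : is_UFD (invariant_ring (BI120 z s)).
Proof.
set H := BI120 z s.
apply: (@invariants_UFD B _ (@inv_val k H) (SL2 k) H (fun h => @act k h)).
- exact: val_inj.
- exact: OSL2_factorial.
- by move=> b; exact: inv_val_image.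
- move=> h Hh; exists h^-1%g; first exact: subgroup_genV.
  by move=> b; apply: etrans (esym (act_mul h h^-1%g b)) _; rewrite mulgV act_one.
move=> g g0 sigma_; suff : invariants H g by [].
rewrite /H invariants_gen; apply: (BI_weight_trivial g0) => h Sh.
have [|u uu uE] := sigma_ h; first exact: sub_gen_smallest.
have [t tE] := OSL2_units uu; exists t.
  apply/eqP => t0; have [v uv] := uu; move: uv; rewrite tE t0 scale0r mul0r => /esym/eqP.
  by rewrite oner_eq0.
by rewrite /weight uE tE -scalerAl mul1r.
Qed.
End BinaryIcosahedral.

Theorem theorem3p3 (k : closedFieldType) (char0 : [pchar k] =i pred0)
    (zeta : nat -> k)
    (zetaP : forall n, (0 < n)%N -> n.-primitive_root (zeta n))
    (i : k) (iP : i ^+ 2 = -1) (sqrt5 : k) (sqrt5P : sqrt5 ^+ 2 = 5) :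
  let x : {mpoly k[2]} := 'X_0 in
  let y : {mpoly k[2]} := 'X_1 in
  (forall n, (2 <= n)%N ->
     invariants (Zgroup (zeta n)) =
     subalgebra_gen (hat (x ^+ n + y ^+ n) `|` hat (x * y))) /\
  (forall n, odd n -> (3 <= n)%N ->
     invariants (Zgroup (zeta n)) = subalgebra_gen (hat (x ^+ n + y ^+ n))) /\
  (forall n, odd n -> (3 <= n)%N ->
     invariants (Zgroup (zeta (2 * n)%N)) =
     subalgebra_gen
       (hat (x ^+ (2 * n) + (x * y) ^+ n + y ^+ (2 * n)))) /\
  (forall n, (2 <= n)%N ->
     invariants (BDgroup (zeta (2 * n)%N)) =
     subalgebra_gen (hat (x ^+ (2 * n) + y ^+ (2 * n)))) /\
  invariants (BT24 i) = subalgebra_gen (hat (x * y * (x ^+ 4 - y ^+ 4))) /\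
  invariants (BO48 i (zeta 8%N)) =
    subalgebra_gen (hat (x ^+ 8 + 14 * x ^+ 4 * y ^+ 4 + y ^+ 8)) /\
  invariants (BI120 (zeta 5%N) sqrt5) =
    subalgebra_gen
      (hat (x * y * (x ^+ 10 + 11 * x ^+ 5 * y ^+ 5 - y ^+ 10))) /\
  is_UFD (invariant_ring (BI120 (zeta 5%N) sqrt5)).
Proof.
split=> [n n1|]; first exact: (invariants_cyclic char0 (zetaP n (ltnW n1)) n1).
split=> [n on n2|].
  by apply: (invariants_cyclic_odd char0 _ on n2); apply: zetaP; case: n n2 {on}.
split=> [n on n2|].
  by apply: (invariants_cyclic_double_odd char0 on n2); apply: zetaP; case: n n2 {on}.
split=> [n n1|].
  by apply: (invariants_binary_dihedral char0 n1); apply: zetaP; case: n n1.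
have z5 : 5.-primitive_root (zeta 5%N) by apply: zetaP.
split; first exact: (invariants_binary_tetrahedral char0 iP).
split; first exact: (invariants_binary_octahedral char0 iP (zetaP 8%N isT)).
split; first exact: (invariants_binary_icosahedral char0 z5 sqrt5P).
exact: (binary_icosahedral_UFD char0 z5 sqrt5P).
Qed.
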